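(* For every $\epsilon > 0$ and finite set $J$, there exist $\delta > 0$ and $T > 0$ such that the following holds. Let $V = V^{(N)} = (J, (V_j)_{j \in J}, r, H)$ be a family of hypergraph systems and let $\nu = \nu^{(N)}$ be weighted hypergraphs on $V^{(N)}$ satisfying the $H$-linear forms condition with rate $\tau$. Then there is $N_0$, depending only on $\epsilon$, $J$ and $\tau$, such that for every $N \geq N_0$ and every weighted hypergraph $g$ on $V = V^{(N)}$ with $0 \leq g \leq \nu$: if $$\mathbb{E}\Bigl[ \prod_{e \in H} g_e(x_e) \Big| x \in V_J \Bigr] \leq \delta,$$ then for each $e \in H$ there exists a set $E'_e \subseteq V_e$ for which $V_e \setminus E'_e$ has complexity at most $T$ and such that $$\prod_{e \in H} 1_{E'_e}(x_e) = 0 \quad \text{for all } x \in V_J$$ and for all $e \in H$ one has $$\mathbb{E}\bigl[ g_e(x_e) 1_{V_e \setminus E'_e}(x_e) \,\big|\, x_e \in V_e \bigr] \leq \epsilon.$$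
   Context: A hypergraph system is a quadruple $V = (J, (V_j)_{j\in J}, r, H)$, where $J$ is a finite set, the $V_j$ are finite non-empty sets, $r \geq 1$ is an integer, and $H \subseteq \binom{J}{r} := \{e \subseteq J : |e| = r\}$. For $e \subseteq J$ put $V_e := \prod_{j \in e} V_j$; for $x = (x_j)_{j\in J} \in V_J$ and $J' \subseteq J$ put $x_{J'} := (x_j)_{j \in J'} \in V_{J'}$; and put $\partial e := \{ f \subsetneq e : |f| = |e|-1\}$. A weighted hypergraph on $V$ is a collection $g = (g_e)_{e \in H}$ of functions $g_e : V_e \to \mathbb{R}_{\geq 0}$; $0$ denotes the weighted hypergraph with all $g_e \equiv 0$, and $g \leq \nu$ means $g_e(x_e) \leq \nu_e(x_e)$ for all $e \in H$ and $x_e \in V_e$. $\mathbb{E}[\,\cdot \mid \cdots]$ is the average over the indicated variables, chosen uniformly and independently. Linear forms condition: let $J, r, H$ be fixed and let $V = V^{(N)} = (J, (V_j^{(N)})_{j \in J}, r, H)$ be hypergraph systems with weighted hypergraphs $\nu = \nu^{(N)}$. For $\omega \in \{0,1\}^e$ write $x_e^{(\omega)} := (x_j^{(\omega_j)})_{j \in e}$. The family $\nu$ satisfies the $H$-linear forms condition with rate $\tau$, where $\tau(N) \to 0$ as $N \to \infty$, if for every choice of exponents $n_{e,\omega} \in \{0,1\}$ and every $N$, $$\Bigl| \mathbb{E}\Bigl[\prod_{e \in H} \prod_{\omega \in \{0,1\}^e} \nu_e(x_e^{(\omega)})^{n_{e,\omega}} \Big| x_J^{(0)}, x_J^{(1)}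 \in V_J \Bigr] - 1 \Bigr| \leq \tau(N).$$ In other words each such expectation is $1+o(1)$, and $\tau$ bounds the $o(1)$ term. Complexity of a set: for $e$ of size $r$ and $E_e \subseteq V_e$, the complexity of $E_e$ is the minimum integer $T$ such that there is a partition of $E_e$ into $T$ sets $E_{e,1}, \dots, E_{e,T}$ where, for each $i$, there exist $B_{f,i} \subseteq V_f$ for $f \in \partial e$ with $1_{E_{e,i}}(x_e) = \prod_{f \in \partial e} 1_{B_{f,i}}(x_f)$ for all $x_e \in V_e$. *)

(* Defs.v *)
From HB Require Import structures.
From mathcomp Require Import all_boot all_order all_algebra.
From mathcomp Require Import reals.

Set Implicit Arguments.
Unset Strict Implicit.
Unset Printing Implicit Defensive.

Import Order.TTheory GRing.Theory Num.Theory.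

Local Open Scope ring_scope.

Section HypergraphSystem.
Variables (J : finType) (V : J -> finType).

Definition vprod (e : {set J}) : finType :=
  {dffun forall j : {j : J | j \in e}, V (val j)}.

Definition vrestr (e f : {set J}) (fe : f \subset e) (x : vprod e) : vprod f :=
  [ffun j : {j : J | j \in f} =>
    (x (exist _ (val j) (subsetP fe (val j) (valP j))) : V (val j))].

(* The full product V_J is vprod V [set: J]. *)
Definition proj (e : {set J}) (x : vprod [set: J]) : vprod e :=
  vrestr (subsetT e) x.

Definition boundary (e : {set J}) : {set {set J}} :=
  [set f : {set J} | (f \proper e) && (#|f| == #|e|.-1)].

Lemma boundary_sub (e f : {set J}) : f \in boundary e -> f \subset e.
Proof. by rewrite inE => /andP[/proper_sub]. Qed.

Definition boundary_product (e : {set J}) (E : {set vprod e}) : Prop :=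
  exists B : forall f : {set J}, {set vprod f},
    forall x : vprod e,
      (x \in E : nat) =
      (\prod_(f : {f : {set J} | f \in boundary e})
          (vrestr (boundary_sub (valP f)) x \in B (val f)))%N.

Definition splits_into (e : {set J}) (E : {set vprod e}) (t : nat) : Prop :=
  exists P : {set {set vprod e}},
    [/\ partition P E, #|P| = t
      & forall A : {set vprod e}, A \in P -> boundary_product A].

(* A relation rather than a function: when #|e| = 1 every part is empty or
   full, so that most sets admit no partition at all. *)
Definition complexity (e : {set J}) (E : {set vprod e}) (t : nat) : Prop :=
  splits_into E t /\ forall s : nat, splits_into E s -> (t <= s)%N.

Definition twisted (e : {set J}) (x0 x1 : vprod [set: J])
    (w : {ffun {j : J | j \in e} -> bool}) : vprod e :=
  [ffun j : {j : J | j \in e} =>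
    ((if w j then proj e x1 j else proj e x0 j) : V (val j))].

End HypergraphSystem.

Definition uniform_hypergraph (J : finType) (r : nat) (H : {set {set J}}) : Prop :=
  forall e : {set J}, e \in H -> #|e| = r.

Definition avg (R : realType) (X : finType) (f : X -> R) : R :=
  (\sum_(x : X) f x) / #|X|%:R.

(* Weights are carried by every set e of indices; only those with e in H are
   ever constrained or used. *)
Definition weights (R : realType) (J : finType) (V : J -> finType) : Type :=
  forall e : {set J}, vprod V e -> R.

Definition weights_le (R : realType) (J : finType) (V : J -> finType)
    (H : {set {set J}}) (g h : weights R V) : Prop :=
  forall e : {set J}, e \in H -> forall x : vprod V e, g e x <= h e x.

Definition weights0 (R : realType) (J : finType) (V : J -> finType) :
  weights R V := fun _ _ => 0.
Arguments weights0 R {J} V e x.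

Definition linear_forms_condition (R : realType) (J : finType)
    (H : {set {set J}}) (V : nat -> J -> finType)
    (nu : forall N : nat, weights R (V N)) (tau : nat -> R) : Prop :=
  forall (n : forall e : {set J}, {ffun {j : J | j \in e} -> bool} -> bool)
         (N : nat),
    `| avg (fun x : vprod (V N) [set: J] * vprod (V N) [set: J] =>
         \prod_(e in H) \prod_(w : {ffun {j : J | j \in e} -> bool})
            nu N e (twisted x.1 x.2 w) ^+ n e w) - 1 | <= tau N.

(* Main.v *)
Require Import Defs.
From HB Require Import structures.
From mathcomp Require Import all_boot all_order all_algebra.
From mathcomp Require Import classical_sets reals topology normedtype sequences.
From mathcomp Require Import ring lra.

(** Why the theorem is true. There are three ingredients: a removal lemma for
    weights bounded by [1], bounded models of the given weights, and a counting
    lemma saying that the models have the same count.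

    Dense removal. Colour the edges by whether their weight is large. By strong
    regularity one finds colourings of the faces of size [r - 1], then of size
    [r - 2], and so on, each of which predicts the colours one size above: given
    the colours of the facets, a colour behaves like a random set of a certain
    density, up to a cut norm that is tiny even compared with the number of
    colours chosen afterwards for the smaller faces ([strong_regularity]).
    Discard the patterns of colours that contain a rare colour, or on which the
    prediction is bad. This costs little. Every configuration of remaining
    patterns then occurs with positive probability: replace the indicators of the
    colours by their densities, the largest faces first. The error made at a face
    is small relative to the cell of that face, and has to be compared with the
    cell of the whole configuration. This comparison is part of the statement
    proved by induction on the size of the faces ([cell_counting_all]): since the
    errors at small faces are chosen much smaller than everything that happens at
    larger faces, conditioning on the colours of further faces changes averages by
    a bounded factor only. Hence, if the edges with their patterns kept could
    cover [H] at some configuration, the count would be bounded below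
    ([dense_removal]).

    Bounded models. If [nu - 1] has tiny cut norm and [0 <= g <= nu], then [g] is
    close in cut norm to a function with values in [0, 1], namely a truncated sum
    of boundedly many signed indicators of boxes. The boxes are chosen greedily
    and a convex potential bounds their number ([dense_model]). The linear forms
    condition makes the cut norm of [nu - 1] tiny, by repeated use of the
    Cauchy--Schwarz inequality ([doubled_bound], [cut_nu]).

    Counting. To pass from [g] to its models, one edge [e0] at a time, take out
    the weight on [e0] by the Cauchy--Schwarz inequality. The linear forms
    condition allows it to be replaced by [1], and then shows that the weight
    which the other edges induce on [e0] may be truncated to a bounded function. This
    leaves averages in which [e0] carries a bounded weight
    ([relative_counting]).

    Finally the sets that dense removal provides for the models also work for
    [g], because their complements are unions of boundedly many boxes and the
    models are close to [g] in cut norm ([relative_removal]). *)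

Set Implicit Arguments.
Unset Strict Implicit.
Unset Printing Implicit Defensive.

Import Order.TTheory GRing.Theory Num.Theory.
Import numFieldNormedType.Exports.

Local Open Scope ring_scope.

(** * Averages, product spaces and the cut norm *)

Notation "'\E_' x F" := (avg (fun x => F))
  (at level 36, x name, F at level 36, only parsing) : ring_scope.

Section Averages.
Variable R : realType.
Implicit Types (X Y : finType).

Lemma eq_avg X (f g : X -> R) : f =1 g -> avg f = avg g.
Proof. by move=> fg; rewrite /avg (eq_bigr g). Qed.

Lemma avgD X (f g : X -> R) : \E_ x (f x + g x) = avg f + avg g.
Proof. by rewrite /avg big_split mulrDl. Qed.

Lemma avgN X (f : X -> R) : \E_ x (- f x) = - avg f.
Proof. by rewrite /avg sumrN mulNr. Qed.

Lemma avgB X (f g : X -> R) : \E_ x (f x - g x) = avg f - avg g.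
Proof. by rewrite avgD avgN. Qed.

Lemma avgZ X (a : R) (f : X -> R) : \E_ x (a * f x) = a * avg f.
Proof. by rewrite /avg -mulr_sumr mulrA. Qed.

Lemma avgZr X (a : R) (f : X -> R) : \E_ x (f x * a) = avg f * a.
Proof. by rewrite /avg -mulr_suml mulrAC. Qed.

Lemma avg_sum X (I : Type) (r : seq I) (P : pred I) (F : I -> X -> R) :
  \E_ x (\sum_(i <- r | P i) F i x) = \sum_(i <- r | P i) avg (F i).
Proof. by rewrite /avg exchange_big mulr_suml. Qed.

Lemma ler_avg X (f g : X -> R) : (forall x, f x <= g x) -> avg f <= avg g.
Proof.
by move=> fg; rewrite /avg ler_wpM2r ?invr_ge0 // ler_sum.
Qed.

Lemma avg_ge0 X (f : X -> R) : (forall x, 0 <= f x) -> 0 <= avg f.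
Proof.
by move=> f0; rewrite /avg mulr_ge0 ?invr_ge0 // sumr_ge0.
Qed.

Lemma avg_cst X (x0 : X) (a : R) : avg (fun _ : X => a) = a.
Proof.
rewrite /avg sumr_const -[a *+ _]mulr_natr mulfK // pnatr_eq0 -lt0n.
by apply/card_gt0P; exists x0.
Qed.

Lemma ler_norm_avg X (f : X -> R) : `|avg f| <= \E_ x `|f x|.
Proof.
rewrite /avg normrM [X in _ * X]ger0_norm ?invr_ge0 //.
by rewrite ler_wpM2r ?invr_ge0 // ler_norm_sum.
Qed.

Lemma avg_exchange X Y (F : X -> Y -> R) :
  \E_ x (\E_ y F x y) = \E_ y (\E_ x F x y).
Proof.
by rewrite /avg -!mulr_suml exchange_big mulrAC.
Qed.

Lemma avg_pair X Y (F : X -> Y -> R) :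
  \E_ p (F p.1 p.2) = \E_ x (\E_ y F x y).
Proof.
rewrite /avg card_prod natrM -(pair_bigA _ F) /=.
by rewrite -mulr_suml -mulrA -invfM [X in _ / X]mulrC.
Qed.

Lemma avg_bij X Y (h : X -> Y) (F : Y -> R) : bijective h ->
  \E_ x F (h x) = avg F.
Proof.
move=> bh; rewrite /avg (reindex h) /=; last by apply: onW_bij.
by rewrite (bij_eq_card bh).
Qed.

(** Cauchy--Schwarz for a nonnegative weight, from nonnegativity of the
    average of [N x * N y * (f x - f y) ^+ 2] over all pairs. *)
Lemma avg_cauchy X (N f : X -> R) : (forall x, 0 <= N x) ->
  (\E_ x (N x * f x)) ^+ 2 <= avg N * \E_ x (N x * f x ^+ 2).
Proof.
move=> N0.
have : 0 <= \E_ x (\E_ y (N x * N y * (f x - f y) ^+ 2)).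
  apply: avg_ge0 => x; apply: avg_ge0 => y.
  by rewrite mulr_ge0 ?sqr_ge0 // mulr_ge0.
set u := avg N; set v := \E_ x (N x * f x); set w := \E_ x (N x * f x ^+ 2).
have -> : \E_ x (\E_ y (N x * N y * (f x - f y) ^+ 2)) =
          \E_ x (N x * f x ^+ 2 * u - 2 * (N x * f x * v) + N x * w).
  apply: eq_avg => x; rewrite /u /v /w -!avgZ -avgB -avgD.
  by apply: eq_avg => y /=; ring.
rewrite avgD avgB !avgZr avgZ avgZr -/u -/v -/w; nra.
Qed.

Lemma avg_cauchy_le X (N P Q : X -> R) : (forall x, `|P x| <= N x) ->
  (\E_ x (P x * Q x)) ^+ 2 <= avg N * \E_ x (N x * Q x ^+ 2).
Proof.
move=> PN; have N0 x : 0 <= N x by apply: le_trans (PN x); apply: normr_ge0.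
have -> : \E_ x (N x * Q x ^+ 2) = \E_ x (N x * `|Q x| ^+ 2).
  by apply: eq_avg => x; rewrite real_normK ?num_real.
apply: le_trans (avg_cauchy _ N0).
rewrite -real_normK ?num_real // lerXn2r ?nnegrE ?normr_ge0 //.
  by apply: avg_ge0 => x; rewrite mulr_ge0.
apply: le_trans (ler_norm_avg _) _; apply: ler_avg => x.
by rewrite normrM ler_wpM2r.
Qed.

Lemma avg_sqr_le X (x0 : X) (f : X -> R) : avg f ^+ 2 <= \E_ x (f x ^+ 2).
Proof.
have := @avg_cauchy X (fun _ => 1) f (fun _ => ler01).
rewrite avg_cst // mul1r.
by under eq_avg do rewrite mul1r; under [X in _ <= X]eq_avg do rewrite mul1r.
Qed.

End Averages.

Section ProductSpace.
Variables (R : realType) (J : finType).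
Implicit Types (A B e f g q : {set J}).

Definition config (V : J -> finType) : finType := {dffun forall j : J, V j}.

Variable V : J -> finType.
Local Notation Om := (config V).
Implicit Types (x y z : Om).

Definition mix A x y : Om := [ffun j => if j \in A then x j else y j].

Lemma mixE A x y j : mix A x y j = if j \in A then x j else y j.
Proof. by rewrite ffunE. Qed.

Lemma pointP x y : (forall j, x j = y j) -> x = y.
Proof. by move=> xy; apply/ffunP. Qed.

(** Functions on a face are represented by functions of the whole configuration
    that ignore the other coordinates, so that all faces live on one space. *)
Definition dep T A (h : Om -> T) :=
  forall x y, (forall j, j \in A -> x j = y j) -> h x = h y.

Lemma dep_mix T A (h : Om -> T) x y : dep A h -> h (mix A x y) = h x.
Proof. by move=> dh; apply: dh => j jA; rewrite mixE jA. Qed.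

Lemma dep_comp T T' A (h : Om -> T) (k : T -> T') :
  dep A h -> dep A (fun x => k (h x)).
Proof. by move=> dh x y xy; rewrite (dh x y). Qed.

Lemma dep_comp2 T1 T2 T A (h1 : Om -> T1) (h2 : Om -> T2) (k : T1 -> T2 -> T) :
  dep A h1 -> dep A h2 -> dep A (fun x => k (h1 x) (h2 x)).
Proof. by move=> d1 d2 x y xy; rewrite (d1 x y) // (d2 x y). Qed.

Lemma dep_cst T A (a : T) : dep A (fun _ => a).
Proof. by []. Qed.

(** Resampling a set of coordinates preserves the uniform measure: the map
    exchanging the coordinates of two points outside [A] is an involution. *)
Lemma avg_mix A (F : Om -> Om -> R) :
  \E_ x (\E_ y F (mix A x y) (mix A y x)) = \E_ x (\E_ y F x y).
Proof.
rewrite -avg_pair -[RHS]avg_pair.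
pose h (p : Om * Om) := (mix A p.1 p.2, mix A p.2 p.1).
suff bh : bijective h by rewrite -(avg_bij (fun p => F p.1 p.2) bh).
have hK : involutive h.
  case=> x y; rewrite /h /=; congr pair; apply: pointP => j;
  by rewrite !mixE; case: (j \in A).
by exists h; apply: hK.
Qed.

(** The conditional expectation given the coordinates in [A]. *)
Definition cavg A (h : Om -> R) x : R := \E_ y h (mix A x y).

Lemma avg_mix1 A (F : Om -> R) (o : Om) : \E_ x (\E_ y F (mix A x y)) = avg F.
Proof.
rewrite (avg_mix A (fun x _ => F x)); apply: eq_avg => x.
exact: avg_cst.
Qed.

Lemma avg_cavg A (h : Om -> R) (o : Om) : avg (cavg A h) = avg h.
Proof. exact: avg_mix1. Qed.

Lemma cavg_dep A (h : Om -> R) : dep A (cavg A h).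
Proof.
move=> x y xy; apply: eq_avg => z; congr h; apply: pointP => j.
by rewrite !mixE; case: ifP => // /xy.
Qed.

Lemma cavgM A (h k : Om -> R) x : dep A h ->
  cavg A (fun y => h y * k y) x = h x * cavg A k x.
Proof.
by move=> dh; rewrite /cavg -avgZ; apply: eq_avg => y; rewrite dep_mix.
Qed.

Lemma avg_cavgM A (h k : Om -> R) (o : Om) : dep A h ->
  \E_ x (h x * cavg A k x) = \E_ x (h x * k x).
Proof.
move=> dh; rewrite -[RHS](avg_cavg A _ o); apply: eq_avg => x.
by rewrite cavgM.
Qed.

(** A product of two conditional expectations is an average over two
    independent copies of the coordinates outside [A]. *)
Lemma avg_cavg_sqr A (h k l : Om -> R) (o : Om) : dep A h ->
  \E_ x (h x * (cavg A k x * cavg A l x)) =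
  \E_ x (\E_ y (h x * k x * l (mix A x y))).
Proof.
move=> dh; transitivity (\E_ x ((h x * cavg A l x) * cavg A k x)).
  by apply: eq_avg => x; ring.
rewrite avg_cavgM //; last first.
  by apply: dep_comp2 => //; apply: cavg_dep.
by apply: eq_avg => x; rewrite -mulrA [cavg _ _ _ * _]mulrC mulrA -avgZ.
Qed.

Lemma cavg_ge0 A (h : Om -> R) x : (forall y, 0 <= h y) -> 0 <= cavg A h x.
Proof. by move=> h0; apply: avg_ge0. Qed.

Lemma ler_cavg A (h k : Om -> R) x : (forall y, h y <= k y) ->
  cavg A h x <= cavg A k x.
Proof. by move=> hk; apply: ler_avg. Qed.

(** A set of the shape counted by the complexity: its indicator is a product of
    indicators over the facets of [f]. *)
Definition box f (B : {set J} -> Om -> bool) x : bool :=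
  [forall (g | g \in boundary f), B g x].

(** A bound on the cut norm of [u], for boxes over the facets of [f]. *)
Definition cut_le f (u : Om -> R) (D : R) :=
  forall B : {set J} -> Om -> bool, (forall g, dep g (B g)) ->
    `|\E_ x (u x * (box f B x)%:R)| <= D.

Definition unitv (w : Om -> R) := forall x, 0 <= w x <= 1.

Lemma unitv_prod (I : Type) (r : seq I) (P : pred I) (F : I -> Om -> R) :
  (forall i, P i -> unitv (F i)) -> unitv (fun x => \prod_(i <- r | P i) F i x).
Proof.
move=> uF x; apply/andP; split.
  by apply: prodr_ge0 => i /uF /(_ x) /andP[].
by apply: prodr_ile1 => i /uF /(_ x).
Qed.

Lemma unitv_bool (b : Om -> bool) : unitv (fun x => (b x)%:R).
Proof. by move=> x; case: (b x); rewrite ?lexx ler01. Qed.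

Lemma unitvM (v w : Om -> R) : unitv v -> unitv w -> unitv (fun x => v x * w x).
Proof.
move=> uv uw x; have /andP[v0 v1] := uv x; have /andP[w0 w1] := uw x.
by rewrite mulr_ge0 // mulr_ile1.
Qed.

Lemma prod_bool (I : finType) (P : pred I) (B : I -> bool) :
  \prod_(i | P i) (B i)%:R = ([forall (i | P i), B i])%:R :> R.
Proof.
have [/forall_inP allB|/forall_inPn[i Pi nB]] := boolP [forall (i | P i), B i].
  by rewrite big1 // => i /allB ->.
by rewrite (bigD1 i) //= (negbTE nB) mul0r.
Qed.

Lemma boundary_setD1 f j : j \in f -> f :\ j \in boundary f.
Proof.
by move=> jf; rewrite inE properD1 //= [#|f|](cardsD1 j) jf.
Qed.

(** The average of [u] against a product is linear in each factor, so it does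
    not decrease when the factors are successively replaced by indicators. *)
Lemma cut_round f (u : Om -> R) D (o : Om) :
  (forall B : {set J} -> Om -> bool, (forall g, dep g (B g)) ->
     \E_ x (u x * (box f B x)%:R) <= D) ->
  forall w : {set J} -> Om -> R,
  (forall g, dep g (w g)) -> (forall g, unitv (w g)) ->
  \E_ x (u x * \prod_(g in boundary f) w g x) <= D.
Proof.
move=> cutu w dw uw.
have : forall g, g \notin enum {set J} ->
    exists2 b : Om -> bool, dep g b & w g =1 (fun x => (b x)%:R).
  by move=> g; rewrite mem_enum.
elim: (enum _) w dw uw => [|g s IH] w dw uw wb.
  have /fin_all_exists[B BP] : forall g, exists b : Om -> bool,
      dep g b /\ (w g =1 (fun x => (b x)%:R)).
    by move=> g; have [//|b db eb] := wb g; exists b.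
  apply: le_trans (cutu B (fun g => (BP g).1)).
  apply: ler_avg => x; rewrite /box -prod_bool.
  by under eq_bigr => g _ do rewrite (BP g).2.
have [gs|gs] := boolP (g \in s).
  by apply: IH => // h hs; apply: wb; rewrite inE negb_or hs andbT;
    apply: contraNneq hs => ->.
have [gf|gf] := boolP (g \in boundary f); last first.
  pose w' h := if h == g then (fun=> 1) else w h.
  have -> : \E_ x (u x * \prod_(g in boundary f) w g x) =
            \E_ x (u x * \prod_(g in boundary f) w' g x).
    apply: eq_avg => x; congr (_ * _); apply: eq_bigr => h hf.
    by rewrite /w'; case: eqP => // hg; rewrite -hg hf in gf.
  apply: IH => [h|h|h hs]; rewrite /w'; case: eqP => // hg.
  - by move=> x; rewrite ler01 lexx.
  - by exists (fun=> true).
  - by apply: wb; rewrite inE (introF eqP hg).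
pose r x := u x * \prod_(h in boundary f | h != g) w h x.
pose b x := 0 <= cavg g r x.
pose w' h := if h == g then (fun x => (b x)%:R) else w h.
have db : dep g b by apply: dep_comp; apply: cavg_dep.
apply: (@le_trans _ _ (\E_ x (u x * \prod_(g in boundary f) w' g x))).
  have -> : \E_ x (u x * \prod_(g in boundary f) w g x) =
            \E_ x (w g x * r x).
    by apply: eq_avg => x; rewrite (bigD1 g) //= /r; ring.
  have -> : \E_ x (u x * \prod_(g in boundary f) w' g x) =
            \E_ x ((b x)%:R * r x).
    apply: eq_avg => x; rewrite (bigD1 g) //= /r {1}/w' eqxx mulrCA.
    congr (_ * (_ * _)); apply: eq_bigr => h /andP[_ hg].
    by rewrite /w' (negbTE hg).
  rewrite -(avg_cavgM _ o (dw g)) -(@avg_cavgM g (fun x => (b x)%:R) r o); last first.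
    exact: (dep_comp (fun c : bool => c%:R) db).
  apply: ler_avg => x; rewrite /b; have /andP[w0 w1] := uw g x.
  case: (lerP 0 (cavg g r x)) => h0; first by rewrite mul1r ler_piMl.
  by rewrite mul0r mulr_ge0_le0 // ltW.
apply: IH => [h|h|h hs]; rewrite /w'; case: eqP => // hg.
- by rewrite hg; exact: (dep_comp (fun c : bool => c%:R) db).
- exact: unitv_bool.
- by exists b; rewrite ?hg.
- by apply: wb; rewrite inE (introF eqP hg).
Qed.

(** Fixing the coordinates outside [f] turns every function of a set not
    containing [f] into a function of a facet of [f]. *)
Lemma cut_le_prod f (u : Om -> R) D (o : Om) : dep f u -> cut_le f u D ->
  forall (I : finType) (P : pred I) (w : I -> Om -> R) (A : I -> {set J}),
  (forall i, P i -> ~~ (f \subset A i)) -> (forall i, P i -> dep (A i) (w i)) ->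
  (forall i, P i -> unitv (w i)) ->
  `|\E_ x (u x * \prod_(i | P i) w i x)| <= D.
Proof.
move=> du cutu I P w A nfA dw uw.
pose G i := if [pick j in f :\: A i] is Some j then f :\ j else finset.set0.
have GP i : P i -> G i \in boundary f /\ (forall j, j \in f -> j \in A i -> j \in G i).
  move=> Pi; rewrite /G; case: pickP => [j|].
    rewrite inE => /andP[jA jf]; split; first exact: boundary_setD1.
    by move=> l lf lA; rewrite !inE lf andbT; apply: contraNneq jA => <-.
  by move/(_ _)=> H; case/fintype.subsetPn: (nfA i Pi) => j jf jA; move: (H j); rewrite !inE jf jA.
rewrite -(avg_mix1 f _ o) avg_exchange.
apply: le_trans (ler_norm_avg _) _; rewrite -[leRHS](avg_cst o); apply: ler_avg => y.
pose v g x := \prod_(i | P i && (G i == g)) w i (mix f x y).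
have E x : u (mix f x y) * \prod_(i | P i) w i (mix f x y) =
   u x * \prod_(g in boundary f) v g x.
  rewrite dep_mix //; congr (_ * _).
  by apply: partition_big => i /GP[].
have dv g : dep g (v g).
  move=> x x' xx'; apply: eq_bigr => i /andP[Pi /eqP Gi]; apply: dw => // j jA.
  by rewrite !mixE; case: ifP => // jf; apply: xx'; rewrite -Gi; apply: (GP i Pi).2.
have uv g : unitv (v g).
  move=> x; have := @unitv_prod I (index_enum I) (fun i => P i && (G i == g)) w.
  by apply=> i /andP[Pi _]; apply: uw.
rewrite (eq_avg E) ler_norml lerNl -avgN; apply/andP; split.
  under eq_avg do rewrite -mulNr.
  apply: (@cut_round f (fun x => - u x) D o) => // B dB.
  under eq_avg do rewrite mulNr.
  by rewrite avgN lerNl; have := cutu B dB; rewrite ler_norml => /andP[].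
apply: cut_round => // B dB.
by have := cutu B dB; rewrite ler_norml => /andP[].
Qed.

End ProductSpace.

(** * Conditional expectation and strong regularity *)

Section CondExp.
Variables (R : realType) (X : finType) (T : eqType).
Implicit Types (Gam : X -> T) (h k : X -> R).

(** Conditional expectation on the partition of [X] into fibres of [Gam]. *)
Definition ce Gam h x : R :=
  (\sum_(y | Gam y == Gam x) h y) / \sum_(y | Gam y == Gam x) 1.

Lemma fibre_gt0 Gam x : 0 < \sum_(y | Gam y == Gam x) 1 :> R.
Proof. by rewrite (bigD1 x) //= ltr_pwDl ?ltr01 ?sumr_ge0. Qed.

Lemma ce_meas Gam h x y : Gam x = Gam y -> ce Gam h x = ce Gam h y.
Proof. by rewrite /ce => ->. Qed.

(** Each fibre contributes its total to both sides. *)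
Lemma avg_ce Gam h k : (forall x y, Gam x = Gam y -> k x = k y) ->
  \E_ x (ce Gam h x * k x) = \E_ x (h x * k x).
Proof.
move=> mk; rewrite /avg; congr (_ / _).
transitivity (\sum_x \sum_(y | Gam y == Gam x)
   h y * k y / (\sum_(z | Gam z == Gam y) 1)).
  apply: eq_bigr => x _; rewrite /ce mulr_suml mulr_suml.
  apply: eq_bigr => y /eqP xy.
  by rewrite (eq_bigl (fun z => Gam z == Gam y)) ?(mk x y) 1?mulrAC // => z; rewrite xy.
rewrite (exchange_big_dep xpredT) //=; apply: eq_bigr => y _.
rewrite -mulr_suml (_ : \sum_(i | _) _ = h y * k y * \sum_(z | Gam z == Gam y) 1).
  by rewrite mulfK // gt_eqF // fibre_gt0.
by rewrite mulr_sumr; apply: eq_big => z; rewrite ?mulr1 // eq_sym.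
Qed.

Lemma avg_ce1 Gam h : avg (ce Gam h) = avg h.
Proof.
have /= := @avg_ce Gam h (fun _ => 1) (fun _ _ _ => erefl).
by under eq_avg do rewrite mulr1; under [X in _ = X -> _]eq_avg do rewrite mulr1.
Qed.

Lemma ler_ce Gam h k x : (forall y, h y <= k y) -> ce Gam h x <= ce Gam k x.
Proof.
by move=> hk; rewrite /ce ler_wpM2r ?invr_ge0 ?(ltW (fibre_gt0 _ _)) // ler_sum.
Qed.

Lemma ce_cst Gam (a : R) x : ce Gam (fun _ => a) x = a.
Proof.
rewrite /ce (eq_bigr (fun z => a * 1)); last by move=> z _; rewrite mulr1.
by rewrite -mulr_sumr mulfK // gt_eqF // fibre_gt0.
Qed.

Lemma ce_ge0 Gam h x : (forall y, 0 <= h y) -> 0 <= ce Gam h x.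
Proof.
by move=> h0; rewrite divr_ge0 ?(ltW (fibre_gt0 _ _)) // sumr_ge0.
Qed.

Lemma ce_unitv Gam h x : (forall y, 0 <= h y <= 1) -> 0 <= ce Gam h x <= 1.
Proof.
move=> uh.
have l0 : 0 <= ce Gam h x by apply: ce_ge0 => y; case/andP: (uh y).
have l1 : ce Gam h x <= ce Gam (fun=> 1) x by apply: ler_ce => y; case/andP: (uh y).
by move: l0 l1; rewrite ce_cst => -> ->.
Qed.

End CondExp.

Lemma ce_pythagoras (R : realType) (X : finType) (T T' : eqType)
    (Gam : X -> T) (Gam' : X -> T') (h : X -> R) :
  (forall x y, Gam' x = Gam' y -> Gam x = Gam y) ->
  \E_ x (ce Gam' h x ^+ 2) =
  \E_ x (ce Gam h x ^+ 2) + \E_ x ((ce Gam' h x - ce Gam h x) ^+ 2).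
Proof.
move=> ref.
have E1 : \E_ x (ce Gam' h x * ce Gam h x) = \E_ x (ce Gam h x ^+ 2).
  rewrite avg_ce => [|x y /ref xy]; last exact: ce_meas.
  rewrite -(avg_ce h (k := ce Gam h) (Gam := Gam)) // => x y; exact: ce_meas.
have -> : \E_ x ((ce Gam' h x - ce Gam h x) ^+ 2) =
    \E_ x (ce Gam' h x ^+ 2 - 2 * (ce Gam' h x * ce Gam h x) + ce Gam h x ^+ 2).
  by apply: eq_avg => x; ring.
rewrite avgD avgB avgZ E1; ring.
Qed.

Section Regularity.
Variables (R : realType) (J : finType) (I : finType).

Section Potential.
Variables (V : J -> finType) (o : config V).
Local Notation Om := (config V).
Variables (e : I -> {set J}) (h : I -> Om -> R).
Hypothesis uh : forall i, unitv (h i).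

Definition colouring := {set J} -> Om -> nat.

Definition dep_colouring (C : colouring) := forall g, dep g (C g).

(** The partition on which functions of [f] are conditioned. The constant value
    off the boundary makes it an ordinary finite function of faces. *)
Definition prof (C : colouring) (f : {set J}) (x : Om) : {ffun {set J} -> nat} :=
  [ffun g => if g \in boundary f then C g x else 0%N].

Lemma prof_eq C f x y : prof C f x = prof C f y <->
  (forall g, g \in boundary f -> C g x = C g y).
Proof.
split=> [/ffunP E g gf|E]; first by have := E g; rewrite !ffunE gf.
by apply/ffunP => g; rewrite !ffunE; case: ifP => // /E.
Qed.

Lemma ce_prof_dep C f k : dep_colouring C -> dep f (ce (R := R) (prof C f) k).
Proof.
move=> dC x y xy; apply: ce_meas; apply/prof_eq => g gf; apply: dC => j jg.
by apply: xy; apply: (fintype.subsetP (boundary_sub gf)).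
Qed.

(** The potential of the regularity argument: by Pythagoras it grows under
    refinement, and it never exceeds the number of functions. *)
Definition energy C : R := \sum_i \E_ x (ce (prof C (e i)) (h i) x ^+ 2).

Definition refines (C' C : colouring) :=
  forall g x y, C' g x = C' g y -> C g x = C g y.

Lemma prof_refines C' C f x y : refines C' C ->
  prof C' f x = prof C' f y -> prof C f x = prof C f y.
Proof. by move=> ref /prof_eq E; apply/prof_eq => g /E /ref. Qed.

Lemma energy_le C : energy C <= #|I|%:R.
Proof.
rewrite /energy -sum1_card natr_sum ler_sum // => i _.
rewrite -[leRHS](avg_cst o); apply: ler_avg => x.
have /andP[c0 c1] := ce_unitv (prof C (e i)) x (uh i).
by rewrite expr_le1.
Qed.

Lemma energy_refines C' C i : refines C' C ->
  energy C + \E_ x ((ce (prof C' (e i)) (h i) x - ce (prof C (e i)) (h i) x) ^+ 2)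
  <= energy C'.
Proof.
move=> ref; rewrite /energy (bigD1 i) //= [leRHS](bigD1 i) //=.
rewrite [X in _ <= X + _](ce_pythagoras (Gam := prof C (e i))); last first.
  by move=> x y; apply: prof_refines.
rewrite -!addrA lerD2l addrC lerD2l ler_sum // => j _.
rewrite (ce_pythagoras (Gam' := prof C' (e j)) (Gam := prof C (e j))); last first.
  by move=> x y; apply: prof_refines.
by rewrite lerDl avg_ge0 // => x; apply: sqr_ge0.
Qed.

(** Recording in each colour also the membership in the side of [B] makes the
    box measurable, so its correlation with [h i] bounds the Pythagorean
    increment from below. *)
Lemma energy_increment C i B D : 0 <= D -> dep_colouring C ->
  (forall g, dep g (B g)) ->
  D < `|\E_ x ((h i x - ce (prof C (e i)) (h i) x) * (box (e i) B x)%:R)| ->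
  let C' g x := ((C g x).*2 + B g x)%N in
  [/\ refines C' C, dep_colouring C' & energy C + D ^+ 2 <= energy C'].
Proof.
move=> D0 dC dB gtD C'.
have oddC' g x : odd (C' g x) = B g x by rewrite /C' oddD odd_double; case: (B g x).
have halfC' g x : (C' g x)./2 = C g x.
  by rewrite /C' addnC half_bit_double.
have ref : refines C' C by move=> g x y E; rewrite -!halfC' E.
split=> //; first by move=> g x y xy; rewrite /C' (dC g x y) ?(dB g x y).
apply: le_trans (energy_refines i ref); rewrite lerD2l.
under eq_avg do rewrite -real_normK ?num_real //.
apply: le_trans (avg_sqr_le o _).
rewrite lerXn2r ?nnegrE //; first by apply: avg_ge0.
apply: le_trans (ltW gtD) _.
have -> : \E_ x ((h i x - ce (prof C (e i)) (h i) x) * (box (e i) B x)%:R) =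
  \E_ x ((ce (prof C' (e i)) (h i) x - ce (prof C (e i)) (h i) x) * (box (e i) B x)%:R).
  under eq_avg do rewrite mulrBl; under [in RHS]eq_avg do rewrite mulrBl.
  rewrite !avgB; congr (_ - _); symmetry; apply: avg_ce => x y /prof_eq E.
  congr ((nat_of_bool _)%:R); apply: eq_forallb_in => g gf.
  by rewrite -!oddC' E.
apply: le_trans (ler_norm_avg _) _; apply: ler_avg => x.
by rewrite normrM ler_piMr // ger0_norm //; case: (box _ _ _).
Qed.

Definition cut_regular C D := forall i,
  cut_le (e i) (fun x => h i x - ce (prof C (e i)) (h i) x) D.

Lemma irregular_refine C n D : 0 <= D -> dep_colouring C ->
  (forall g x, C g x < n)%N -> ~ cut_regular C D ->
  exists C', [/\ refines C' C, dep_colouring C', (forall g x, C' g x < n.*2)%N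
                & energy C + D ^+ 2 <= energy C'].
Proof.
move=> D0 dC Cn nreg.
have [i [B [dB gtB]]] : exists i (B : {set J} -> Om -> bool),
    (forall g, dep g (B g)) /\
    D < `|\E_ x ((h i x - ce (prof C (e i)) (h i) x) * (box (e i) B x)%:R)|.
  apply: boolp.contrapT => H; apply: nreg => i B dB; rewrite leNgt.
  by apply/negP => gtB; apply: H; exists i, B.
have [ref dC' en] := energy_increment D0 dC dB gtB.
exists (fun g x => ((C g x).*2 + B g x)%N); split=> // g x.
have := Cn g x; case: (B g x) => Cgn; last by rewrite addn0 ltn_double.
by rewrite addn1 -doubleS leq_double.
Qed.

(** [s] counts the energy increments that are still possible; each of them
    doubles the number of colours. *)
Lemma weak_regularity_fuel (D : R) (D0 : 0 < D) (s : nat) n C :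
  dep_colouring C -> (forall g x, C g x < n)%N ->
  #|I|%:R - D ^+ 2 *+ s <= energy C ->
  exists C', [/\ dep_colouring C', (forall g x, C' g x < n * 2 ^ s)%N,
                 refines C' C & cut_regular C' D].
Proof.
elim: s n C => [|s IH] n C dC Cn es.
all: have [reg|nreg] := boolp.pselect (cut_regular C D);
  first by exists C; split => // g x; apply: leq_trans (Cn g x) _;
    rewrite leq_pmulr // expn_gt0.
all: have [C1 [ref dC1 C1n en]] := irregular_refine (ltW D0) dC Cn nreg.
  have := energy_le C1; move: es en; rewrite mulr0n subr0 => es en le.
  by have := exprn_gt0 2 D0; lra.
have [|C2 [dC2 C2n ref2 reg2]] := IH _ _ dC1 C1n.
  by apply: le_trans en; move: es; rewrite mulrS; lra.
exists C2; split=> // [g x|g x y /ref2 /ref //].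
by rewrite expnS mulnA [(n * 2)%N]muln2.
Qed.

End Potential.

Lemma archi_steps (K D : R) : 0 < D -> exists s : nat, K - D *+ s <= 0.
Proof.
move=> D0; exists (Num.bound `|K / D|).
rewrite subr_le0 -mulr_natr -ler_pdivrMl // mulrC.
by apply: le_trans (ler_norm _) _; apply: ltW; apply: archi_boundP.
Qed.

Lemma energy_ge0 (V : J -> finType) (e : I -> {set J}) (h : I -> config V -> R) C :
  0 <= energy e h C.
Proof. by apply: sumr_ge0 => i _; apply: avg_ge0 => x; apply: sqr_ge0. Qed.

(** A coarse colouring [C] and a fine one [C']. The accuracy [F n] to which the
    fine one is regular may be arbitrarily small in terms of the number [n] of
    coarse colours, while in mean the two conditional expectations agree up to
    [eta]; in general no single colouring is regular to such an accuracy. *)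
Definition regular_pair (eta : R) (F : nat -> R) (N : nat) (V : J -> finType)
    (e : I -> {set J}) (h : I -> config V -> R) :=
  exists n (C C' : colouring V),
    [/\ (n <= N)%N, dep_colouring C, (forall g x, C g x < n)%N, dep_colouring C'
      & forall i,
       \E_ x `|ce (prof C' (e i)) (h i) x - ce (prof C (e i)) (h i) x| <= eta /\
       cut_le (e i) (fun x => h i x - ce (prof C' (e i)) (h i) x) (F n)].

(** Weak regularity is iterated, each time to the accuracy demanded by the
    current number of colours. Since the energy is bounded, one of the steps
    gains at most [eta ^+ 2]; that step provides the pair. *)
Lemma strong_regularity_fuel (eta : R) (F : nat -> R) (s n : nat) :
  0 < eta -> (forall n, 0 < F n) ->
  exists N, forall (V : J -> finType) (o : config V) (e : I -> {set J})
    (h : I -> config V -> R) (C : colouring V),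
  (forall i, unitv (h i)) -> dep_colouring C -> (forall g x, C g x < n)%N ->
  #|I|%:R - eta ^+ 2 *+ s <= energy e h C ->
  regular_pair eta F N e h.
Proof.
move=> eta0 F0; elim: s n => [|s IH] n.
all: have [L HL] := archi_steps #|I|%:R (exprn_gt0 2 (F0 n)).
  exists n => V o e h C uh dC Cn es.
  have [|C' [dC' _ ref reg]] := weak_regularity_fuel (e := e) o uh (F0 n) dC Cn (s := L).
    exact: le_trans HL (energy_ge0 _ _ _).
  exists n, C, C'; split=> // i; split; last exact: reg.
  have := energy_refines e h i ref; have := energy_le o e uh C'.
  move: es; rewrite mulr0n subr0 => es le en.
  have : \E_ x `|ce (prof C' (e i)) (h i) x - ce (prof C (e i)) (h i) x| ^+ 2 <= 0.
    under eq_avg do rewrite real_normK ?num_real //.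
    by lra.
  move/(le_trans (avg_sqr_le o _)) => sq0; apply: le_trans (ltW eta0).
  by rewrite leNgt; apply/negP => /(exprn_gt0 2); lra.
have [N HN] := IH (n * 2 ^ L)%N.
exists (maxn n N) => V o e h C uh dC Cn es.
have [|C' [dC' C'n ref reg]] := weak_regularity_fuel (e := e) o uh (F0 n) dC Cn (s := L).
  exact: le_trans HL (energy_ge0 _ _ _).
have [small|big] := lerP (energy e h C') (energy e h C + eta ^+ 2).
  exists n, C, C'; split=> //; first exact: leq_maxl.
  move=> i; split; last exact: reg.
  have en := energy_refines e h i ref.
  have : \E_ x `|ce (prof C' (e i)) (h i) x - ce (prof C (e i)) (h i) x| ^+ 2 <= eta ^+ 2.
    under eq_avg do rewrite real_normK ?num_real //.
    by lra.
  move/(le_trans (avg_sqr_le o _)).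
  by rewrite ler_pXn2r ?nnegrE ?(ltW eta0) ?avg_ge0.
have [|n' [C1 [C2 [n'N *]]]] := HN V o e h C' uh dC' C'n.
  by move: es; rewrite mulrS; lra.
by exists n', C1, C2; split=> //; apply: leq_trans n'N (leq_maxr _ _).
Qed.

Lemma strong_regularity (eta : R) (F : nat -> R) :
  0 < eta -> (forall n, 0 < F n) ->
  exists N, forall (V : J -> finType) (o : config V) (e : I -> {set J})
    (h : I -> config V -> R), (forall i, unitv (h i)) ->
  regular_pair eta F N e h.
Proof.
move=> eta0 F0; have [s Hs] := archi_steps #|I|%:R (exprn_gt0 2 eta0).
have [N HN] := strong_regularity_fuel s 1 eta0 F0.
exists N => V o e h uh; apply: (HN V o e h (fun _ _ => 0%N)) => //.
exact: le_trans Hs (energy_ge0 _ _ _).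
Qed.

End Regularity.

(** * Counting good colour patterns *)

(** An error of at most half the density changes a probability by at most a
    factor of two. *)
Lemma close_bounds (R : realFieldType) (km X S PA P1 : R) :
  0 < PA -> km <= X -> 2 * S <= km -> `|P1 - X * PA| <= S * PA ->
  [/\ km * PA <= X * PA, X * PA <= 2 * P1 & P1 <= 2 * (X * PA)].
Proof.
move=> PA0 kX Sk; rewrite ler_norml => /andP[h1 h2].
have h3 : 2 * S * PA <= X * PA by apply: ler_wpM2r; [exact: ltW | exact: le_trans kX].
have h4 : km * PA <= X * PA by apply: ler_wpM2r; first exact: ltW.
by split=> //; lra.
Qed.

(** The bookkeeping of constants in the induction step on the dimension. *)
Lemma next_cell_arith (R : realFieldType)
    (X Xa Y C S b b' p1 p2 km PA Pq P1A P1q : R) :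
  0 < km -> km <= p1 -> km <= p2 -> 0 < PA -> 0 < Pq -> 0 <= S -> 0 <= b' ->
  0 < C -> 0 <= Y ->
  km * PA <= p1 * p2 * PA -> p1 * p2 * PA <= 2 * P1A ->
  p1 * Pq <= 2 * P1q -> P1q <= 2 * (p1 * Pq) ->
  X <= p2 * Xa + S * PA -> Xa * Pq <= C * Y * PA + b' * PA * Pq ->
  8 * b' + 2 * S <= b * km ->
  X * P1q <= 4 * C * Y * P1A + b * P1A * P1q.
Proof.
move=> km0 kp1 kp2 PA0 Pq0 S0 b'0 C0 Y0 l1 l2 k2 k3 H1 H2 hb.
have p10 : 0 < p1 by lra.
have p20 : 0 < p2 by lra.
have P1q0 : 0 < P1q by have := mulr_gt0 p10 Pq0; lra.
have P1A0 : 0 < P1A by have := mulr_gt0 (mulr_gt0 p10 p20) PA0; lra.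
have CY0 : 0 <= C * Y by rewrite mulr_ge0 // ltW.
have kPq : km * Pq <= 2 * P1q by apply: le_trans k2; rewrite ler_wpM2r // ltW.
have kPA : km * PA <= 2 * P1A by lra.
have h1 : X * P1q <= (p2 * Xa + S * PA) * P1q by rewrite ler_wpM2r // ltW.
have h2 : p2 * Xa * P1q <= 4 * C * Y * P1A + 4 * b' * P1A * Pq.
  have [Xa0|Xa0] := lerP Xa 0.
    apply: (@le_trans _ _ 0).
      by rewrite pmulr_lle0 // pmulr_rle0.
    by rewrite addr_ge0 ?mulr_ge0 // ltW.
  have e1 : p2 * Xa * P1q <= p2 * Xa * (2 * (p1 * Pq)).
    by rewrite ler_wpM2l // mulr_ge0 // ltW.
  have e2 : 2 * (p1 * p2) * (Xa * Pq) <= 2 * (p1 * p2) * (C * Y * PA + b' * PA * Pq).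
    by rewrite ler_wpM2l // !mulr_ge0 // ltW.
  have e3 : p1 * p2 * PA * (C * Y + b' * Pq) <= 2 * P1A * (C * Y + b' * Pq).
    by rewrite ler_wpM2r // addr_ge0 // mulr_ge0 // ltW.
  lra.
have h3 : km * (4 * b' * P1A * Pq) <= 8 * b' * P1A * P1q.
  have : 4 * b' * P1A * (km * Pq) <= 4 * b' * P1A * (2 * P1q).
    by rewrite ler_wpM2l // !mulr_ge0 // ltW.
  lra.
have h4 : km * (S * PA * P1q) <= 2 * S * P1A * P1q.
  have : S * P1q * (km * PA) <= S * P1q * (2 * P1A).
    by rewrite ler_wpM2l // mulr_ge0 // ltW.
  lra.
have h5 : (8 * b' + 2 * S) * (P1A * P1q) <= b * km * (P1A * P1q).
  by rewrite ler_wpM2r // mulr_ge0 // ltW.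
rewrite -(ler_pM2l km0).
have h6 := ler_wpM2l (ltW km0) h1; have h7 := ler_wpM2l (ltW km0) h2.
lra.
Qed.

Section Cells.
Variables (R : realType) (J : finType) (Fam : {set {set J}}).
Hypothesis down : forall f g : {set J}, f \in Fam -> g \subset f -> g \in Fam.

Implicit Types (A f g q : {set J}).

Definition pr (X : finType) (b : X -> bool) : R := \E_ x (b x)%:R.

Lemma ler_pr (X : finType) (b c : X -> bool) : (forall x, b x -> c x) -> pr b <= pr c.
Proof.
by move=> bc; apply: ler_avg => x; have := bc x; case: (b x) => [->|_] //; case: (c x).
Qed.

Section Colours.
Variable V : J -> finType.
Local Notation Om := (config V).
Implicit Types (a : {set J} -> nat) (gam : colouring V).

Definition cell gam k (A : {set J}) a (x : Om) : bool :=
  [forall f : {set J}, [&& f \in Fam, #|f| <= k & f \subset A]%N ==> (gam f x == a f)].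

Lemma cellP gam k A a x : reflect
  (forall f, f \in Fam -> (#|f| <= k)%N -> f \subset A -> gam f x = a f)
  (cell gam k A a x).
Proof.
apply: (iffP forallP) => [H f fF fk fA|H f].
  by apply/eqP; apply: (implyP (H f)); rewrite fF fk.
by apply/implyP => /and3P[fF fk fA]; apply/eqP; apply: H.
Qed.

(** [G f a] tests whether the colour pattern [a] is acceptable at [f]. The
    patterns that pass everywhere occur with positive probability, although
    [G] only looks at one face at a time. The last clause is the form in which
    this survives the induction on dimension: passing from the pattern on [q] to
    the pattern on a larger set [A] distorts averages of functions of [q] at
    most by the factor [C], up to [beta]. It spares the second moment
    estimates by which counting lemmas usually control such averages. *)
Definition good_cells gam (G : {set J} -> ({set J} -> nat) -> bool) k
    (C beta eps : R) (T : nat) (delta : R) : Prop :=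
  [/\ (forall f, (#|f| <= k)%N -> dep f (gam f)) /\
      (forall f x, (#|f| <= k)%N -> (gam f x < T)%N),
      forall f a a', (forall g, g \subset f -> a g = a' g) -> G f a = G f a',
      forall f, f \in Fam -> (#|f| <= k)%N -> pr (fun x => ~~ G f (gam^~ x)) <= eps
    & forall a, (forall f, f \in Fam -> (#|f| <= k)%N -> G f a) ->
      delta <= pr (cell gam k [set: J] a) /\
      forall (A q : {set J}) (W : Om -> R), q \subset A -> (k < #|q|)%N ->
        dep q W -> unitv W ->
        (\E_ x (W x * (cell gam k A a x)%:R)) * pr (cell gam k q a) <=
        C * (\E_ x (W x * (cell gam k q a x)%:R)) * pr (cell gam k A a) +
        beta * pr (cell gam k A a) * pr (cell gam k q a)].

End Colours.

(** The faces of size [k] come with an arbitrary colouring [c], and colourings of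
    the smaller faces are found. The constant [C] is fixed before the number of
    colours and the errors, so that these may be chosen small in terms of it. *)
Definition cell_counting (k : nat) : Prop :=
  exists C : R, 0 < C /\
  forall (K : nat) (beta eps : R), 0 < beta -> 0 < eps ->
  exists (T : nat) (delta : R), 0 < delta /\
  forall (V : J -> finType) (o : config V) (c : colouring V),
    (forall f, #|f| = k -> dep f (c f)) ->
    (forall f x, #|f| = k -> (c f x < K)%N) ->
  exists gam G, (forall f, #|f| = k -> gam f = c f) /\
    good_cells gam G k C beta eps T delta.

(** The empty face has one colour; a pattern is acceptable if it shows it. *)
Lemma cell_counting0 : cell_counting 0.
Proof.
exists 1; split=> // K beta eps beta0 eps0; exists K, 1; split=> // V o c dc cK.
exists c, (fun f a => [exists x, c f x == a f]); split=> //; split.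
- by split=> [f|f x]; rewrite leqn0 => /eqP; [apply: dc | apply: cK].
- by move=> f a a' E; apply: eq_existsb => x; rewrite (E f).
- move=> f _ _; rewrite /pr (eq_avg (g := fun=> 0)) ?avg_cst ?(ltW eps0) // => x.
  by rewrite (_ : [exists _, _] = true) //; apply/existsP; exists x.
move=> a Ga; have cellT A x : cell c 0 A a x = true.
  apply/cellP => f fF fk _; have /existsP[y /eqP <-] := Ga f fF fk.
  have f0 : #|f| = 0%N by apply/eqP; rewrite -leqn0.
  by apply: dc => // j; rewrite (cards0_eq f0) finset.in_set0.
have pr1 A : pr (cell c 0 A a) = 1.
  by rewrite /pr (eq_avg (g := fun=> 1)) ?avg_cst // => x; rewrite cellT.
split=> [|A q W _ _ _ _]; rewrite !pr1 // !mulr1 mul1r.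
under eq_avg do rewrite cellT mulr1; under [in leRHS]eq_avg do rewrite cellT mulr1.
by rewrite lerDl ltW.
Qed.

Section Step.
Variables (k K : nat) (V : J -> finType) (o : config V).
Local Notation Om := (config V).
Variables (c gam C' : colouring V) (G : {set J} -> ({set J} -> nat) -> bool).
Variables (Ck beta' beta eps delta s kap eps1 eta : R) (T : nat).
Hypothesis dc : forall f, #|f| = k.+1 -> dep f (c f).
Hypothesis cK : forall f x, #|f| = k.+1 -> (c f x < K)%N.
Hypothesis dC' : dep_colouring C'.
Hypothesis HG : good_cells gam G k Ck beta' eps T delta.

Let ind f v (x : Om) : R := (c f x == v)%:R.

Hypothesis Hreg : forall f v, #|f| = k.+1 -> (v < K)%N ->
  \E_ x `|ce (prof C' f) (ind f v) x - ce (prof gam f) (ind f v) x| <= eta.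
Hypothesis Hcut : forall f v, #|f| = k.+1 -> (v < K)%N ->
  cut_le f (fun x => ind f v x - ce (prof C' f) (ind f v) x) (s * delta).

Definition next_gam : colouring V := fun f => if #|f| == k.+1 then c f else gam f.
Local Notation gam1 := next_gam.

Definition face f (a : {set J} -> nat) (x : Om) :=
  [forall (g | g \in boundary f), gam g x == a g].

(** The density of the colour [a f] given the coarse colours of the facets; it is
    [0] when these do not occur. *)
Definition dens f (a : {set J} -> nat) : R :=
  (\sum_(y | face f a y) ind f (a f) y) / \sum_(y | face f a y) 1.

(** The amount by which the fine conditional density of the colour [a f] differs
    from the coarse one. *)
Definition bias f a x : R := ce (prof C' f) (ind f (a f)) x - dens f a.

(** A colour is acceptable if it is not rare on its facets and if its bias is
    small in mean on the cell of [f], not merely on the whole space. *)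
Definition next_good f (a : {set J} -> nat) : bool :=
  if #|f| == k.+1 then
    [&& (a f < K)%N, kap <= dens f a &
       \E_ x (`|bias f a x| * (cell gam k f a x)%:R) <= eps1 * pr (cell gam k f a)]
  else G f a.

Lemma boundary_card f g : #|f| = k.+1 -> g \in boundary f -> #|g| = k.
Proof. by move=> fk; rewrite inE fk => /andP[_ /eqP]. Qed.

Lemma dens_unit f a : 0 <= dens f a <= 1.
Proof.
rewrite /dens; set S := \sum_(_ | _) 1.
have S0 : 0 <= S by apply: sumr_ge0.
have [->|Sn] := eqVneq S 0; first by rewrite invr0 mulr0 lexx ler01.
have Sp : 0 < S by rewrite lt_neqAle eq_sym Sn.
apply/andP; split; first by rewrite divr_ge0 // sumr_ge0.
rewrite ler_pdivrMr // mul1r; apply: ler_sum => y _.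
by rewrite /ind; case: (_ == _).
Qed.

Lemma gam1_lt f x : (#|f| < k.+1)%N -> gam1 f x = gam f x.
Proof. by move=> fk; rewrite /gam1 ltn_eqF. Qed.

Lemma gam1_top f x : #|f| = k.+1 -> gam1 f x = c f x.
Proof. by move=> fk; rewrite /gam1 fk eqxx. Qed.

Lemma dens_gam1 f x : #|f| = k.+1 ->
  dens f (gam1^~ x) = ce (prof gam f) (ind f (c f x)) x.
Proof.
move=> fk; rewrite /dens /ce gam1_top //.
have E y : face f (gam1^~ x) y = (prof gam f y == prof gam f x).
  apply/forall_inP/eqP => [H|/prof_eq H g gf].
    apply/prof_eq => g gf; rewrite (eqP (H g gf)) gam1_lt //.
    by rewrite (boundary_card fk gf).
  by rewrite gam1_lt ?H // (boundary_card fk gf).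
by rewrite (eq_bigl _ _ E) [in X in _ / X](eq_bigl _ _ E).
Qed.

Let Gcell f x : {ffun {set J} -> nat} :=
  [ffun g => if [&& g \in Fam, (#|g| <= k)%N & g \subset f] then gam g x else 0%N].

Lemma cell_gam1 f x y : #|f| = k.+1 ->
  cell gam k f (gam1^~ x) y = (Gcell f y == Gcell f x).
Proof.
move=> fk; apply/cellP/eqP => [H|/ffunP H g gF gk gf].
  apply/ffunP => g; rewrite !ffunE; case: and3P => // -[gF gk gf].
  by rewrite H // gam1_lt.
by have := H g; rewrite !ffunE gF gk gf /= gam1_lt.
Qed.

Lemma bias_gam1 f x y : f \in Fam -> #|f| = k.+1 -> Gcell f y = Gcell f x ->
  bias f (gam1^~ x) y =
  ce (prof C' f) (ind f (c f x)) y - ce (prof gam f) (ind f (c f x)) y.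
Proof.
move=> fF fk /ffunP E; rewrite /bias dens_gam1 // gam1_top //; congr (_ - _).
apply: ce_meas; apply/prof_eq => g gf; have := E g.
have gF := down fF (boundary_sub gf).
by rewrite !ffunE gF (boundary_card fk gf) leqnn (boundary_sub gf).
Qed.

Hypothesis eps1_gt0 : 0 < eps1.
Hypothesis kap_gt0 : 0 < kap.
Hypothesis Heps : K%:R * (kap + eta / eps1) <= eps.

(** Colours of density below [kap] have total mass at most [K%:R * kap], and by
    Markov's inequality for the conditional expectation of the bias on the cells
    of [f], large relative bias is rare. *)
Lemma next_good_pr f : f \in Fam -> (#|f| <= k.+1)%N ->
  pr (fun x => ~~ next_good f (gam1^~ x)) <= eps.
Proof.
move=> fF fk; have [fk1|fk1] := eqVneq #|f| k.+1; last first.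
  have fk2 : (#|f| <= k)%N by rewrite -ltnS ltn_neqAle fk1.
  case: HG => _ Gloc /(_ f fF fk2) Gpr _; apply: le_trans Gpr.
  rewrite le_eqVlt; apply/orP; left; apply/eqP; apply: eq_avg => x.
  rewrite /next_good (negbTE fk1); congr ((nat_of_bool (~~ _))%:R).
  by apply: Gloc => g gf; rewrite gam1_lt // ltnS (leq_trans (subset_leq_card gf)).
pose bb v x := ce (prof C' f) (ind f v) x - ce (prof gam f) (ind f v) x.
apply: le_trans Heps.
pose M := (\E_ x (\sum_(v < K)
   (ind f v x * (ce (prof gam f) (ind f v) x < kap)%R%:R +
    ce (Gcell f) (fun y => `|bb v y|) x / eps1))).
apply: (@le_trans _ _ M).
  apply: ler_avg => x; set v := Ordinal (cK x fk1).
  have terms_ge0 (w : 'I_K) : 0 <= ind f w x * (ce (prof gam f) (ind f w) x < kap)%R%:R +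
    ce (Gcell f) (fun y => `|bb w y|) x / eps1.
    by apply: addr_ge0; apply: mulr_ge0; rewrite ?invr_ge0 ?ler0n ?(ltW eps1_gt0) // ce_ge0.
  case: (boolP (next_good _ _)) => [_|bad]; first by apply: sumr_ge0.
  rewrite (bigD1 v) //= -[leLHS]addr0; apply: lerD; last by apply: sumr_ge0.
  move: bad; rewrite /next_good fk1 eqxx dens_gam1 //.
  rewrite gam1_top // cK //= negb_and -ltNge /ind eqxx mul1r -/(ind f).
  have cge0 : 0 <= ce (Gcell f) (fun y => `|bb (c f x) y|) x / eps1.
    by apply: divr_ge0; rewrite ?(ltW eps1_gt0) // ce_ge0.
  case/orP => [->|]; first by rewrite lerDl.
  rewrite -ltNge => big; rewrite -[leLHS]add0r lerD // ler_pdivlMr // mul1r ltW //.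
  rewrite /ce ltr_pdivlMr ?fibre_gt0 //.
  have c0 : (0 : R) < #|{: Om}|%:R by rewrite ltr0n; apply/card_gt0P; exists o.
  move: big; rewrite /pr /avg mulrA ltr_pM2r ?invr_gt0 //.
  suff -> : \sum_y `|bias f (gam1^~ x) y| * (cell gam k f (gam1^~ x) y)%:R =
    \sum_(y | Gcell f y == Gcell f x) `|bb (c f x) y|.
    suff -> : \sum_y (cell gam k f (gam1^~ x) y)%:R =
      \sum_(y | Gcell f y == Gcell f x) 1 :> R by [].
    rewrite [RHS]big_mkcond; apply: eq_bigr => y _; rewrite cell_gam1 //.
    by case: ifP.
  rewrite [RHS]big_mkcond; apply: eq_bigr => y _; rewrite cell_gam1 //.
  by case: eqP => E; rewrite ?mulr0 // mulr1 bias_gam1.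
have -> : K%:R * (kap + eta / eps1) = \sum_(v < K) (kap + eta / eps1).
  by rewrite sumr_const card_ord mulr_natl.
rewrite /M avg_sum; apply: ler_sum => v _; rewrite avgD avgZr; apply: lerD; last first.
  by rewrite avg_ce1 ler_wpM2r ?invr_ge0 ?(ltW eps1_gt0) // Hreg.
rewrite -(avg_ce (Gam := prof gam f)) => [|x y E]; last by rewrite (ce_meas _ E).
rewrite -[leRHS](avg_cst o); apply: ler_avg => x.
by case: ltP => [/ltW|_]; rewrite ?mulr1 // mulr0 ltW.
Qed.

Section Count.
Variable a : {set J} -> nat.
Hypothesis Ga : forall f, f \in Fam -> (#|f| <= k.+1)%N -> next_good f a.
Hypothesis Ck_gt0 : 0 < Ck.
Hypothesis s_ge0 : 0 <= s.
Hypothesis delta_gt0 : 0 < delta.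
Hypothesis beta'_ge0 : 0 <= beta'.

Let phi f x : R := ind f (a f) x.
Let cE A x : R := (cell gam k A a x)%:R.
Let P A : R := pr (cell gam k A a).
Let P1 A : R := pr (cell gam1 k.+1 A a).
Let top A : {set {set J}} := [set f in Fam | (#|f| == k.+1) && (f \subset A)].

Lemma good_below f : f \in Fam -> (#|f| <= k)%N -> G f a.
Proof.
move=> fF fk; have := Ga fF (leqW fk).
by rewrite /next_good ltn_eqF.
Qed.

Lemma P_ge A : delta <= P A.
Proof.
case: HG => _ _ _ /(_ a good_below) [le _]; apply: le_trans le _.
by apply: ler_pr => x /cellP H; apply/cellP => f fF fk _; apply: H.
Qed.

Lemma P_gt0 A : 0 < P A. Proof. exact: lt_le_trans delta_gt0 (P_ge A). Qed.

(** The two applications below: [W] is the bias of a face, or it collects the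
    indicators of the faces inside [q]. *)
Lemma rel_bound A q W : q \subset A -> (k < #|q|)%N -> dep q W -> unitv W ->
  (\E_ x (W x * cE A x)) * P q <=
  Ck * (\E_ x (W x * cE q x)) * P A + beta' * P A * P q.
Proof. by case: HG => _ _ _ /(_ a good_below) [_ H]; apply: H. Qed.

Lemma cE_prod A x : cE A x =
  \prod_(f | [&& f \in Fam, (#|f| <= k)%N & f \subset A]) (gam f x == a f)%:R.
Proof. by rewrite prod_bool; congr ((nat_of_bool _)%:R); apply: eq_forallb. Qed.

Lemma top_card A f : f \in top A -> #|f| = k.+1.
Proof. by rewrite inE => /and3P[_ /eqP]. Qed.

Lemma phi_unit f : unitv (phi f).
Proof. exact: unitv_bool. Qed.

Lemma phi_dep f : #|f| = k.+1 -> dep f (phi f).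
Proof. by move=> fk; apply: (dep_comp (fun n => (n == a f)%:R) (dc fk)). Qed.

(** Inside a good cell the indicator of a colour may be replaced by its density.
    The part orthogonal to the fine colouring has a cut norm far below the
    probability of the cell; the bias is small relative to the cell of [f], and
    [rel_bound] carries this over to the cell of [A]. *)
Lemma face_estimate A f q W (L : {set {set J}}) :
  f \in top A -> ~~ (f \subset q) -> dep q W -> unitv W ->
  (forall g, g \in L -> #|g| = k.+1) -> f \notin L ->
  `|\E_ x (cE A x * (W x * \prod_(g in L) phi g x) * (phi f x - dens f a))| <=
  (Ck * eps1 + beta' + s) * P A.
Proof.
move=> ft fq dW uW Lk fL; have fk := top_card ft.
move: ft; rewrite inE => /and3P[fF _ fA].
have := Ga fF; rewrite fk leqnn => /(_ isT).
rewrite /next_good fk eqxx => /and3P[aK _ small].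
pose w g x := (if g == q then W x else 1) * (if g \in L then phi g x else 1) *
  (if [&& g \in Fam, (#|g| <= k)%N & g \subset A] then (gam g x == a g)%:R else 1).
have wE x : cE A x * (W x * \prod_(g in L) phi g x) =
    \prod_(g : {set J} | ~~ (f \subset g)) w g x.
  rewrite !big_split /= mulrC; congr (_ * _ * _).
  - by rewrite -big_mkcondr (big_pred1 q) // => g; rewrite /= andbC; case: eqP => // ->.
  - rewrite -big_mkcondr; apply: eq_bigl => g /=.
    case: (boolP (g \in L)) => gL; rewrite ?andbF // andbT.
    symmetry; apply: contra fL => fg; rewrite (_ : f = g) //.
    by apply/eqP; rewrite eqEcard fg fk (Lk _ gL) leqnn.
  - rewrite cE_prod -big_mkcondr; apply: eq_bigl => g /=.
    case: and3P => [[_ gk _]|]; rewrite ?andbF // andbT.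
    by symmetry; apply: contraTN gk => /subset_leq_card; rewrite fk -ltnNge.
have uw g : unitv (w g).
  have u1 : unitv (fun _ : Om => 1 : R) by move=> y; rewrite ler01 lexx.
  apply: unitvM; first apply: unitvM.
  - by move=> x; case: eqP => _; [apply: uW | apply: u1].
  - by move=> x; case: ifP => _; [apply: phi_unit | apply: u1].
  - by move=> x; case: ifP => _; [apply: (unitv_bool R (fun x => gam g x == a g)) | apply: u1].
have dw g : dep g (w g).
  move=> x y xy; rewrite /w; congr (_ * _ * _).
  - by case: eqP => // gq; apply: dW => j; rewrite -gq; apply: xy.
  - by case: ifP => // gL; apply: phi_dep => //; apply: Lk.
  case: ifP => // /and3P[_ gk _]; case: HG => -[dg _] _ _ _.
  by rewrite (dg g gk x y).
have split_phi x : cE A x * (W x * \prod_(g in L) phi g x) * (phi f x - dens f a) =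
   (phi f x - ce (prof C' f) (ind f (a f)) x) * \prod_(g : {set J} | ~~ (f \subset g)) w g x +
   cE A x * (W x * \prod_(g in L) phi g x) * bias f a x.
  by rewrite -wE /bias; ring.
rewrite (eq_avg split_phi) avgD; apply: le_trans (ler_normD _ _) _.
rewrite addrC mulrDl; apply: lerD; last first.
  apply: le_trans (_ : s * delta <= _); last by rewrite ler_wpM2l // P_ge.
  apply: (cut_le_prod (f := f) o _ (Hcut fk aK) (A := id)) => //.
  exact: (dep_comp2 (fun u v => u - v) (phi_dep fk) (ce_prof_dep (ind f (a f)) dC')).
apply: (@le_trans _ _ (\E_ x (`|bias f a x| * cE A x))).
  apply: le_trans (ler_norm_avg _) _; apply: ler_avg => x.
  rewrite normrM mulrC ler_wpM2l // normrM ger0_norm ?ler0n // ler_piMr ?ler0n //.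
  have /andP[l0 l1] := uW x.
  have /andP[l0' l1'] := unitv_prod (index_enum _) (P := mem L) (fun g _ => phi_unit g) x.
  by rewrite ger0_norm ?mulr_ge0 // mulr_ile1.
have db : dep f (fun x => `|bias f a x|).
  exact: (dep_comp (fun t => `|t - dens f a|) (ce_prof_dep (ind f (a f)) dC')).
have ub : unitv (fun x => `|bias f a x|).
  move=> x; rewrite normr_ge0 /= ler_norml /bias.
  have /andP[l0 l1] := dens_unit f a.
  have /andP[l0' l1'] := ce_unitv (prof C' f) x (unitv_bool R (fun x => c f x == a f)).
  by rewrite -/(ind f (a f)) in l0' l1'; lra.
have := rel_bound fA _ db ub; rewrite fk ltnSn => /(_ isT) rb.
have PfP := P_gt0 f; have PAP := P_gt0 A.
rewrite -(ler_pM2r PfP); apply: le_trans rb _.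
have : Ck * \E_ x (`|bias f a x| * cE f x) <= Ck * (eps1 * P f).
  by rewrite ler_pM2l.
by move/(ler_wpM2r (ltW PAP)); lra.
Qed.

Definition face_error : R := Ck * eps1 + beta' + s.

(** The faces of [L] are removed one at a time by [face_estimate]. *)
Lemma telescope A q W (L : {set {set J}}) :
  L \subset top A -> (forall f, f \in L -> ~~ (f \subset q)) -> dep q W -> unitv W ->
  `|\E_ x (cE A x * (W x * \prod_(g in L) phi g x)) -
    (\prod_(g in L) dens g a) * \E_ x (cE A x * W x)| <=
  #|L|%:R * face_error * P A.
Proof.
move=> LA Lq dW uW; have [n] := ubnP #|L|.
elim: n L LA Lq => // n IH L LA Lq Ln.
have [->|[f fL]] := set_0Vmem L.
  rewrite big_set0 mul1r cards0 !mul0r (eq_avg (g := fun x => cE A x * W x)).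
    by rewrite subrr normr0.
  by move=> x; rewrite big_set0 mulr1.
pose L' := L :\ f; have L'L : L' \subset L by apply: subD1set.
have cardL : #|L| = #|L'|.+1 by rewrite (cardsD1 f) fL.
have ft := fintype.subsetP LA f fL.
have := @face_estimate A f q W L' ft (Lq f fL) dW uW.
rewrite finset.setD11 => /(_ _ isT) est.
have {est} := est (fun g gL => top_card (fintype.subsetP LA g (fintype.subsetP L'L g gL))).
have := IH L' (fintype.subset_trans L'L LA) (fun g gL => Lq g (fintype.subsetP L'L g gL)).
rewrite -cardL -ltnS => /(_ Ln).
rewrite cardL -addn1 natrD !(big_setD1 f fL) /= -/L' -/face_error.
have -> : \E_ x (cE A x * (W x * \prod_(g in L) phi g x)) =
  \E_ x (cE A x * (W x * \prod_(g in L') phi g x) * (phi f x - dens f a)) +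
  dens f a * \E_ x (cE A x * (W x * \prod_(g in L') phi g x)).
  by rewrite -avgZ -avgD; apply: eq_avg => x; rewrite (big_setD1 f fL) /= -/L'; ring.
move: (\E_ x _) (\E_ x (cE A x * (W x * _))) => X Y.
have /andP[d0 d1] := dens_unit f a.
rewrite !ler_norml => /andP[h1 h2] /andP[h3 h4].
have := P_gt0 A; set D := \prod_(i in L') _ in h1 h2 *; set Z := \E_ x _ in h1 h2 *.
set e1 := _ * P A in h1 h2 => PA0.
have e0 : 0 <= e1.
  by rewrite -oppr_le0; lra.
have -> : (#|L'|%:R + 1) * face_error * P A = e1 + face_error * P A.
  by rewrite /e1; ring.
have h5 : dens f a * (Y - D * Z) <= e1 by nra.
have h6 : - e1 <= dens f a * (Y - D * Z) by nra.
by apply/andP; split; lra.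
Qed.

Let m := #|{set J}|.
Let S := m%:R * face_error.
Hypothesis kap_le1 : kap <= 1.
Hypothesis S_small : 2 * S <= kap ^+ m.
Hypothesis beta_big : 8 * beta' + 2 * S <= beta * kap ^+ m.

Lemma cell1E A x : (cell gam1 k.+1 A a x)%:R = cE A x * \prod_(g in top A) phi g x.
Proof.
rewrite /cE /phi /ind prod_bool -natrM mulnb; congr ((nat_of_bool _)%:R).
apply/cellP/andP => [H|[/cellP H1 /forall_inP H2] f fF fk fA].
  split; first by apply/cellP => f fF fk fA; rewrite -gam1_lt ?ltnS // H // leqW.
  apply/forall_inP => f; rewrite inE => /and3P[fF /eqP fk fA].
  by rewrite -gam1_top // H // fk.
move: fk; rewrite leq_eqVlt => /predU1P[fk|fk]; last by rewrite gam1_lt // H1.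
by rewrite gam1_top //; apply/eqP/H2; rewrite inE fF fk eqxx.
Qed.

Lemma dens_prod (L : {set {set J}}) A : L \subset top A ->
  kap ^+ m <= \prod_(g in L) dens g a <= 1.
Proof.
move=> LA; apply/andP; split; last by apply: prodr_ile1 => g _; apply: dens_unit.
apply: (@le_trans _ _ (\prod_(g in L) kap)); last first.
  apply: ler_prod => g gL; rewrite (ltW kap_gt0) /=.
  have := fintype.subsetP LA g gL; rewrite inE => /and3P[gF /eqP gk _].
  have := Ga gF; rewrite gk leqnn => /(_ isT).
  by rewrite /next_good gk eqxx => /and3P[].
by rewrite prodr_const ler_wiXn2l ?(ltW kap_gt0) // max_card.
Qed.

Lemma card_error (L : {set {set J}}) A : 0 <= face_error ->
  #|L|%:R * face_error * P A <= S * P A.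
Proof.
move=> e0; rewrite ler_wpM2r ?(ltW (P_gt0 A)) // ler_wpM2r // ler_nat.
exact: max_card.
Qed.

Lemma face_error_ge0 : 0 <= face_error.
Proof. by rewrite !addr_ge0 // mulr_ge0 // ltW. Qed.

Lemma P1_close A : `|P1 A - (\prod_(g in top A) dens g a) * P A| <= S * P A.
Proof.
have nonempty f : f \in top A -> ~~ (f \subset finset.set0).
  by move=> /top_card fk; rewrite finset.subset0 -cards_eq0 fk.
have := @telescope A finset.set0 (fun=> 1) (top A) (fintype.subxx _) nonempty.
move=> /(_ (fun _ _ _ => erefl)) /(_ (fun _ => _)).
rewrite ler01 lexx => /(_ (fun _ => isT)) le.
apply: le_trans (card_error (top A) A face_error_ge0); apply: le_trans le.
rewrite le_eqVlt; apply/orP; left; apply/eqP; congr `|_ - _ * _|.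
  by apply: eq_avg => x; rewrite cell1E mul1r.
by apply: eq_avg => x; rewrite mulr1.
Qed.

(** For the comparison between [q] and [A], the faces in [A] but not in [q] are
    replaced by their densities; those inside [q] are absorbed in [W], where the
    bound for faces of size [k] applies. *)
Lemma next_cell_bounds :
  kap ^+ m * delta / 2 <= P1 [set: J] /\
  forall A q W, q \subset A -> (k.+1 < #|q|)%N -> dep q W -> unitv W ->
    (\E_ x (W x * (cell gam1 k.+1 A a x)%:R)) * P1 q <=
    4 * Ck * (\E_ x (W x * (cell gam1 k.+1 q a x)%:R)) * P1 A + beta * P1 A * P1 q.
Proof.
have km0 : 0 < kap ^+ m by apply: exprn_gt0.
have S0 : 0 <= S by rewrite mulr_ge0 // face_error_ge0.
have low A : [/\ kap ^+ m * P A <= (\prod_(g in top A) dens g a) * P A,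
   (\prod_(g in top A) dens g a) * P A <= 2 * P1 A &
   P1 A <= 2 * ((\prod_(g in top A) dens g a) * P A)].
  have /andP[l1 _] := dens_prod (fintype.subxx (top A)).
  exact: close_bounds (P_gt0 A) l1 S_small (P1_close A).
split.
  have [h1 h2 _] := low [set: J]; rewrite ler_pdivrMr // [leRHS]mulrC.
  apply: le_trans h2; apply: le_trans h1.
  by rewrite ler_pM2l // P_ge.
move=> A q W qA qk dW uW.
pose W1 x := W x * \prod_(g in top q) phi g x.
have dW1 : dep q W1.
  move=> x y xy; congr (_ * _); first exact: dW.
  apply: eq_bigr => g gt; apply: phi_dep (top_card gt) _ _ _ => j jg.
  by apply: xy; move: gt; rewrite inE => /and3P[_ _ /fintype.subsetP]; apply.
have uW1 : unitv W1.
  apply: unitvM => //; apply: unitv_prod => g _; exact: phi_unit.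
have tqA : top q \subset top A.
  apply/fintype.subsetP => g; rewrite !inE => /and3P[-> -> gq] /=.
  exact: fintype.subset_trans gq qA.
have tdis g : g \in top A :\: top q -> ~~ (g \subset q).
  by rewrite !inE => /andP[H /and3P[gF gk gA]]; move: H; rewrite gF gk.
have := @telescope A q W1 (top A :\: top q) (finset.subsetDl _ _) tdis dW1 uW1.
move=> /le_trans /(_ (card_error _ A face_error_ge0)).
have -> : \E_ x (cE A x * (W1 x * \prod_(g in top A :\: top q) phi g x)) =
  \E_ x (W x * (cell gam1 k.+1 A a x)%:R).
  apply: eq_avg => x; rewrite cell1E [in RHS](big_setID (top q)) /= (finset.setIidPr tqA) /W1.
  by ring.
have -> : \E_ x (W x * (cell gam1 k.+1 q a x)%:R) = \E_ x (W1 x * cE q x).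
  by apply: eq_avg => x; rewrite cell1E /W1; ring.
have -> : \E_ x (cE A x * W1 x) = \E_ x (W1 x * cE A x).
  by apply: eq_avg => x; rewrite mulrC.
have := rel_bound qA (ltnW qk) dW1 uW1.
have Y0 : 0 <= \E_ x (W1 x * cE q x).
  by apply: avg_ge0 => x; rewrite mulr_ge0 ?ler0n //; have /andP[] := uW1 x.
move: (\E_ x (W x * _)) (\E_ x (W1 x * cE A x)) (\E_ x (W1 x * cE q x)) Y0.
move=> X Xa Y Y0 H2 /(le_trans (ler_norm _)); rewrite lerBlDl => H1.
have [l1 l2 l3] := low A; have [k1 k2 k3] := low q.
have : \prod_(g in top A) dens g a =
  (\prod_(g in top q) dens g a) * \prod_(g in top A :\: top q) dens g a.
  by rewrite (big_setID (top q)) /= (finset.setIidPr tqA).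
have /andP[p2lo p2hi] := dens_prod (finset.subsetDl (top A) (top q)).
have /andP[p1lo p1hi] := dens_prod (fintype.subxx (top q)).
move: p1lo p1hi p2lo p2hi l1 l2 l3 k1 k2 k3 H1 H2.
have PA := P_gt0 A; have Pq := P_gt0 q.
set p1 := \prod_(g in top q) _; set p2 := \prod_(g in _ :\: _) _.
set p := \prod_(g in top A) _.
move: p1 p2 p => p1 p2 p p1lo p1hi p2lo p2hi l1 l2 l3 k1 k2 k3 H1 H2 pE.
apply: (next_cell_arith (Xa := Xa) (p1 := p1) (p2 := p2) (PA := P A) (Pq := P q)
  (b' := beta') (S := S) (km := kap ^+ m)); rewrite -?pE //.
Qed.

End Count.
Lemma next_good_cells : 0 < Ck -> 0 <= s -> 0 < delta -> 0 <= beta' -> kap <= 1 ->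
  2 * (#|{set J}|%:R * face_error) <= kap ^+ #|{set J}| ->
  8 * beta' + 2 * (#|{set J}|%:R * face_error) <= beta * kap ^+ #|{set J}| ->
  good_cells gam1 next_good k.+1 (4 * Ck) beta eps (maxn K T)
    (kap ^+ #|{set J}| * delta / 2).
Proof.
move=> Ck0 s0 d0 b'0 k1 Ssmall bbig; case: (HG) => -[dg gT] Gloc _ _; split.
- split=> [f|f x]; rewrite leq_eqVlt => /predU1P[fk|fk].
  + by move=> x y xy; rewrite !gam1_top // (dc fk xy).
  + by move=> x y xy; rewrite !gam1_lt // (dg f fk x y).
  + by rewrite gam1_top // leq_max cK.
  + by rewrite gam1_lt // leq_max gT // orbT.
- move=> f a a' E; rewrite /next_good; case: eqP => [fk|_]; last exact: Gloc.
  have Ef : a f = a' f by apply: E.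
  have Eface : face f a =1 face f a'.
    by move=> x; apply: eq_forallb_in => g /boundary_sub gf; rewrite E.
  have Edens : dens f a = dens f a'.
    by rewrite /dens Ef (eq_bigl _ _ Eface) [in X in _ / X](eq_bigl _ _ Eface).
  have Ecell x : cell gam k f a x = cell gam k f a' x.
    by apply/cellP/cellP => H g gF gk gf; rewrite H // E.
  have -> : pr (cell gam k f a) = pr (cell gam k f a').
    by apply: eq_avg => x; rewrite Ecell.
  rewrite Ef Edens (eq_avg (g := fun x => `|bias f a' x| * (cell gam k f a' x)%:R)) // => x.
  by rewrite Ecell /bias Ef Edens.
- exact: next_good_pr.
- by move=> a Ga; apply: next_cell_bounds.
Qed.

End Step.

Lemma good_cells_weaken V (gam : colouring V) G k C beta eps T T' delta delta' :
  (T <= T')%N -> delta' <= delta ->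
  good_cells gam G k C beta eps T delta -> good_cells gam G k C beta eps T' delta'.
Proof.
move=> TT dd [[dg gT] Gloc Gpr Gcell]; split=> //.
  by split=> // f x fk; apply: leq_trans TT; apply: gT.
by move=> a /Gcell[le ?]; split=> //; apply: le_trans le.
Qed.

Lemma pos_lower_bound N (d : nat -> R) : (forall n, 0 < d n) ->
  exists2 d0, 0 < d0 & forall n, (n <= N)%N -> d0 <= d n.
Proof.
move=> d_gt0; elim: N => [|N [d1 d10 dN]].
  by exists (d 0%N) => // n; rewrite leqn0 => /eqP ->.
exists (Num.min d1 (d N.+1)); first by rewrite lt_min d10 d_gt0.
move=> n; rewrite leq_eqVlt ge_min => /predU1P[->|/dN ->//].
by rewrite lexx orbT.
Qed.

Lemma half_split (L eps : R) : 0 < L -> L * (eps / (2 * L) + eps / (2 * L)) = eps.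
Proof. by move=> L0; field; rewrite gt_eqF. Qed.

Lemma error_split (M e X : R) : 0 <= e -> (8 + 2 * M) * e <= X ->
  2 * (M * e) <= X /\ 8 * (e / 3) + 2 * (M * e) <= X.
Proof. by move=> e0 h; split; lra. Qed.

(** The given colouring of the faces of size [k.+1] is regularised by one of the
    faces of size [k], to which the induction hypothesis applies. The accuracy
    required of the fine colouring depends on the probability bound that the
    hypothesis provides for the coarse one, hence on its number of colours. *)
Lemma cell_countingS k : cell_counting k -> cell_counting k.+1.
Proof.
case=> Ck [Ck0 IH]; exists (4 * Ck); split; first by rewrite mulr_gt0.
move=> K beta eps beta0 eps0.
set m := #|{set J}|.
have K1 : 0 < K.+1%:R :> R by rewrite ltr0n.
(* Half of [eps] is spent on colours of density below [kap]. *)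
pose kap := Num.min 1 (eps / (2 * K.+1%:R)).
have kap0 : 0 < kap by rewrite lt_min ltr01 divr_gt0 // mulr_gt0.
have kap1 : kap <= 1 by rewrite ge_min lexx.
have km0 : 0 < kap ^+ m by apply: exprn_gt0.
have m1 : 0 < 8 + 2 * m%:R :> R by rewrite ltr_wpDr // mulr_ge0.
(* The error per face: [m] faces together stay below half of the smallest
   product of densities, [kap ^+ m], and below [beta] after division by it. *)
pose e := kap ^+ m * Num.min 1 beta / (8 + 2 * m%:R).
have e0 : 0 < e by rewrite divr_gt0 // mulr_gt0 // lt_min ltr01.
have e_small : (8 + 2 * m%:R) * e <= kap ^+ m.
  by rewrite /e mulrC divfK ?gt_eqF // ler_piMr ?(ltW km0) // ge_min lexx.
have e_beta : (8 + 2 * m%:R) * e <= beta * kap ^+ m.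
  rewrite /e mulrC divfK ?gt_eqF // mulrC ler_wpM2r ?(ltW km0) //.
  by rewrite ge_min lexx orbT.
(* The three sources of this error get equal shares. *)
pose eps1 := e / (3 * Ck).
have eps10 : 0 < eps1 by rewrite divr_gt0 // mulr_gt0.
pose eta := eps1 * (eps / (2 * K.+1%:R)).
have eta0 : 0 < eta by rewrite mulr_gt0 // divr_gt0 // mulr_gt0.
have e30 : 0 < e / 3 by rewrite divr_gt0.
have /boolp.choice[Td HTd] : forall n, exists Td : nat * R, 0 < Td.2 /\
  forall (V : J -> finType) (o : config V) (c : colouring V),
    (forall f, #|f| = k -> dep f (c f)) ->
    (forall f x, #|f| = k -> (c f x < n)%N) ->
    exists gam G, (forall f, #|f| = k -> gam f = c f) /\
    good_cells gam G k Ck (e / 3) eps Td.1 Td.2.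
  by move=> n; have [T [d H]] := IH n _ _ e30 eps0; exists (T, d).
have [N HN] := @strong_regularity R J
  (Datatypes_prod__canonical__fintype_Finite {set J} 'I_K) eta
  (fun n => e / 3 * (Td n).2) eta0 (fun n => mulr_gt0 e30 (HTd n).1).
have [d0 d00 d0N] := pos_lower_bound N (fun n => (HTd n).1).
exists (maxn K (\max_(n < N.+1) (Td n).1)), (kap ^+ m * d0 / 2).
split; first by rewrite divr_gt0 // mulr_gt0.
move=> V o c dc cK.
pose h (p : {set J} * 'I_K) x : R := (c p.1 x == p.2)%:R.
have [n [C [C' [nN dC Cn dC' reg]]]] := HN V o (fun p => p.1) h
  (fun p => unitv_bool R (fun x => c p.1 x == p.2)).
have [gam [G [gamC HG]]] := (HTd n).2 V o C (fun f _ => dC f) (fun f x _ => Cn f x).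
exists (next_gam k c gam), (next_good k K c gam C' G kap eps1); split.
  by move=> f fk; rewrite /next_gam fk eqxx.
have profE f : #|f| = k.+1 -> prof gam f = prof C f.
  move=> fk; apply/boolp.funext => x; apply/ffunP => g; rewrite !ffunE.
  by case: ifP => // gf; rewrite gamC // (boundary_card fk gf).
have le_d : kap ^+ m * d0 / 2 <= kap ^+ m * (Td n).2 / 2.
  by rewrite ler_pM2r ?invr_gt0 // ler_pM2l // d0N.
have le_T : (maxn K (Td n).1 <= maxn K (\max_(n < N.+1) (Td n).1))%N.
  rewrite geq_max leq_maxl leq_max; apply/orP; right.
  exact: (@leq_bigmax _ (fun n : 'I_N.+1 => (Td n).1) (Ordinal (nN : (n < N.+1)%N))).
apply: (good_cells_weaken le_T le_d).
have face_err : Ck * eps1 + e / 3 + e / 3 = e.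
  by rewrite /eps1; field; rewrite gt_eqF.
apply: (@next_good_cells k K V o c gam C' G Ck (e / 3) beta eps (Td n).2
    (e / 3) kap eps1 eta) => //; rewrite ?(ltW e30) ?(HTd n).1 //.
- move=> f v fk vK; have := (reg (f, Ordinal vK)).1.
  by rewrite /= -(profE f fk).
- by move=> f v fk vK; have := (reg (f, Ordinal vK)).2.
- rewrite /eta [_ / eps1]mulrAC divff ?gt_eqF // mul1r.
  have kle : kap <= eps / (2 * K.+1%:R) by rewrite ge_min lexx orbT.
  apply: (@le_trans _ _ (K.+1%:R * (eps / (2 * K.+1%:R) + eps / (2 * K.+1%:R)))).
    rewrite ler_pM ?ler_nat // ?lerD //.
    by rewrite addr_ge0 ?(ltW kap0) // divr_ge0 ?mulr_ge0 // ltW.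
  by rewrite half_split.
- rewrite /face_error face_err -/m; exact: (error_split (ltW e0) e_small).1.
- rewrite /face_error face_err -/m; exact: (error_split (ltW e0) e_beta).2.
Qed.

Lemma cell_counting_all k : cell_counting k.
Proof. by elim: k => [|k IH]; [exact: cell_counting0 | exact: cell_countingS]. Qed.

End Cells.

(** * Removal for bounded weights *)

Section DenseRemoval.
Variables (R : realType) (J : finType).
Implicit Types (e f g q A : {set J}).

Lemma uniform_subset (r : nat) (H : {set {set J}}) (e f : {set J}) :
  uniform_hypergraph r H -> e \in H -> f \in H -> f \subset e -> f = e.
Proof. by move=> uH eH fH fe; apply/eqP; rewrite eqEcard fe (uH e eH) (uH f fH) leqnn. Qed.

(** The edges of weight at least [eps / 2] are coloured and a proper pattern is
    kept if it becomes acceptable once all edges get that colour. If every edge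
    kept its pattern at some configuration, the resulting full pattern would
    occur with probability bounded below, against the smallness of the average
    of the product. *)
Lemma dense_removal (r : nat) (H : {set {set J}}) (eps : R) :
  uniform_hypergraph r H -> 0 < eps ->
  exists (T : nat) (delta : R), 0 < delta /\
  forall (V : J -> finType) (o : config V) (g : {set J} -> config V -> R),
    (forall e, e \in H -> dep e (g e)) -> (forall e, e \in H -> unitv (g e)) ->
    \E_ x (\prod_(e in H) g e x) <= delta ->
  exists (gam : colouring V) (E : {set J} -> ({set J} -> nat) -> bool),
    [/\ (forall f, (#|f| < r)%N -> dep f (gam f)),
        (forall f x, (#|f| < r)%N -> (gam f x < T)%N),
        (forall e a a', e \in H -> (forall g : {set J}, g \proper e -> a g = a' g) ->
           E e a = E e a'),
        (forall x, ~ (forall e, e \in H -> E e (gam^~ x)))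
      & forall e, e \in H -> \E_ x (g e x * (~~ E e (gam^~ x))%:R) <= eps].
Proof.
move=> uH eps0; pose Fam := [set f : {set J} | [exists (e | e \in H), f \subset e]].
have FamP f e : e \in H -> f \subset e -> f \in Fam.
  by move=> eH fe; rewrite inE; apply/exists_inP; exists e.
have down f g : f \in Fam -> g \subset f -> g \in Fam.
  by rewrite !inE => /exists_inP[e eH fe] gf; apply/exists_inP; exists e => //;
    apply: fintype.subset_trans gf fe.
have eps20 : 0 < eps / 2 by rewrite divr_gt0.
have m0 : 0 < #|{set J}|.+1%:R :> R by rewrite ltr0n.
have [C [_ HC]] := cell_counting_all R down r.
have eps'0 : 0 < eps / 2 / #|{set J}|.+1%:R by rewrite divr_gt0.
have [T [d [d0 HT]]] := HC 2%N 1 _ ltr01 eps'0.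
exists T, (d * (eps / 2) ^+ #|H| / 2); split.
  by rewrite divr_gt0 // mulr_gt0 // exprn_gt0.
move=> V o g dg ug small.
pose c : colouring V := fun f x => ((f \in H) && (eps / 2 <= g f x) : nat).
have [||gam [G [gamE [[dgam gamT] Gloc Gpr Gcell]]]] := HT V o c.
- move=> f _ x y xy; rewrite /c; case: (boolP (f \in H)) => //= fH.
  by rewrite (dg f fH x y).
- by move=> f x _; rewrite /c; case: (_ && _).
pose upd a (f : {set J}) : nat := if f \in H then 1%N else a f.
pose E (e : {set J}) a :=
  [forall f : {set J}, [&& f \in Fam, (#|f| <= r)%N & f \subset e] ==> G f (upd a)].
exists gam, E; split.
- by move=> f /ltnW; apply: dgam.
- by move=> f x /ltnW; apply: gamT.
- move=> e a a' eH aa'; apply: eq_forallb => f; case: and3P => //= -[_ _ fe].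
  apply: Gloc => h hf; rewrite /upd; case: (boolP (h \in H)) => // hH.
  apply: aa'; rewrite finset.properEneq (fintype.subset_trans hf fe) andbT.
  by apply: contraNneq hH => ->.
- move=> x Ex; have Ga f : f \in Fam -> (#|f| <= r)%N -> G f (upd (gam^~ x)).
    move=> fF fr; move: (fF); rewrite inE => /exists_inP[e eH fe].
    by have /forallP/(_ f)/implyP := Ex e eH; apply; rewrite fF fr.
  have [dP _] := Gcell _ Ga.
  have : (eps / 2) ^+ #|H| * pr R (cell Fam gam r [set: J] (upd (gam^~ x))) <=
         \E_ y (\prod_(e in H) g e y).
    rewrite /pr -avgZ; apply: ler_avg => y.
    have [/cellP cy|_] := boolP (cell _ _ _ _ _ _); last first.
      by rewrite mulr0 prodr_ge0 // => e eH; have /andP[] := ug e eH y.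
    rewrite mulr1 -prodr_const; apply: ler_prod => e eH; rewrite (ltW eps20) /=.
    have := cy e (FamP e e eH (fintype.subxx e)).
    rewrite (uH e eH) leqnn finset.subsetT => /(_ isT isT).
    by rewrite gamE ?uH // /c /upd eH /=; case: lerP.
  move: small dP; set P := pr _ _; set A := avg _; have q0 := exprn_gt0 #|H| eps20.
  move: q0; set q := _ ^+ #|H|; move: q P A => q P A q0 h1 h2 h3.
  have h4 : q * d <= q * P by rewrite ler_pM2l.
  have h5 : 0 < q * d by rewrite mulr_gt0.
  by lra.
move=> e eH.
pose bad f x : R := if (f \in Fam) && (#|f| <= r)%N then (~~ G f (gam^~ x))%:R else 0.
have bad_ge0 f x : 0 <= bad f x by rewrite /bad; case: ifP.
apply: (@le_trans _ _ (\E_ x (eps / 2 + \sum_(f : {set J}) bad f x))).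
  apply: ler_avg => x; have /andP[g0 g1] := ug e eH x.
  have [gbig|gsmall] := lerP (eps / 2) (g e x); last first.
    apply: (@le_trans _ _ (g e x)); first by rewrite ler_piMr //; case: (E _ _).
    by rewrite ler_wpDr ?(ltW gsmall) // sumr_ge0.
  case: (boolP (E e _)) => [_|]; rewrite ?mulr0 ?mulr1.
    by rewrite addr_ge0 ?(ltW eps20) // sumr_ge0.
  case/forallPn => f; rewrite negb_imply => /andP[/and3P[fF fr fe]].
  have -> : G f (upd (gam^~ x)) = G f (gam^~ x).
    apply: Gloc => h hf; rewrite /upd; case: ifP => // hH.
    have -> : h = e by apply: uniform_subset uH eH hH (fintype.subset_trans hf fe).
    by rewrite gamE ?uH // /c eH gbig.
  move=> nG; rewrite ler_wpDl ?(ltW eps20) // (bigD1 f) //= {1}/bad fF fr nG.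
  by apply: le_trans g1 _; rewrite lerDl sumr_ge0.
rewrite avgD (avg_cst o) avg_sum.
have : \sum_(f : {set J}) avg (bad f) <= \sum_(f : {set J}) (eps / 2 / #|{set J}|.+1%:R).
  apply: ler_sum => f _; rewrite /bad; case: (boolP ((f \in Fam) && _)) => [/andP[fF fr]|_].
    exact: Gpr.
  by rewrite (avg_cst o) ltW // divr_gt0.
rewrite sumr_const -[_ *+ _]mulr_natr => bound.
have last : eps / 2 / #|{set J}|.+1%:R * #|{set J}|%:R <= eps / 2.
  by rewrite mulrAC ler_pdivrMr // ler_pM2l // ler_nat leqnSn.
rewrite [leRHS]splitr lerD2l; exact: le_trans bound last.
Qed.

End DenseRemoval.

(** * Doubling of coordinates *)

Section Doubling.
Variables (R : realType) (J : finType) (V : J -> finType) (o : config V).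
Local Notation Om := (config V).
Implicit Types (A B e f g q : {set J}) (x y z : Om) (F : Om -> Om -> R).

(** Cauchy--Schwarz in the coordinate [j]: the factor [P] that does not see it
    is replaced by its majorant, the other factor is doubled. *)
Lemma resample_cauchy (j : J) (P Q N : Om -> Om -> R) :
  (forall y, dep (~: [set j]) (P^~ y)) ->
  (forall y, dep (~: [set j]) (N^~ y)) -> (forall x, dep (~: [set j]) (N x)) ->
  (forall x, dep (~: [set j]) (Q x)) -> (forall x y, `|P x y| <= N x y) ->
  (\E_ x (\E_ y (P x y * Q x y))) ^+ 2 <=
  \E_ x (\E_ y N x y) *
  \E_ x (\E_ y (N x y * (Q x y * Q (mix [set j] y x) y))).
Proof.
move=> dP dN dN' dQ PN; set A := ~: [set j] in dP dN dN' dQ.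
pose T y x := cavg A (Q^~ y) x.
have -> : \E_ x (\E_ y (P x y * Q x y)) = \E_ x (\E_ y (P x y * T y x)).
  rewrite avg_exchange [RHS]avg_exchange; apply: eq_avg => y.
  by rewrite avg_cavgM.
have -> : \E_ x (\E_ y (N x y * (Q x y * Q (mix [set j] y x) y))) =
          \E_ x (\E_ y (N x y * T y x ^+ 2)).
  rewrite [RHS]avg_exchange.
  have E y : \E_ x (N x y * T y x ^+ 2) =
      \E_ x (\E_ z (N x y * Q x y * Q (mix A x z) y)).
    rewrite -(avg_cavg_sqr (Q^~ y) (Q^~ y) o (dN y)); apply: eq_avg => x.
    by rewrite expr2.
  rewrite [RHS](eq_avg E) [RHS]avg_exchange; apply: eq_avg => x.
  rewrite -(avg_mix1 A _ o); apply: eq_avg => y; apply: eq_avg => z.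
  rewrite -mulrA dep_mix //; congr (_ * (_ * _)); first by rewrite dep_mix.
  rewrite dep_mix //; congr (Q _ y); apply: pointP => l.
  by rewrite !mixE !inE; case: eqP.
rewrite -[X in X ^+ 2]avg_pair -[X in _ <= X * _]avg_pair -[X in _ <= _ * X]avg_pair.
exact: (avg_cauchy_le (fun p => T p.2 p.1) (fun p => PN p.1 p.2)).
Qed.

Lemma prod_subsets_setU1 (F : {set J} -> R) j A : j \notin A ->
  \prod_(B : {set J} | B \subset j |: A) F B =
  (\prod_(B : {set J} | B \subset A) F B) *
  \prod_(B : {set J} | B \subset A) F (j |: B).
Proof.
move=> jA; rewrite (bigID (fun B : {set J} => j \notin B)) /=; congr (_ * _).
  apply: eq_bigl => B; apply/andP/idP => [[BA jB]|BA].
    apply/fintype.subsetP => i iB; have := fintype.subsetP BA i iB.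
    by rewrite !inE => /predU1P[ij|//]; rewrite -ij iB in jB.
  split; first exact: fintype.subset_trans BA (finset.subsetUr _ _).
  by apply: contra jA; apply: (fintype.subsetP BA).
rewrite (reindex_onto (fun B => j |: B) (fun B => B :\ j)) /=; last first.
  by move=> B /andP[_]; rewrite negbK => jB; rewrite finset.setD1K.
apply: eq_bigl => B; rewrite negbK setU11 andbT.
apply/andP/idP=> [[BA /eqP BE]|BA].
  apply/fintype.subsetP => i iB.
  have ij : i != j by apply: contraTneq iB => ->; rewrite -BE !inE eqxx.
  have := fintype.subsetP BA i; rewrite !inE iB orbT (negbTE ij) => /(_ isT).
  by [].
split; first exact: finset.setUS.
by apply/eqP/finset.setU1K; apply: contra jA; apply: (fintype.subsetP BA).
Qed.

(** Applying this for all [B] inside [A] doubles the coordinates in [A]. *)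
Definition swapped B F x y : R := F (mix B y x) (mix B x y).

(** In the rest of this part the coordinates in [e0] are doubled. The functions of
    two points read the coordinates in [e0] from the first one; the second one
    supplies another copy of the remaining coordinates. The factor [k] sees only
    the coordinates [U k] of [e0]. *)
Variables (e0 : {set J}) (I : finType) (U : I -> {set J}).
Variables (D : Om -> Om -> R) (h b : I -> Om -> Om -> R).
Hypothesis UP : forall k, U k \proper e0.
Hypothesis Dy : forall x, dep (~: e0) (D x).
Hypothesis hy : forall k x, dep (~: e0) (h k x).
Hypothesis hx : forall k y, dep (U k :|: ~: e0) ((h k)^~ y).
Hypothesis b_y : forall k x, dep (~: e0) (b k x).
Hypothesis b_x : forall k y, dep (U k :|: ~: e0) ((b k)^~ y).
Hypothesis hb : forall k x y, 0 <= h k x y <= b k x y.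

Let bound A k := if A \subset U k then h k else b k.

(** The average after doubling the coordinates in [A]; a factor that misses
    one of them has been replaced by its majorant. *)
Definition doubled A : R := \E_ x (\E_ y (
  (\prod_(B : {set J} | B \subset A) swapped B D x y) *
  \prod_k \prod_(B : {set J} | B \subset A :&: U k) swapped B (bound A k) x y)).

Definition side_mass A j : R := \E_ x (\E_ y
  (\prod_(k | j \notin U k) \prod_(B : {set J} | B \subset A :&: U k) swapped B (b k) x y)).

Lemma bound_y A k x : dep (~: e0) (bound A k x).
Proof. by rewrite /bound; case: ifP => _; [apply: hy | apply: b_y]. Qed.

Lemma bound_x A k y : dep (U k :|: ~: e0) ((bound A k)^~ y).
Proof. by rewrite /bound; case: ifP => _; [apply: hx | apply: b_x]. Qed.

Lemma b_ge0 k x y : 0 <= b k x y.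
Proof. by have /andP[] := hb k x y; apply: le_trans. Qed.

Lemma bound_le A k x y : 0 <= bound A k x y <= b k x y.
Proof. by rewrite /bound; case: ifP => _; rewrite ?lexx ?b_ge0 ?hb. Qed.

Lemma sw_dep_y (F : Om -> Om -> R) B j x :
  (forall x, dep (~: e0) (F x)) -> j \in e0 -> j \notin B ->
  dep (~: [set j]) (swapped B F x).
Proof.
move=> Fy je jB y y' yy'; rewrite /swapped.
rewrite (_ : mix B y' x = mix B y x); last first.
  apply: pointP => i; rewrite !mixE; case: ifP => // iB; rewrite yy' // !inE.
  by apply: contraNneq jB => <-.
apply: Fy => i; rewrite !inE !mixE => ie; case: ifP => // _; apply: yy'.
by rewrite !inE; apply: contraNneq ie => ->.
Qed.

Lemma sw_dep_x (F : Om -> Om -> R) B j u y :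
  (forall x, dep (~: e0) (F x)) -> (forall y, dep (u :|: ~: e0) (F^~ y)) ->
  j \in e0 -> j \notin u -> j \notin B -> dep (~: [set j]) ((swapped B F)^~ y).
Proof.
move=> Fy Fx je ju jB x x' xx'; rewrite /swapped.
rewrite (_ : mix B x' y = mix B x y); last first.
  apply: pointP => i; rewrite !mixE; case: ifP => // iB; rewrite xx' // !inE.
  by apply: contraNneq jB => <-.
apply: Fx => i; rewrite !inE !mixE => ie; case: ifP => // _; apply: xx'.
by rewrite !inE; apply: contraTneq ie => ->; rewrite negb_or ju negbK.
Qed.

Lemma sw_double (F : Om -> Om -> R) B j x y :
  (forall x, dep (~: e0) (F x)) -> j \in e0 -> j \notin B ->
  swapped B F (mix [set j] y x) y = swapped (j |: B) F x y.
Proof.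
move=> Fy je jB; rewrite /swapped.
rewrite (_ : mix B y (mix [set j] y x) = mix (j |: B) y x); last first.
  by apply: pointP => i; rewrite !mixE !inE; case: eqP => //=; case: ifP.
apply: Fy => i; rewrite !inE !mixE !inE => ie.
by rewrite (negbTE (_ : i != j)) //; apply: contraNneq ie => ->.
Qed.

(** The factors that miss [j] are bounded by their majorants and taken out by
    [resample_cauchy]. The others are doubled; those that already missed an
    earlier coordinate stay majorants. *)
Lemma doubled_step A j : A \subset e0 -> j \in e0 -> j \notin A ->
  doubled A ^+ 2 <= side_mass A j * doubled (j |: A).
Proof.
move=> Ae je jA.
have jB (B A' : {set J}) : B \subset A :&: A' -> j \notin B.
  move=> BA; apply: contra jA => /(fintype.subsetP BA).
  by rewrite inE => /andP[].
have jB' (B : {set J}) : B \subset A -> j \notin B.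
  by move=> BA; apply: contra jA; apply: (fintype.subsetP BA).
pose P x y := \prod_(k | j \notin U k)
  \prod_(B : {set J} | B \subset A :&: U k) swapped B (bound A k) x y.
pose N x y := \prod_(k | j \notin U k)
  \prod_(B : {set J} | B \subset A :&: U k) swapped B (b k) x y.
pose Q x y := (\prod_(B : {set J} | B \subset A) swapped B D x y) * \prod_(k | j \in U k)
  \prod_(B : {set J} | B \subset A :&: U k) swapped B (bound A k) x y.
have -> : doubled A = \E_ x (\E_ y (P x y * Q x y)).
  apply: eq_avg => x; apply: eq_avg => y; rewrite /P /Q mulrCA; congr (_ * _).
  by rewrite (bigID (fun k => j \notin U k)) /=; congr (_ * _); apply: eq_bigl => k;
    rewrite negbK.
have -> : doubled (j |: A) =
    \E_ x (\E_ y (N x y * (Q x y * Q (mix [set j] y x) y))).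
  apply: eq_avg => x; apply: eq_avg => y; rewrite /N /Q.
  rewrite prod_subsets_setU1 // (bigID (fun k => j \notin U k)) /=.
  have -> : \prod_(k | j \notin U k)
      \prod_(B : {set J} | B \subset (j |: A) :&: U k) swapped B (bound (j |: A) k) x y =
      \prod_(k | j \notin U k)
      \prod_(B : {set J} | B \subset A :&: U k) swapped B (b k) x y.
    apply: eq_bigr => k jU.
    have -> : (j |: A) :&: U k = A :&: U k.
      apply/finset.setP => i; rewrite !inE; case: eqP => // ->.
      by rewrite (negbTE jU) !andbF.
    rewrite /bound (_ : j |: A \subset U k = false) //; apply/negbTE.
    by apply: contra jU => /fintype.subsetP; apply; rewrite setU11.
  have -> : \prod_(k | ~~ (j \notin U k))
      \prod_(B : {set J} | B \subset (j |: A) :&: U k) swapped B (bound (j |: A) k) x y =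
    \prod_(k | j \in U k)
      ((\prod_(B : {set J} | B \subset A :&: U k) swapped B (bound A k) x y) *
      (\prod_(B : {set J} | B \subset A :&: U k) swapped B (bound A k) (mix [set j] y x) y)).
    apply: eq_big => k; rewrite negbK // => jU.
    have -> : (j |: A) :&: U k = j |: (A :&: U k).
      by apply/finset.setP => i; rewrite !inE; case: eqP => // ->; rewrite jU.
    rewrite prod_subsets_setU1; last by rewrite inE (negbTE jA).
    have -> : bound (j |: A) k = bound A k.
      by rewrite /bound finset.subUset finset.sub1set jU.
    congr (_ * _); apply: eq_bigr => B BA; rewrite sw_double //; last exact: jB BA.
    exact: bound_y.
  rewrite big_split /=.
  have -> : \prod_(B : {set J} | B \subset A) swapped B D (mix [set j] y x) y =
            \prod_(B : {set J} | B \subset A) swapped (j |: B) D x y.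
    by apply: eq_bigr => B BA; rewrite sw_double // jB'.
  ring.
apply: resample_cauchy.
- move=> y x x' xx'; apply: eq_bigr => k jU; apply: eq_bigr => B BA.
  by apply: (@sw_dep_x _ B j (U k) y _ _ je jU (jB _ _ BA) x x' xx');
    [exact: bound_y | exact: bound_x].
- move=> y x x' xx'; apply: eq_bigr => k jU; apply: eq_bigr => B BA.
  by apply: (@sw_dep_x _ B j (U k) y _ _ je jU (jB _ _ BA) x x' xx').
- move=> x y y' yy'; apply: eq_bigr => k jU; apply: eq_bigr => B BA.
  exact: (@sw_dep_y _ B j x (b_y k) je (jB _ _ BA) y y' yy').
- move=> x y y' yy'; congr (_ * _).
    by apply: eq_bigr => B BA; apply: (@sw_dep_y _ B j x Dy je (jB' _ BA) y y' yy').
  apply: eq_bigr => k jU; apply: eq_bigr => B BA.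
  by apply: (@sw_dep_y _ B j x _ je (jB _ _ BA) y y' yy'); apply: bound_y.
move=> x y; rewrite ger0_norm; last first.
  apply: prodr_ge0 => k _; apply: prodr_ge0 => B _.
  by rewrite /swapped; have /andP[] := bound_le A k (mix B y x) (mix B x y).
apply: ler_prod => k _; apply/andP; split.
  apply: prodr_ge0 => B _.
  by rewrite /swapped; have /andP[] := bound_le A k (mix B y x) (mix B x y).
by apply: ler_prod => B _; apply: bound_le.
Qed.

(** Each step squares the bound. *)
Lemma doubled_bound beta : 0 <= beta ->
  (forall A j, A \subset e0 -> j \in e0 -> j \notin A -> side_mass A j <= 2) ->
  `|doubled e0| <= 2 * beta ^+ (2 ^ #|e0|) -> `|doubled finset.set0| <= 2 * beta.
Proof.
move=> b0 mass top.
suff H n A : (#|e0 :\: A| <= n)%N -> A \subset e0 -> `|doubled A| <= 2 * beta ^+ (2 ^ #|A|).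
  have := H _ finset.set0 (leqnn _) (finset.sub0set _).
  by rewrite cards0 expn0 expr1.
elim: n A => [|n IH] A.
  rewrite leqn0 cards_eq0 finset.setD_eq0 => eA Ae.
  by have -> : A = e0 by apply/eqP; rewrite finset.eqEsubset Ae.
move=> cA Ae; have [eA|/fintype.subsetPn[j je jA]] := boolP (e0 \subset A).
  by have -> : A = e0 by apply/eqP; rewrite finset.eqEsubset Ae.
have jAe : j |: A \subset e0 by rewrite finset.subUset finset.sub1set je.
have:= IH (j |: A) _ jAe; rewrite cardsU1 jA add1n expnS => /(_ _) IHj.
have {}IHj : `|doubled (j |: A)| <= 2 * beta ^+ (2 * 2 ^ #|A|).
  apply: IHj; rewrite -ltnS; apply: leq_trans cA; apply: proper_card.
  apply/properP; split; first by apply: finset.setDS; apply: finset.subsetUr.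
  by exists j; rewrite !inE ?eqxx ?je ?jA.
have st := doubled_step Ae je jA.
have sm0 : 0 <= side_mass A j.
  apply: avg_ge0 => x; apply: avg_ge0 => y; apply: prodr_ge0 => k _.
  by apply: prodr_ge0 => B _; apply: b_ge0.
have {}st : doubled A ^+ 2 <= (2 * beta ^+ (2 ^ #|A|)) ^+ 2.
  apply: le_trans st _; apply: (@le_trans _ _ (2 * `|doubled (j |: A)|)).
    apply: (@le_trans _ _ (side_mass A j * `|doubled (j |: A)|)).
      by rewrite ler_wpM2l // ler_norm.
    by rewrite ler_wpM2r // mass.
  apply: (@le_trans _ _ (2 * (2 * beta ^+ (2 * 2 ^ #|A|)))); first by rewrite ler_pM2l.
  by rewrite exprMn -exprM mulnC mulrA.
rewrite -(ler_pXn2r (n := 2)) // ?nnegrE ?normr_ge0 ?mulr_ge0 ?exprn_ge0 //.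
by rewrite real_normK ?num_real.
Qed.

Lemma doubled0 : doubled finset.set0 = \E_ x (\E_ y (D x y * \prod_k h k x y)).
Proof.
have sw0 F x y : \prod_(B : {set J} | B \subset finset.set0) swapped B F x y = F x y.
  rewrite (big_pred1 finset.set0) => [|B]; last by rewrite /= finset.subset0.
  by rewrite /swapped; congr F; apply: pointP => i; rewrite !mixE !inE.
apply: eq_avg => x; apply: eq_avg => y; rewrite sw0; congr (_ * _).
by apply: eq_bigr => k _; rewrite finset.set0I sw0 /bound finset.sub0set.
Qed.

Lemma doubled_full : doubled e0 = \E_ x (\E_ y (
  (\prod_(B : {set J} | B \subset e0) swapped B D x y) *
  \prod_k \prod_(B : {set J} | B \subset U k) swapped B (b k) x y)).
Proof.
apply: eq_avg => x; apply: eq_avg => y; congr (_ * _); apply: eq_bigr => k _.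
rewrite (finset.setIidPr (proper_sub (UP k))).
by rewrite /bound (_ : e0 \subset U k = false) //; apply/negbTE; exact: proper_subn (UP k).
Qed.

End Doubling.

(** * Consequences of the linear forms condition *)

Section LinearForms.
Variables (R : realType) (J : finType) (V : J -> finType) (o : config V).
Local Notation Om := (config V).
Implicit Types (A B C e f g q : {set J}) (x y z : Om).
Variables (r : nat) (H : {set {set J}}) (nu : {set J} -> Om -> R).
Hypothesis uH : uniform_hypergraph r H.
Hypothesis r0 : (0 < r)%N.
Hypothesis dnu : forall e, e \in H -> dep e (nu e).

(** The products of weights whose averages the linear forms condition controls;
    [C] is the set of coordinates taken from the second point. *)
Definition nu_form (n : {set J} -> {set J} -> bool) x y : R :=
  \prod_(e in H) \prod_(C : {set J} | C \subset e) nu e (mix C y x) ^+ n e C.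

Definition linear_forms (tau : R) :=
  forall n, `|\E_ x (\E_ y nu_form n x y) - 1| <= tau.

Lemma form_false x y : nu_form (fun _ _ => false) x y = 1.
Proof. by rewrite /nu_form big1 // => e _; rewrite big1. Qed.

Lemma form_add e0 B n x y : e0 \in H -> B \subset e0 -> ~~ n e0 B ->
  nu e0 (mix B y x) * nu_form n x y =
  nu_form (fun e C => n e C || (e == e0) && (C == B)) x y.
Proof.
move=> eH Be nB; rewrite /nu_form (bigD1 e0) //= [RHS](bigD1 e0) //= mulrA.
congr (_ * _); last first.
  by apply: eq_bigr => e /andP[_ /negbTE ->]; apply: eq_bigr => C _; rewrite orbF.
rewrite (bigD1 B) //= [RHS](bigD1 B) //= (negbTE nB) !eqxx expr0 mul1r expr1.
by congr (_ * _); apply: eq_bigr => C /andP[_ /negbTE ->]; rewrite andbF orbF.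
Qed.

(** Expanding one factor leaves two shorter products; at the end two forms, both
    within [tau] of [1], are subtracted from each other. *)
Lemma alternating_small tau e0 (s : seq {set J}) n : linear_forms tau ->
  e0 \in H -> uniq s -> s != [::] -> (forall B, B \in s -> B \subset e0) ->
  (forall B, B \in s -> ~~ n e0 B) ->
  `|\E_ x (\E_ y ((\prod_(B <- s) (nu e0 (mix B y x) - 1)) * nu_form n x y))| <=
  2 ^+ size s * tau.
Proof.
move=> lf eH; elim: s n => // B s IH n /= /andP[Bs us] _ sub nf.
pose n' e C := n e C || (e == e0) && (C == B).
have E : \E_ x (\E_ y ((\prod_(B <- B :: s) (nu e0 (mix B y x) - 1)) * nu_form n x y)) =
    \E_ x (\E_ y ((\prod_(B <- s) (nu e0 (mix B y x) - 1)) * nu_form n' x y)) -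
    \E_ x (\E_ y ((\prod_(B <- s) (nu e0 (mix B y x) - 1)) * nu_form n x y)).
  rewrite -avgB; apply: eq_avg => x; rewrite -avgB; apply: eq_avg => y.
  rewrite big_cons -(form_add x y eH (sub B (mem_head _ _)) (nf B (mem_head _ _))).
  by ring.
rewrite {}E exprS; have [s0|sn0] := eqVneq s [::].
  have E0 m : \E_ x (\E_ y ((\prod_(B <- s) (nu e0 (mix B y x) - 1)) * nu_form m x y)) =
      \E_ x (\E_ y nu_form m x y).
    by apply: eq_avg => x; apply: eq_avg => y; rewrite s0 big_nil mul1r.
  rewrite !E0 s0 expr0 mulr1.
  move: (lf n) (lf n'); rewrite !ler_norml => /andP[? ?] /andP[? ?].
  by apply/andP; split; lra.
apply: le_trans (ler_normB _ _) _; rewrite -mulrA mulr_natl mulr2n.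
apply: lerD; apply: IH => // C Cs; rewrite ?sub ?nf ?inE ?Cs ?orbT //.
rewrite /n' negb_or nf ?inE ?Cs ?orbT //= eqxx /=.
by apply: contraNneq Bs => <-.
Qed.

Lemma exp_small (beta : R) (N M : nat) : 0 < beta ->
  exists2 t, 0 < t & forall tau, tau <= t -> 2 ^+ N * tau <= 2 * beta ^+ M.
Proof.
move=> b0; have N0 : 0 < 2 ^+ N :> R by rewrite exprn_gt0.
exists (2 * beta ^+ M / 2 ^+ N); first by rewrite divr_gt0 // mulr_gt0 // exprn_gt0.
by move=> tau; rewrite ler_pdivlMr // mulrC.
Qed.

Section Doubled.
Variables (e0 : {set J}) (I : finType) (U : I -> {set J}).
Variables (h b : I -> Om -> Om -> R).
Hypothesis e0H : e0 \in H.
Hypothesis UP : forall k, U k \proper e0.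
Hypothesis hy : forall k x, dep (~: e0) (h k x).
Hypothesis hx : forall k y, dep (U k :|: ~: e0) ((h k)^~ y).
Hypothesis b_y : forall k x, dep (~: e0) (b k x).
Hypothesis b_x : forall k y, dep (U k :|: ~: e0) ((b k)^~ y).
Hypothesis hb : forall k x y, 0 <= h k x y <= b k x y.
Hypothesis b_form : forall A (S : pred {set J}), A \subset e0 ->
  exists2 n, (forall B, ~~ n e0 B) & forall x y,
    \prod_(k | S (U k)) \prod_(B : {set J} | B \subset A :&: U k) swapped B (b k) x y =
    nu_form n x y.

(** After doubling, the weights [nu e0 - 1] are multiplied by a form in the other
    weights, so the sum is alternating. *)
Lemma doubled_small (beta : R) : 0 < beta ->
  forall tau, linear_forms tau -> tau <= 1 ->
  2 ^+ (2 ^ r) * tau <= 2 * beta ^+ (2 ^ r) ->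
  `|\E_ x (\E_ y ((nu e0 x - 1) * \prod_k h k x y))| <= 2 * beta.
Proof.
move=> b0 tau lf tau1 tau_small.
pose D (x y : Om) := nu e0 x - 1.
have Dy x : dep (~: e0) (D x) by [].
rewrite -(doubled0 U D h b).
apply: (doubled_bound o Dy hy hx b_y b_x hb (ltW b0)) => [A j Ae je jA|].
  have [n _ nE] := b_form (fun u : {set J} => j \notin u) Ae.
  rewrite /side_mass (eq_avg (g := fun x => \E_ y nu_form n x y)); last first.
    by move=> x; apply: eq_avg => y; rewrite nE.
  by have := lf n; rewrite ler_norml => /andP[_]; lra.
rewrite (doubled_full D h b UP).
have [n nn nE] := b_form predT (fintype.subxx e0).
pose s := enum (powerset e0).
have sizes : size s = (2 ^ r)%N by rewrite -cardE card_powerset (uH e0H).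
rewrite (uH e0H); apply: le_trans tau_small; rewrite -sizes.
rewrite (eq_avg (g := fun x => \E_ y ((\prod_(B <- s) (nu e0 (mix B y x) - 1)) * nu_form n x y))).
  apply: alternating_small => //.
  - exact: enum_uniq.
  - by rewrite -size_eq0 sizes expn_eq0.
  - by move=> B; rewrite mem_enum inE.
move=> x; apply: eq_avg => y; congr (_ * _).
  by rewrite /s big_enum_cond /=; apply: eq_big => B; rewrite ?inE ?andbT.
rewrite -nE; apply: eq_bigr => k _; apply: eq_bigl => B.
by rewrite (finset.setIidPr (proper_sub (UP k))).
Qed.

End Doubled.

(** The sides of a box are bounded by [1] and each of them misses a coordinate of
    [e0], so after doubling only the weights [nu e0 - 1] remain. *)
Lemma cut_nu (beta : R) tau e0 : 0 < beta -> linear_forms tau -> tau <= 1 ->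
  2 ^+ (2 ^ r) * tau <= 2 * beta ^+ (2 ^ r) -> e0 \in H ->
  cut_le e0 (fun x => nu e0 x - 1) (2 * beta).
Proof.
move=> b0 lf tau1 tau_small e0H B dB.
pose U g := if g \in boundary e0 then g else finset.set0.
have e0n : finset.set0 \proper e0.
  by rewrite finset.proper0 -card_gt0 (uH e0H).
have UP g : U g \proper e0.
  by rewrite /U; case: ifP => //; rewrite inE => /andP[].
pose h g (x y : Om) : R := if g \in boundary e0 then (B g x)%:R else 1.
pose b (g : {set J}) (x y : Om) : R := 1.
have := @doubled_small e0 _ U h b e0H UP _ _ _ _ _ _ beta b0 tau lf tau1 tau_small.
have -> : \E_ x (\E_ y ((nu e0 x - 1) * \prod_k h k x y)) =
  \E_ x ((nu e0 x - 1) * (box e0 B x)%:R).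
  apply: eq_avg => x; rewrite /h (avg_cst o) /box -prod_bool; congr (_ * _).
  by rewrite -big_mkcond.
apply=> //.
- move=> g y x x' xx'; rewrite /h; case: (boolP (g \in boundary e0)) => // gb.
  congr ((nat_of_bool _)%:R); apply: dB => j jg; apply: xx'.
  by rewrite /U gb inE jg.
- by move=> g x y; rewrite /h /b; case: ifP => _; rewrite ?lexx ?ler01 //; case: (B g x);
    rewrite ?lexx ?ler01.
- move=> A S Ae; exists (fun _ _ => false) => // x y.
  by rewrite form_false big1 // => k _; rewrite big1.
Qed.

(** The points at which [e] is evaluated after doubling [A]: the coordinates
    outside [e0] are taken all from the first point or all from the second. *)
Definition copy_mask e0 A e C :=
  [&& C \subset e, C :&: e0 \subset A & (C :\: e0 == finset.set0) || (C :\: e0 == e :\: e0)].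

(** Since [e] is not contained in [e0], its two copies never coincide; the linear
    forms condition allows each point only once. *)
Lemma copies_prod e0 A e (F : {set J} -> R) : ~~ (e \subset e0) -> A \subset e0 ->
  \prod_(i : bool) \prod_(B : {set J} | B \subset A :&: (e :&: e0))
     F (B :|: (if i then e :\: e0 else finset.set0)) =
  \prod_(C | copy_mask e0 A e C) F C.
Proof.
move=> ee Ae; rewrite pair_big_dep /=.
rewrite (reindex_onto (fun p : bool * {set J} => p.2 :|: (if p.1 then e :\: e0 else finset.set0))
   (fun C => (C :\: e0 != finset.set0, C :&: e0))) /=; last first.
  move=> C /and3P[Ce CA CE]; rewrite (_ : (if _ then _ else _) = C :\: e0) ?finset.setID //.
  by case: eqP CE => [-> //|_] /= /eqP.
have en : e :\: e0 != finset.set0 by rewrite finset.setD_eq0.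
apply: eq_bigl => -[i B] /=; rewrite /copy_mask.
apply/idP/andP => [BA|[/and3P[h1 h2 h3] /eqP[E1 E2]]].
  have BAe := finset.subsetIP BA; have Be := finset.subsetIP BAe.2.
  have E2 : (B :|: (if i then e :\: e0 else finset.set0)) :&: e0 = B.
    rewrite finset.setIUl (finset.setIidPl Be.2).
    case: i; last by rewrite finset.set0I finset.setU0.
    by rewrite finset.setIDAC finset.setDIl finset.setDv finset.setI0 finset.setU0.
  have E1 : (B :|: (if i then e :\: e0 else finset.set0)) :\: e0 =
            if i then e :\: e0 else finset.set0.
    rewrite finset.setDUl; have /eqP -> : B :\: e0 == finset.set0 by rewrite finset.setD_eq0 Be.2.
    by rewrite finset.set0U; case: i {E2}; rewrite ?finset.set0D // finset.setDDl finset.setUid.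
  rewrite {}E1 {}E2; split.
    rewrite BAe.1 finset.subUset Be.1; case: i; rewrite ?eqxx ?orbT ?andbT ?finset.sub0set //.
    exact: finset.subsetDl.
  by case: i; rewrite ?en ?eqxx.
rewrite !finset.subsetI -E2 h2 finset.subsetIr andbT.
exact: fintype.subset_trans (finset.subsetIl _ _) h1.
Qed.

Lemma not_sub e0 e : e0 \in H -> e \in H :\ e0 -> e \in H /\ ~~ (e \subset e0).
Proof.
move=> e0H; rewrite !inE => /andP[ee eH]; split=> //; apply: contra ee => sub.
by rewrite eqEcard sub (uH eH) (uH e0H) leqnn.
Qed.

Definition capped (b : bool) e x : R := if b then nu e x else 1.

Lemma capped_dep b e : e \in H -> dep e (capped b e).
Proof. by move=> eH x y xy; rewrite /capped (dnu eH xy). Qed.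

Definition copy e0 (i : bool) x y : Om := if i then mix e0 x y else x.

Lemma copies_form e0 A (S : pred {set J}) (m : {set J} -> bool -> bool) :
  e0 \in H -> A \subset e0 ->
  exists2 n, (forall B, ~~ n e0 B) & forall x y,
    \prod_(e in H :\ e0 | S e) \prod_(i : bool)
      \prod_(B : {set J} | B \subset A :&: (e :&: e0))
        capped (m e i) e (copy e0 i (mix B y x) (mix B x y)) = nu_form n x y.
Proof.
move=> e0H Ae.
exists (fun e C => [&& e \in H :\ e0, S e, m e (C :\: e0 != finset.set0) & copy_mask e0 A e C]).
  by move=> B; rewrite !inE eqxx.
move=> x y; rewrite [RHS]/nu_form big_mkcond [RHS]big_mkcond; apply: eq_bigr => e _.
have [eHD|neHD] := boolP (e \in H :\ e0); last first.
  by rewrite /=; case: ifP => // eH; rewrite big1.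
have [eH ee] := not_sub e0H eHD; rewrite eH /=.
case: (boolP (S e)) => Se; last by rewrite big1 // => C _; rewrite andbF.
rewrite (eq_bigr (fun i : bool => \prod_(B : {set J} | B \subset A :&: (e :&: e0))
   capped (m e ((B :|: (if i then e :\: e0 else finset.set0)) :\: e0 != finset.set0)) e
     (mix (B :|: (if i then e :\: e0 else finset.set0)) y x))); last first.
  move=> i _; apply: eq_bigr => B.
  rewrite !finset.subsetI => /and3P[_ _ Be].
  have -> : (B :|: (if i then e :\: e0 else finset.set0)) :\: e0 != finset.set0 = i.
    rewrite finset.setD_eq0 finset.subUset Be /=; case: i; last by rewrite finset.sub0set.
    apply/negP => sub; case/negP: ee; rewrite -finset.setD_eq0 -finset.subset0.
    have : e :\: e0 \subset e0 :&: (e :\: e0) by rewrite finset.subsetI sub fintype.subxx.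
    by rewrite finset.setIDA [e0 :&: e]finset.setIC -finset.setIDA finset.setDv finset.setI0.
  apply: capped_dep => // j je.
  rewrite /copy; case: i; rewrite !mixE !inE; last by rewrite orbF.
  case: (boolP (j \in e0)) => j0; first by rewrite je /= orbF.
  rewrite je orbT; case: ifP => // /(fintype.subsetP Be) j0'.
  by rewrite j0' in j0.
rewrite (copies_prod (fun C => capped (m e (C :\: e0 != finset.set0)) e (mix C y x)) ee Ae) /=.
rewrite big_mkcond [RHS]big_mkcond; apply: eq_bigr => C _.
rewrite /capped /copy_mask; case: (C \subset e) => //=; case: (m e _) => /=.
  by case: (_ && _); rewrite ?expr1 ?expr0.
by rewrite expr0; case: (_ && _).
Qed.

(** No other face contains [e0], so each factor misses a coordinate of [e0] and
    disappears when that coordinate is doubled. Two copies of the coordinates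
    outside [e0] are allowed because squares of averages over these coordinates
    have to be treated. *)
Lemma nu_orthogonal (beta : R) tau e0 (m : {set J} -> bool -> bool)
    (h : {set J} -> bool -> Om -> R) :
  0 < beta -> linear_forms tau -> tau <= 1 ->
  2 ^+ (2 ^ r) * tau <= 2 * beta ^+ (2 ^ r) -> e0 \in H ->
  (forall e i, e \in H -> dep e (h e i)) ->
  (forall e i x, e \in H -> 0 <= h e i x <= capped (m e i) e x) ->
  `|\E_ x (\E_ y ((nu e0 x - 1) *
      \prod_(e in H :\ e0) (h e false x * h e true (mix e0 x y))))| <= 2 * beta.
Proof.
move=> b0 lf tau1 tau_small e0H dh hb.
pose I : finType := ({set J} * bool)%type.
pose U (k : I) := if k.1 \in H :\ e0 then k.1 :&: e0 else finset.set0.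
pose h' (k : I) x y := if k.1 \in H :\ e0 then h k.1 k.2 (copy e0 k.2 x y) else 1.
pose b (k : I) x y := if k.1 \in H :\ e0 then
  capped (m k.1 k.2) k.1 (copy e0 k.2 x y) else 1.
have e0n : finset.set0 \proper e0.
  by rewrite finset.proper0 -card_gt0 (uH e0H).
have UP k : U k \proper e0.
  rewrite /U; case: ifP => // /(not_sub e0H)[eH ee].
  rewrite finset.properEneq finset.subsetIr andbT.
  apply: contraNneq (ee) => E.
  suff -> : k.1 = e0 by [].
  by apply/eqP; rewrite eq_sym eqEcard (uH eH) (uH e0H) leqnn andbT -{1}E finset.subsetIl.
have pt_y (F : Om -> R) e i x : dep e F -> dep (~: e0) (fun y => F (copy e0 i x y)).
  move=> dF y y' yy'; apply: dF => j je; rewrite /copy; case: i => //.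
  by rewrite !mixE; case: ifP => // j0; apply: yy'; rewrite inE j0.
have pt_x (F : Om -> R) e i y : dep e F -> dep (e :&: e0 :|: ~: e0) (fun x => F (copy e0 i x y)).
  move=> dF x x' xx'; apply: dF => j je; rewrite /copy; case: i.
    by rewrite !mixE; case: ifP => // j0; apply: xx'; rewrite !inE je j0.
  by apply: xx'; rewrite !inE je; case: (j \in e0).
have := @doubled_small e0 I U h' b e0H UP _ _ _ _ _ _ beta b0 tau lf tau1 tau_small.
have -> : \E_ x (\E_ y ((nu e0 x - 1) * \prod_k h' k x y)) =
  \E_ x (\E_ y ((nu e0 x - 1) *
      \prod_(e in H :\ e0) (h e false x * h e true (mix e0 x y)))).
  apply: eq_avg => x; apply: eq_avg => y; congr (_ * _).
  rewrite -(pair_bigA _ (fun e i => h' (e, i) x y)) /= [RHS]big_mkcond.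
  apply: eq_bigr => e _; rewrite big_bool /h' /copy /=; case: ifP => _; last by rewrite mulr1.
  exact: mulrC.
apply.
- by move=> k x; rewrite /h'; case: (boolP (k.1 \in H :\ e0)) => [/(not_sub e0H)[eH _]|_] //;
    exact: (pt_y _ k.1 k.2 x (dh k.1 k.2 eH)).
- move=> k y; rewrite /h' /U; case: (boolP (k.1 \in H :\ e0)) => [/(not_sub e0H)[eH _]|_] //.
  exact: (pt_x _ k.1 k.2 y (dh k.1 k.2 eH)).
- by move=> k x; rewrite /b; case: (boolP (k.1 \in H :\ e0)) => [/(not_sub e0H)[eH _]|_] //;
    exact: (pt_y _ k.1 k.2 x (capped_dep _ eH)).
- move=> k y; rewrite /b /U; case: (boolP (k.1 \in H :\ e0)) => [/(not_sub e0H)[eH _]|_] //.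
  exact: (pt_x _ k.1 k.2 y (capped_dep _ eH)).
- move=> k x y; rewrite /h' /b; case: ifP => [/(not_sub e0H)[eH _]|_]; last by rewrite ler01 lexx.
  exact: hb.
move=> A S Ae.
have [n nn nE] := copies_form (fun e => S (e :&: e0)) m e0H Ae; exists n => // x y.
rewrite -nE [LHS]big_mkcond -(pair_bigA _ (fun e i => if S (U (e, i)) then
  \prod_(B : {set J} | B \subset A :&: U (e, i)) swapped B (b (e, i)) x y else 1)) /=.
rewrite [RHS]big_mkcond; apply: eq_bigr => e _; rewrite /U /=.
case: (boolP (e \in H :\ e0)) => eHD /=.
  case: ifP => Se; last by rewrite big1.
  by apply: eq_bigr => i _; apply: eq_bigr => B _; rewrite /swapped /b /= eHD.
rewrite big1 // => i _; case: ifP => // _; rewrite big1 // => B _.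
by rewrite /swapped /b /= (negbTE eHD).
Qed.

(** The first two moments of this average are averages of forms. *)
Lemma link_variance tau e0 (Dd : {set {set J}}) : linear_forms tau -> e0 \in H ->
  \E_ x ((cavg e0 (fun x => \prod_(e in H :\ e0) capped (e \in Dd) e x) x - 1) ^+ 2)
    <= 3 * tau.
Proof.
move=> lf e0H; pose G x := \prod_(e in H :\ e0) capped (e \in Dd) e x.
have sub0 (F : {set J} -> R) A : \prod_(B : {set J} | B \subset finset.set0 :&: A) F B =
    F finset.set0.
  by rewrite finset.set0I (big_pred1 finset.set0) // => B; rewrite /= finset.subset0.
have mix0 x y : mix finset.set0 y x = x :> Om.
  by apply: pointP => j; rewrite mixE inE.
have [n _ nE] := copies_form predT (fun e _ => e \in Dd) e0H (finset.sub0set _).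
have [n' _ nE'] := copies_form predT (fun e i => ~~ i && (e \in Dd)) e0H (finset.sub0set _).
have E2 : \E_ x (cavg e0 G x ^+ 2) = \E_ x (\E_ y nu_form n x y).
  under eq_avg do rewrite expr2 -[_ * _]mul1r.
  rewrite (avg_cavg_sqr G G o (dep_cst (A := e0) (1 : R))).
  apply: eq_avg => x; apply: eq_avg => y; rewrite -nE mul1r /G -big_split /=.
  apply: eq_big => [e|e _]; first by rewrite andbT.
  by rewrite big_bool !sub0 /copy !mix0 mulrC.
have E1 : avg (cavg e0 G) = \E_ x (\E_ y nu_form n' x y).
  rewrite (avg_cavg _ _ o); apply: eq_avg => x; rewrite -[LHS](avg_cst o).
  apply: eq_avg => y; rewrite -nE' /G.
  apply: eq_big => [e|e _]; first by rewrite andbT.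
  by rewrite big_bool !sub0 /copy !mix0 /= /capped mul1r.
have -> : \E_ x ((cavg e0 G x - 1) ^+ 2) =
    \E_ x (cavg e0 G x ^+ 2 - 2 * cavg e0 G x + 1).
  by apply: eq_avg => x; ring.
rewrite avgD avgB avgZ (avg_cst o) E2 E1.
move: (lf n) (lf n'); rewrite !ler_norml => /andP[_ ?] /andP[? _]; lra.
Qed.

Lemma avg_nu tau e0 : linear_forms tau -> e0 \in H -> avg (nu e0) <= 1 + tau.
Proof.
move=> lf e0H; have := lf (fun e C => false || (e == e0) && (C == finset.set0)).
have -> : \E_ x (\E_ y nu_form (fun e C => false || (e == e0) && (C == finset.set0)) x y) =
    avg (nu e0).
  apply: eq_avg => x; rewrite -[RHS](avg_cst o); apply: eq_avg => y.
  rewrite -(form_add x y e0H (finset.sub0set e0)) // form_false mulr1.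
  by congr nu; apply: pointP => j; rewrite mixE inE.
by rewrite ler_norml => /andP[_]; lra.
Qed.

End LinearForms.

(** * Bounded models *)

Section Clip.
Variable R : realFieldType.
Implicit Types (u d : R).

Definition clip u : R := if u <= 0 then 0 else if u <= 1 then u else 1.

(** The convex function with derivative [clip] vanishing at the origin. *)
Definition hub u : R := clip u * u - clip u ^+ 2 / 2.

Lemma hub0 : hub 0 = 0.
Proof. by rewrite /hub mulr0 /clip lexx expr0n mul0r subr0. Qed.

Lemma clip_unit u : 0 <= clip u <= 1.
Proof. by rewrite /clip; case: (lerP u 0) => ?; case: (lerP u 1) => ?; lra. Qed.

(** The second derivative of [hub] is at most [1]. *)
Lemma hub_step u d : hub (u + d) <= hub u + clip u * d + d ^+ 2 / 2.
Proof.
rewrite /hub /clip.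
case: (lerP u 0) => ?; case: (lerP u 1) => ?; case: (lerP (u + d) 0) => ?;
  case: (lerP (u + d) 1) => ?; nra.
Qed.

Lemma pos_le_hub u : Num.max 0 u <= hub u + 1 / 2.
Proof.
rewrite /hub /clip.
by case: (lerP u 0) => ?; case: (lerP u 1) => ?; nra.
Qed.

End Clip.

Section DenseModel.
Variables (R : realType) (J : finType).
Implicit Types (e f : {set J}).

Section Construction.
Variables (V : J -> finType) (o : config V) (e : {set J}).
Local Notation Om := (config V).
Variables (nu g : Om -> R) (D : R) (N : nat).
Hypothesis D0 : 0 < D.
Hypothesis g0 : forall x, 0 <= g x <= nu x.

Definition signed_boxes := seq (bool * ({set J} -> Om -> bool)).
Implicit Types L : signed_boxes.

Definition box_sum L x : R := \sum_(p <- L) (-1) ^+ p.1 * (box e p.2 x)%:R.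

Definition dep_boxes L := forall p, List.In p L -> forall f, dep f (p.2 f).

Lemma box_dep (B : {set J} -> Om -> bool) : (forall f, dep f (B f)) -> dep e (box e B).
Proof.
move=> dB x y xy; apply: eq_forallb_in => f fe; apply: dB => j jf.
by apply: xy; apply: (fintype.subsetP (boundary_sub fe)).
Qed.

Lemma box_sum_dep L : dep_boxes L -> dep e (box_sum L).
Proof.
elim: L => [|p L IH] dL x y xy; rewrite /box_sum ?big_nil // !big_cons.
rewrite (box_dep (dL p (or_introl erefl)) xy); congr (_ + _).
by apply: IH => // q qL; apply: dL; right.
Qed.

(** Splitting according to the membership in one box at a time replaces the
    function of the boxes by a combination of boxes. *)
Lemma function_of_boxes t M L (th : R -> R) B0 :
  cut_le e (fun x => nu x - 1) t -> 0 <= t -> 0 <= M ->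
  (forall s, `|th s| <= M) -> dep_boxes L -> (forall f, dep f (B0 f)) ->
  `|\E_ x ((nu x - 1) * (box e B0 x)%:R * th (box_sum L x))| <= M * 3 ^+ size L * t.
Proof.
move=> cut t0 M0; elim: L th B0 => [|p L IH] th B0 thM dL dB0.
  rewrite (eq_avg (g := fun x => (nu x - 1) * (box e B0 x)%:R * th 0)) => [|x]; last first.
    by rewrite /box_sum big_nil.
  rewrite avgZr normrM mulr1 mulrC; apply: ler_pM => //; exact: cut.
have dp := dL p (or_introl erefl).
have dL' : dep_boxes L by move=> q qL; apply: dL; right.
pose B1 f x := B0 f x && p.2 f x.
have dB1 f : dep f (B1 f).
  by move=> x y xy; rewrite /B1 (dB0 f x y) // (dp f x y).
have B1E x : box e B1 x = box e B0 x && box e p.2 x.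
  apply/forall_inP/andP => [H|[/forall_inP H1 /forall_inP H2] f fe]; last first.
    by rewrite /B1 H1 ?H2.
  by split; apply/forall_inP => f /H /andP[].
pose th' s := th ((-1) ^+ p.1 + s).
have -> : \E_ x ((nu x - 1) * (box e B0 x)%:R * th (box_sum (p :: L) x)) =
  \E_ x ((nu x - 1) * (box e B1 x)%:R * th' (box_sum L x)) +
  \E_ x ((nu x - 1) * (box e B0 x)%:R * th (box_sum L x)) -
  \E_ x ((nu x - 1) * (box e B1 x)%:R * th (box_sum L x)).
  rewrite -avgD -avgB; apply: eq_avg => x; rewrite /box_sum big_cons -/(box_sum L x) B1E /th'.
  case: (box e p.2 x); rewrite ?mulr1 ?mulr0 ?andbT ?andbF ?add0r; first by rewrite addrK.
  by rewrite mulr0 !mul0r add0r subr0.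
have i1 := IH th' B1 (fun s => thM _) dL' dB1.
have i2 := IH th B0 thM dL' dB0; have i3 := IH th B1 thM dL' dB1.
have -> : M * 3 ^+ size (p :: L) * t =
  M * 3 ^+ size L * t + M * 3 ^+ size L * t + M * 3 ^+ size L * t.
  by rewrite /= exprS; ring.
apply: le_trans (ler_normB _ _) _; apply: lerD => //.
by apply: le_trans (ler_normD _ _) _; apply: lerD.
Qed.

Definition model L x : R := clip (D * box_sum L x).

(** The gain of the sum of the boxes against [g], compared with the convex function
    of which [model] is the derivative. *)
Definition potential L : R :=
  \E_ x (g x * (D * box_sum L x)) - \E_ x hub (D * box_sum L x).

(** By [hub_step] the potentials agree to first order with the correlation of the
    box, a gain of [D ^+ 2]; the second order term costs half of it. *)
Lemma potential_step L (p : bool * ({set J} -> Om -> bool)) :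
  D < \E_ x ((g x - model L x) * ((-1) ^+ p.1 * (box e p.2 x)%:R)) ->
  potential L + D ^+ 2 / 2 <= potential (p :: L).
Proof.
move=> gt; pose phi x : R := (-1) ^+ p.1 * (box e p.2 x)%:R.
have phi1 x : phi x ^+ 2 <= 1.
  by rewrite /phi exprMn sqrr_sign mul1r; case: (box e p.2 x); rewrite ?expr1n ?expr0n.
have h1 : \E_ x (g x * (D * box_sum (p :: L) x)) =
    D * \E_ x (g x * phi x) + \E_ x (g x * (D * box_sum L x)).
  rewrite -avgZ -avgD; apply: eq_avg => x.
  by rewrite /box_sum big_cons -/(box_sum L x) -/(phi x); ring.
have h2 : \E_ x hub (D * box_sum (p :: L) x) <=
   \E_ x hub (D * box_sum L x) + D * \E_ x (model L x * phi x) + D ^+ 2 / 2.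
  rewrite -avgZ -avgD -[X in _ <= _ + X](avg_cst o) -avgD; apply: ler_avg => x.
  rewrite /box_sum big_cons -/(box_sum L x) -/(phi x) mulrDr addrC.
  apply: le_trans (hub_step _ _) _; rewrite -/(model L x) exprMn.
  have := phi1 x; have : 0 < D ^+ 2 by apply: exprn_gt0.
  move: (phi x ^+ 2) (D ^+ 2) => a b b0 a1; have : b * a <= b by rewrite ler_piMr // ltW.
  lra.
have h3 : D * D <= D * \E_ x (g x * phi x) - D * \E_ x (model L x * phi x).
  rewrite -mulrBr ler_pM2l // -avgB ltW //; move: gt; rewrite -/(phi _).
  by rewrite (eq_avg (g := fun x => g x * phi x - model L x * phi x)) // => x; rewrite mulrBl.
by rewrite /potential h1; move: h2 h3; rewrite expr2; lra.
Qed.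

Lemma box_sum_le L x : box_sum L x <= (size L)%:R.
Proof.
elim: L => [|p L IH]; rewrite /box_sum ?big_nil // big_cons /= -nat1r lerD //.
by case: p => -[] B /=; rewrite ?expr1 ?expr0; case: (box e B x); rewrite ?mulr1 ?mulr0 //;
  lra.
Qed.

(** On the positive part of the sum, [g] may be replaced by [nu], and [nu] by [1]
    because the sum is a function of few boxes. *)
Lemma potential_le t L : cut_le e (fun x => nu x - 1) t -> 0 <= t ->
  D * (size L)%:R * 3 ^+ size L * t <= 1 -> dep_boxes L -> potential L <= 3 / 2.
Proof.
move=> cut t0 small dL; pose M := D * (size L)%:R.
have M0 : 0 <= M by rewrite mulr_ge0 // ltW.
pose th s := Num.max 0 (Num.min M (D * s)).
have thM s : `|th s| <= M.
  by rewrite ger0_norm ?le_max ?lexx // ge_max M0 ge_min lexx.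
have := function_of_boxes (B0 := fun _ _ => true) cut t0 M0 thM dL (fun _ _ _ _ => erefl).
have boxT x : box e (fun _ _ => true) x by apply/forall_inP.
move=> /(le_trans (ler_norm _)) /le_trans /(_ small) f1.
have h1 : \E_ x (g x * (D * box_sum L x)) <=
    \E_ x ((nu x - 1) * (box e (fun _ _ => true) x)%:R * th (box_sum L x)) +
    \E_ x (hub (D * box_sum L x)) + 1 / 2.
  rewrite -avgD -[X in _ <= _ + X](avg_cst o) -avgD; apply: ler_avg => x.
  rewrite boxT mulr1.
  have -> : th (box_sum L x) = Num.max 0 (D * box_sum L x).
    rewrite /th; congr Num.max; apply/min_idPr; rewrite ler_pM2l //.
    exact: box_sum_le.
  have := pos_le_hub (D * box_sum L x); have /andP[gx0 gx1] := g0 x.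
  have m0 : 0 <= Num.max 0 (D * box_sum L x) by rewrite le_max lexx.
  have m1 : D * box_sum L x <= Num.max 0 (D * box_sum L x) by rewrite le_max lexx orbT.
  move: m0 m1; set P := Num.max _ _; set u := D * _; move: P u => P u m0 m1 le.
  have : g x * u <= g x * P by rewrite ler_wpM2l.
  have : g x * P <= nu x * P by rewrite ler_wpM2r.
  by lra.
by rewrite /potential; lra.
Qed.

Lemma dense_model_fuel t n L : cut_le e (fun x => nu x - 1) t -> 0 <= t ->
  D * N%:R * 3 ^+ N * t <= 1 -> 3 < D ^+ 2 * N%:R ->
  (size L + n)%N = N -> dep_boxes L -> D ^+ 2 / 2 * (size L)%:R <= potential L ->
  exists gt, [/\ dep e gt, unitv gt & cut_le e (fun x => g x - gt x) D].
Proof.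
move=> cut t0 small big; elim: n L => [|n IH] L.
  rewrite addn0 => sL dL pL; have := potential_le (L := L) cut t0.
  by rewrite sL => /(_ small dL); move: pL; rewrite sL; lra.
move=> sL dL pL; have [reg|nreg] := boolp.pselect (cut_le e (fun x => g x - model L x) D).
  exists (model L); split=> //; last by move=> x; apply: clip_unit.
  exact: (dep_comp (fun s => clip (D * s)) (box_sum_dep dL)).
have [B [dB gtB]] : exists B : {set J} -> Om -> bool, (forall f, dep f (B f)) /\
    D < `|\E_ x ((g x - model L x) * (box e B x)%:R)|.
  apply: boolp.contrapT => H; apply: nreg => B dB; rewrite leNgt.
  by apply/negP => gtB; apply: H; exists B.
pose sg := \E_ x ((g x - model L x) * (box e B x)%:R) < 0.
apply: (IH ((sg, B) :: L)) => [||].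
- by rewrite /= addSnnS.
- by move=> p /= [<- //|]; apply: dL.
apply: le_trans (potential_step _) => /=.
  by rewrite -[(size L).+1%:R]natr1 mulrDr mulr1; lra.
rewrite (eq_avg (g := fun x => (-1) ^+ sg * ((g x - model L x) * (box e B x)%:R))) => [|x].
  rewrite avgZ /sg; move: gtB; move: (avg _) => X.
  case: (ltrP X 0) => X0; rewrite ?expr1 ?expr0 ?mulN1r ?mul1r.
    by rewrite ltr0_norm.
  by rewrite ger0_norm.
exact: mulrCA.
Qed.

End Construction.

(** While the current model fails on some box, that box with a sign is added to
    the sum. Each addition raises the potential by [D ^+ 2 / 2], but the
    potential stays below [3 / 2]. *)
Lemma dense_model (D : R) : 0 < D -> exists2 t, 0 < t &
  forall (V : J -> finType) (o : config V) e (nu g : config V -> R),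
  (forall x, 0 <= g x <= nu x) -> cut_le e (fun x => nu x - 1) t ->
  exists gt, [/\ dep e gt, unitv gt & cut_le e (fun x => g x - gt x) D].
Proof.
move=> D0; have [N HN] := archi_steps 4 (exprn_gt0 2 D0).
have big : 3 < D ^+ 2 * N%:R by move: HN; rewrite -mulr_natr; lra.
have c0 : 0 < D * N.+1%:R * 3 ^+ N.
  by rewrite !mulr_gt0 // exprn_gt0.
exists (D * N.+1%:R * 3 ^+ N)^-1; first by rewrite invr_gt0.
move=> V o e nu g g0 cut.
apply: (dense_model_fuel o D0 g0 (N := N) (n := N) (L := [::]) cut) => //.
- by rewrite invr_ge0 ltW.
- rewrite ler_pdivrMr // mul1r ler_wpM2r ?exprn_ge0 // ler_pM2l // ler_nat.
  exact: leqnSn.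
rewrite /= mulr0 /potential (eq_avg (g := fun=> 0)) => [|x]; last first.
  by rewrite /box_sum big_nil !mulr0.
rewrite [X in _ - X](eq_avg (g := fun=> 0)) => [|x]; last first.
  by rewrite /box_sum big_nil mulr0 hub0.
by rewrite subrr.
Qed.

End DenseModel.

(** * Relative counting *)

Section RelativeCounting.
Variables (R : realType) (J : finType) (r : nat) (H : {set {set J}}).
Implicit Types (e f : {set J}).
Hypothesis uH : uniform_hypergraph r H.
Hypothesis r0 : (0 < r)%N.

(** Only where [N1] exceeds [1] is there an error, and there [Nu - 1] dominates
    [N1 - 1]. *)
Lemma truncation_error (N1 N2 Nu gam : R) : 0 < gam -> 0 <= N1 <= Nu -> 0 <= N2 <= 1 ->
  (N1 - N2) * (N1 - Num.min N1 1) <= (Nu - 1) ^+ 2 + (Nu - 1) ^+ 2 / gam + gam.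
Proof.
move=> gam0 /andP[a0 a1] /andP[b0 b1].
have s0 : 0 <= (Nu - 1) ^+ 2 by apply: sqr_ge0.
have s1 : 0 <= (Nu - 1) ^+ 2 / gam by apply: divr_ge0 => //; exact: ltW.
have [le1|gt1] := lerP N1 1; first by rewrite subrr mulr0; lra.
have h1 : (N1 - N2) * (N1 - 1) <= (1 + (Nu - 1)) * (Nu - 1) by apply: ler_pM; lra.
have h2 : Nu - 1 <= (Nu - 1) ^+ 2 / gam + gam.
  have [small|big] := lerP (Nu - 1) gam; first by lra.
  suff : Nu - 1 <= (Nu - 1) ^+ 2 / gam by lra.
  rewrite ler_pdivlMr // expr2 ler_wpM2l ?(ltW big) //; lra.
move: h1; rewrite [leRHS]mulrDl mul1r -expr2; lra.
Qed.

Section Step.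
Variables (V : J -> finType) (o : config V).
Local Notation Om := (config V).
Implicit Types (x y : Om).
Variables (nu g gt : {set J} -> Om -> R) (tau : R) (Dd : {set {set J}}) (e0 : {set J}).
Hypothesis dnu : forall e, e \in H -> dep e (nu e).
Hypothesis nu0 : forall e x, e \in H -> 0 <= nu e x.
Hypothesis lf : linear_forms H nu tau.
Hypothesis dg : forall e, e \in H -> dep e (g e).
Hypothesis dgt : forall e, e \in H -> dep e (gt e).
Hypothesis gP : forall e x, e \in H -> 0 <= g e x <= capped nu (e \in Dd) e x.
Hypothesis ugt : forall e, e \in H -> unitv (gt e).
Hypothesis e0H : e0 \in H.
Hypothesis e0D : e0 \in Dd.

(** [N1] and [N2] are the weights that the other faces induce on [e0]; [w] is the
    bounded truncation of the first. *)
Let G x := \prod_(e in H :\ e0) g e x.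
Let Gt x := \prod_(e in H :\ e0) gt e x.
Let K x := G x - Gt x.
Let N1 := cavg e0 G.
Let N2 := cavg e0 Gt.
Let w x := Num.min (N1 x) 1.

Lemma in_rest e : e \in H :\ e0 -> e \in H.
Proof. by rewrite inE => /andP[]. Qed.

(** The four terms of the square are instances of [nu_orthogonal]. *)
Lemma orthogonal_square (beta : R) : 0 < beta -> tau <= 1 ->
  2 ^+ (2 ^ r) * tau <= 2 * beta ^+ (2 ^ r) ->
  \E_ x (\E_ y ((nu e0 x - 1) * (K x * K (mix e0 x y)))) <= 8 * beta.
Proof.
move=> b0 t1 tb.
have pair (a b : {set J} -> Om -> R) (ma mb : {set J} -> bool) :
    (forall e, e \in H -> dep e (a e)) -> (forall e, e \in H -> dep e (b e)) ->
    (forall e x, e \in H -> 0 <= a e x <= capped nu (ma e) e x) ->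
    (forall e x, e \in H -> 0 <= b e x <= capped nu (mb e) e x) ->
    `|\E_ x (\E_ y ((nu e0 x - 1) * ((\prod_(e in H :\ e0) a e x) *
       \prod_(e in H :\ e0) b e (mix e0 x y))))| <= 2 * beta.
  move=> da db ha hb.
  have := @nu_orthogonal R J V o r H nu uH r0 dnu beta tau e0
    (fun e i => if i then mb e else ma e) (fun e i => if i then b e else a e) b0 lf t1 tb e0H.
  rewrite (eq_avg (g := fun x => \E_ y ((nu e0 x - 1) * ((\prod_(e in H :\ e0) a e x) *
       \prod_(e in H :\ e0) b e (mix e0 x y))))); last first.
    by move=> x; apply: eq_avg => y; rewrite big_split.
  by apply=> [e [] eH|e [] x eH]; [apply: db | apply: da | apply: hb | apply: ha].
have gtP e x : e \in H -> 0 <= gt e x <= capped nu false e x by move=> /ugt /(_ x).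
have t11 := pair g g _ _ dg dg gP gP.
have t12 := pair g gt _ _ dg dgt gP gtP.
have t21 := pair gt g _ _ dgt dg gtP gP.
have t22 := pair gt gt _ _ dgt dgt gtP gtP.
have E : \E_ x (\E_ y ((nu e0 x - 1) * (K x * K (mix e0 x y)))) =
  \E_ x (\E_ y ((nu e0 x - 1) * (G x * G (mix e0 x y)))) -
  \E_ x (\E_ y ((nu e0 x - 1) * (G x * Gt (mix e0 x y)))) -
  \E_ x (\E_ y ((nu e0 x - 1) * (Gt x * G (mix e0 x y)))) +
  \E_ x (\E_ y ((nu e0 x - 1) * (Gt x * Gt (mix e0 x y)))).
  rewrite -!avgB -avgD; apply: eq_avg => x; rewrite -!avgB -avgD; apply: eq_avg => y.
  by rewrite /K; ring.
rewrite E; move: t11 t12 t21 t22; rewrite -!/(G _) -!/(Gt _).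
move: (\E_ x (\E_ y ((nu e0 x - 1) * (G x * G (mix e0 x y)))))
  (\E_ x (\E_ y ((nu e0 x - 1) * (G x * Gt (mix e0 x y)))))
  (\E_ x (\E_ y ((nu e0 x - 1) * (Gt x * G (mix e0 x y)))))
  (\E_ x (\E_ y ((nu e0 x - 1) * (Gt x * Gt (mix e0 x y))))) => T1 T2 T3 T4.
rewrite !ler_norml => /andP[_ h1] /andP[h2 _] /andP[h3 _] /andP[_ h4].
lra.
Qed.

Lemma N1_bounds x :
  0 <= N1 x <= cavg e0 (fun x => \prod_(e in H :\ e0) capped nu (e \in Dd) e x) x.
Proof.
apply/andP; split.
  by apply: cavg_ge0 => y; apply: prodr_ge0 => e /in_rest /(gP y) /andP[].
by apply: ler_cavg => y; apply: ler_prod => e /in_rest; apply: gP.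
Qed.

Lemma cavg_unitv (F : Om -> R) : unitv F -> unitv (cavg e0 F).
Proof.
move=> uF x; apply/andP; split; first by apply: cavg_ge0 => y; have /andP[] := uF y.
by rewrite -[leRHS](avg_cst o); apply: ler_avg => y; have /andP[] := uF (mix e0 x y).
Qed.

Lemma N2_unit : unitv N2.
Proof. by apply: cavg_unitv; apply: unitv_prod => e /in_rest; apply: ugt. Qed.

Lemma w_unit : unitv w.
Proof.
move=> x; have /andP[h _] := N1_bounds x.
by rewrite /w le_min h ler01 ge_min lexx orbT.
Qed.

Lemma w_dep : dep e0 w.
Proof. exact: (dep_comp (fun s => Num.min s 1) (cavg_dep (A := e0) G)). Qed.

Lemma cavgK x : cavg e0 K x = N1 x - N2 x.
Proof. exact: avgB. Qed.

(** The square [(N1 - N2) ^+ 2] is expanded with one factor [N1] truncated to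
    [w]. The two remaining terms carry a bounded weight on [e0]. *)
Lemma square_bound (gam rho : R) : 0 < gam ->
  `|\E_ x (w x * K x)| <= rho -> `|\E_ x (N2 x * K x)| <= rho ->
  \E_ x (cavg e0 K x ^+ 2) <= 3 * tau + 3 * tau / gam + gam + 2 * rho.
Proof.
move=> gam0 hw h2.
pose Nu := cavg e0 (fun x => \prod_(e in H :\ e0) capped nu (e \in Dd) e x).
have var := @link_variance R J V o r H nu uH dnu tau e0 Dd lf e0H.
have -> : \E_ x (cavg e0 K x ^+ 2) =
   \E_ x ((N1 x - N2 x) * (N1 x - w x)) + \E_ x (w x * cavg e0 K x) -
   \E_ x (N2 x * cavg e0 K x).
  by rewrite -avgD -avgB; apply: eq_avg => x; rewrite cavgK; ring.
rewrite (avg_cavgM _ o w_dep) (avg_cavgM _ o (cavg_dep (A := e0) Gt)).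
have h1 : \E_ x ((N1 x - N2 x) * (N1 x - w x)) <= 3 * tau + 3 * tau / gam + gam.
  apply: (@le_trans _ _ (\E_ x ((Nu x - 1) ^+ 2 + (Nu x - 1) ^+ 2 / gam + gam))).
    apply: ler_avg => x; apply: truncation_error => //; first exact: N1_bounds.
    exact: N2_unit.
  rewrite avgD avgD (avg_cst o) avgZr lerD2r; apply: lerD => //.
  by rewrite ler_pM2r // invr_gt0.
move: hw h2; rewrite !ler_norml => /andP[_ ?] /andP[? _]; lra.
Qed.

(** Cauchy--Schwarz trades [g e0] for [nu e0], which is then replaced by [1]. *)
Lemma unbounded_factor (beta gam rho : R) : 0 < beta -> 0 < gam -> tau <= 1 ->
  2 ^+ (2 ^ r) * tau <= 2 * beta ^+ (2 ^ r) ->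
  `|\E_ x (w x * K x)| <= rho -> `|\E_ x (N2 x * K x)| <= rho ->
  (\E_ x (g e0 x * K x)) ^+ 2 <=
  2 * (8 * beta + (3 * tau + 3 * tau / gam + gam + 2 * rho)).
Proof.
move=> b0 gam0 t1 tb hw h2; rewrite -(avg_cavgM _ o (dg e0H)).
have gnu x : `|g e0 x| <= nu e0 x.
  have := gP x e0H; rewrite e0D => /andP[? ?]; rewrite ger0_norm //.
apply: le_trans (avg_cauchy_le _ gnu) _.
have sq0 : 0 <= \E_ x (nu e0 x * cavg e0 K x ^+ 2).
  by apply: avg_ge0 => x; rewrite mulr_ge0 ?sqr_ge0 ?nu0.
have mass : avg (nu e0) <= 2.
  by apply: le_trans (avg_nu o lf e0H) _; lra.
apply: (@le_trans _ _ (2 * \E_ x (nu e0 x * cavg e0 K x ^+ 2))).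
  by rewrite ler_wpM2r.
rewrite ler_pM2l //.
have -> : \E_ x (nu e0 x * cavg e0 K x ^+ 2) =
  \E_ x ((nu e0 x - 1) * (cavg e0 K x * cavg e0 K x)) + \E_ x (cavg e0 K x ^+ 2).
  by rewrite -avgD; apply: eq_avg => x; ring.
apply: lerD; last exact: square_bound.
have dn : dep e0 (fun x => nu e0 x - 1) by exact: (dep_comp (fun s => s - 1) (dnu e0H)).
rewrite (avg_cavg_sqr _ _ o dn).
have := orthogonal_square b0 t1 tb.
rewrite (eq_avg (g := fun x => \E_ y ((nu e0 x - 1) * K x * K (mix e0 x y)))) // => x.
by apply: eq_avg => y; rewrite mulrA.
Qed.

End Step.

(** Induction on the number of faces whose weight is unbounded. For such a face
    [e0] the difference of the products splits into a term with the factor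
    [g e0 - gt e0], which a cut norm bounds, and [g e0] times the difference of
    the products over the other faces. By [unbounded_factor] the latter reduces
    to averages with a bounded function in place of [g e0], where the induction
    hypothesis applies. *)
Lemma relative_counting n (rho : R) : 0 < rho -> exists D t : R,
  [/\ 0 < D, 0 < t &
  forall (V : J -> finType) (o : config V) (nu : {set J} -> config V -> R) tau
    (Dd : {set {set J}}) (g gt : {set J} -> config V -> R),
  (forall e, e \in H -> dep e (nu e)) -> (forall e x, e \in H -> 0 <= nu e x) ->
  linear_forms H nu tau -> tau <= t -> Dd \subset H -> (#|Dd| <= n)%N ->
  (forall e, e \in H -> dep e (g e)) -> (forall e, e \in H -> dep e (gt e)) ->
  (forall e x, e \in H -> 0 <= g e x <= capped nu (e \in Dd) e x) ->
  (forall e, e \in H -> unitv (gt e)) ->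
  (forall e, e \in H -> cut_le e (fun x => g e x - gt e x) D) ->
  (forall e, e \in H -> e \notin Dd -> g e =1 gt e) ->
  `|\E_ x (\prod_(e in H) g e x) - \E_ x (\prod_(e in H) gt e x)| <= rho].
Proof.
elim: n rho => [|n IH] rho rho0.
  exists 1, 1; split=> // V o nu tau Dd g gt _ _ _ _ _ D0 _ _ _ _ _ same.
  have D0' : Dd = finset.set0 by apply/eqP; rewrite -cards_eq0 -leqn0.
  rewrite [X in X - _](eq_avg (g := fun x => \prod_(e in H) gt e x)) => [|x].
    by rewrite subrr normr0 ltW.
  by apply: eq_bigr => e eH; rewrite same // D0' inE.
(* Half of [rho] goes to each of the two terms; the parameters below make the
   bracket in [unbounded_factor] at most [q], and [2 * q] is the square of
   [rho / 2]. *)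
pose q := (rho / 2) ^+ 2 / 2.
have q0 : 0 < q by rewrite divr_gt0 // exprn_gt0 // divr_gt0.
have rho1 : 0 < Num.min rho (q / 16) by rewrite lt_min rho0 divr_gt0.
have beta0 : 0 < q / 64 by rewrite divr_gt0.
have gam0 : 0 < q / 8 by rewrite divr_gt0.
have [D1 [t1 [D10 t10 IH1]]] := IH _ rho1.
have [t2 t20 Ht2] := exp_small (2 ^ r) (2 ^ r) beta0.
pose c := 1 + (q / 8)^-1.
have c0 : 0 < c by rewrite addr_gt0 // invr_gt0.
pose t := Num.min (Num.min t1 t2) (Num.min 1 (q / 8 / (3 * c))).
exists (Num.min D1 (rho / 2)), t; split.
- by rewrite lt_min D10 divr_gt0.
- by rewrite !lt_min t10 t20 ltr01 divr_gt0 // mulr_gt0.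
move=> V o nu tau Dd g gt dnu nu0 lf taut DH cD dg dgt gP ugt cut same.
move: taut; rewrite !le_min -andbA => /and4P[tau1 tau2 tau3 tau4].
have cutD e : e \in H -> cut_le e (fun x => g e x - gt e x) D1 /\
    cut_le e (fun x => g e x - gt e x) (rho / 2).
  by move=> eH; split=> B dB; apply: le_trans (cut e eH B dB) _; rewrite ge_min lexx ?orbT.
have [D0|[e0 e0D]] := set_0Vmem Dd.
  apply: le_trans (IH1 V o nu tau Dd g gt dnu nu0 lf tau1 DH _ dg dgt gP ugt _ same) _.
  - by rewrite D0 cards0.
  - by move=> e eH; case: (cutD e eH).
  - by rewrite ge_min lexx.
have e0H := fintype.subsetP DH e0 e0D.
pose G (u : {set J} -> config V -> R) x := \prod_(e in H :\ e0) u e x.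
pose K x := G g x - G gt x.
have HE (v : config V -> R) u x : v x * G u x =
    \prod_(e in H) (if e == e0 then v x else u e x).
  rewrite (big_setD1 e0) //= eqxx; congr (_ * _); apply: eq_bigr => e.
  by rewrite !inE => /andP[/negbTE ->].
have bounded v : dep e0 v -> unitv v -> `|\E_ x (v x * K x)| <= q / 16.
  move=> dv uv.
  pose g' e := if e == e0 then v else g e; pose gt' e := if e == e0 then v else gt e.
  have Eg : \E_ x (\prod_(e in H) g' e x) = \E_ x (v x * G g x).
    apply: eq_avg => x; rewrite HE; apply: eq_bigr => e _.
    by rewrite /g'; case: eqP.
  have Egt : \E_ x (\prod_(e in H) gt' e x) = \E_ x (v x * G gt x).
    apply: eq_avg => x; rewrite HE; apply: eq_bigr => e _.
    by rewrite /gt'; case: eqP.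
  have -> : \E_ x (v x * K x) = \E_ x (v x * G g x) - \E_ x (v x * G gt x).
    by rewrite -avgB; apply: eq_avg => x; rewrite /K mulrBr.
  rewrite -Eg -Egt; apply: le_trans (_ : Num.min rho (q / 16) <= _); last first.
    by rewrite ge_min lexx orbT.
  apply: (IH1 V o nu tau (Dd :\ e0)) => //.
  - exact: fintype.subset_trans (subD1set _ _) DH.
  - by move: cD; rewrite (cardsD1 e0) e0D.
  - by move=> e eH; rewrite /g'; case: eqP => [->|_]; [exact: dv | exact: dg].
  - by move=> e eH; rewrite /gt'; case: eqP => [->|_]; [exact: dv | exact: dgt].
  - move=> e x eH; rewrite /g' !inE; case: eqP => [_|_] /=; first exact: uv.
    exact: gP.
  - by move=> e eH; rewrite /gt'; case: eqP => [_|_]; [exact: uv | exact: ugt].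
  - move=> e eH; rewrite /g' /gt'; case: eqP => [_|_]; last by case: (cutD e eH).
    move=> B dB; rewrite (eq_avg (g := fun=> 0)) => [|x]; last by rewrite subrr mul0r.
    by rewrite (avg_cst o) normr0 ltW.
  move=> e eH; rewrite !inE /g' /gt'; case: eqP => //= _; exact: same.
have dw : dep e0 (fun x => Num.min (cavg e0 (G g) x) 1) by exact: w_dep.
have uw : unitv (fun x => Num.min (cavg e0 (G g) x) 1) by exact: (w_unit e0 gP).
have uN : unitv (cavg e0 (G gt)) by exact: N2_unit.
have big : (\E_ x (g e0 x * K x)) ^+ 2 <= 2 * (8 * (q / 64) +
    (3 * tau + 3 * tau / (q / 8) + q / 8 + 2 * (q / 16))).
  apply: (unbounded_factor o dnu nu0 lf dg dgt gP ugt e0H e0D) => //; first exact: Ht2.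
    exact: bounded.
  exact: bounded (cavg_dep _) uN.
have small : `|\E_ x (g e0 x * K x)| <= rho / 2.
  rewrite -(ler_pXn2r (n := 2)) ?nnegrE ?normr_ge0 ?divr_ge0 ?(ltW rho0) //.
  rewrite real_normK ?num_real //; apply: le_trans big _.
  have -> : (rho / 2) ^+ 2 = 2 * q by rewrite /q mulrCA divff ?mulr1 // pnatr_eq0.
  rewrite ler_pM2l //.
  have : 3 * tau + 3 * tau / (q / 8) <= q / 8.
    have -> : 3 * tau + 3 * tau / (q / 8) = tau * (3 * c) by rewrite /c; ring.
    by move: tau4; rewrite ler_pdivlMr // mulr_gt0.
  lra.
have E : \E_ x (\prod_(e in H) g e x) - \E_ x (\prod_(e in H) gt e x) =
   \E_ x (g e0 x * K x) + \E_ x ((g e0 x - gt e0 x) * G gt x).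
  rewrite -avgB -avgD; apply: eq_avg => x.
  by rewrite !(big_setD1 e0 e0H) /= -/(G g x) -/(G gt x) /K; ring.
rewrite E; apply: le_trans (ler_normD _ _) _; rewrite [leRHS]splitr; apply: lerD => //.
have dsub : dep e0 (fun x => g e0 x - gt e0 x).
  exact: dep_comp2 (fun a b => a - b) (dg e0 e0H) (dgt e0 e0H).
apply: (cut_le_prod o dsub (cutD e0 e0H).2 (A := id)) => e.
- rewrite !inE => /andP[ne eH]; apply: contra ne => sub.
  by rewrite eq_sym eqEcard sub (uH e0H) (uH eH) leqnn.
- by move=> /in_rest; apply: dgt.
- by move=> /in_rest; apply: ugt.
Qed.

End RelativeCounting.

(** * Removal below a pseudorandom weight *)

Section RelativeRemoval.
Variables (R : realType) (J : finType) (H : {set {set J}}).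
Implicit Types (e f : {set J}).

(** The spare colour of ['I_T.+1] keeps the type inhabited when [T] is [0]; faces
    that are not proper faces of [e] get a constant colour. *)
Definition face_colours (V : J -> finType) T (gam : colouring V) e (x : config V) :
    {ffun {set J} -> 'I_T.+1} :=
  [ffun f : {set J} => if f \proper e then inord (gam f x) else ord0].

Definition num_cells T := #|{ffun {set J} -> 'I_T.+1}|.

(** The conclusion of the removal theorem for [E], which is the set of colour
    patterns kept at each edge. *)
Definition removal (V : J -> finType) T (eps : R) (g : {set J} -> config V -> R)
    (gam : colouring V) (E : {set J} -> ({set J} -> nat) -> bool) :=
  [/\ (forall e f, e \in H -> f \proper e -> dep f (gam f)),
      (forall e f x, e \in H -> f \proper e -> (gam f x < T)%N),
      (forall e a a', e \in H -> (forall f : {set J}, f \proper e -> a f = a' f) ->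
         E e a = E e a'),
      (forall x, ~ (forall e, e \in H -> E e (gam^~ x)))
    & forall e, e \in H -> \E_ x (g e x * (~~ E e (gam^~ x))%:R) <= eps].

Lemma face_coloursE (V : J -> finType) T (gam : colouring V) e f x :
  (forall g : {set J}, g \proper e -> (gam g x < T)%N) ->
  f \proper e -> face_colours T gam e x f = gam f x :> nat.
Proof. by move=> gT fe; rewrite ffunE fe inordK // ltnS ltnW // gT. Qed.

(** Such a set is a disjoint union of boundedly many products of functions of
    proper faces, to each of which the cut norm applies. *)
Lemma cut_le_cells (V : J -> finType) (o : config V) T (gam : colouring V) e
    (u : config V -> R) D (S : config V -> bool) :
  e != finset.set0 -> dep e u -> cut_le e u D ->
  (forall f, f \proper e -> dep f (gam f)) ->
  (forall x y, face_colours T gam e x = face_colours T gam e y -> S x = S y) ->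
  \E_ x (u x * (S x)%:R) <= (num_cells T)%:R * D.
Proof.
move=> e0 du cut dgam SE; have D0 : 0 <= D.
  by apply: le_trans (cut (fun _ _ => true) _) => //; apply: normr_ge0.
pose c (a : {ffun {set J} -> 'I_T.+1}) : bool :=
  [exists x, (face_colours T gam e x == a) && S x].
have E x : u x * (S x)%:R = \sum_(a : {ffun {set J} -> 'I_T.+1})
    u x * ((face_colours T gam e x == a)%:R * (c a)%:R).
  rewrite (bigD1 (face_colours T gam e x)) //= eqxx mul1r big1 => [|a ax].
    rewrite addr0; congr (_ * (nat_of_bool _)%:R).
    apply/idP/existsP => [Sx|[y /andP[/eqP xy Sy]]]; first by exists x; rewrite eqxx.
    by rewrite (SE _ _ (esym xy)).
  by rewrite eq_sym (negbTE ax) mul0r mulr0.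
rewrite (eq_avg E) avg_sum.
have -> : (num_cells T)%:R * D = \sum_(a : {ffun {set J} -> 'I_T.+1}) D.
  by rewrite sumr_const mulr_natl.
apply: ler_sum => a _.
rewrite (eq_avg (g := fun x => u x * (face_colours T gam e x == a)%:R * (c a)%:R)) => [|x].
  rewrite avgZr; case: (c a); rewrite ?mulr0 // mulr1.
  pose A (f : {set J}) := if f \proper e then f else finset.set0.
  pose w (f : {set J}) x : R := (face_colours T gam e x f == a f)%:R.
  have -> : \E_ x (u x * (face_colours T gam e x == a)%:R) =
            \E_ x (u x * \prod_(f : {set J}) w f x).
    apply: eq_avg => x; rewrite prod_bool; congr (_ * (nat_of_bool _)%:R).
    by apply/eqP/forall_inP => [-> //|fa]; apply/ffunP => f; apply/eqP/fa.
  apply: le_trans (ler_norm _) _.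
  apply: (cut_le_prod o du cut (A := A)) => f _.
  - rewrite /A; case: ifP => [|_]; first exact: proper_subn.
    by rewrite finset.subset0.
  - move=> x y xy; rewrite /w !ffunE; move: xy; rewrite /A; case: ifP => // fe xy.
    by rewrite (dgam f fe x y xy).
  - exact: unitv_bool.
by rewrite mulrA.
Qed.

(** The bounded models [gt] have almost the same count as [g] by relative counting,
    so dense removal applies to them. The sets it provides have complexity
    bounded before the models are chosen, hence the averages of [g] and of [gt]
    over them are close in terms of the cut norm. *)
Lemma relative_removal (eps : R) (r : nat) : (0 < r)%N -> uniform_hypergraph r H ->
  0 < eps -> exists T (delta t : R), [/\ 0 < delta, 0 < t &
  forall (V : J -> finType) (o : config V) (nu g : {set J} -> config V -> R) tau,
  (forall e, e \in H -> dep e (nu e)) -> (forall e, e \in H -> dep e (g e)) ->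
  linear_forms H nu tau -> tau <= t ->
  (forall e x, e \in H -> 0 <= g e x <= nu e x) ->
  \E_ x (\prod_(e in H) g e x) <= delta ->
  exists gam E, removal T eps g gam E].
Proof.
move=> r0 uH eps0; have eps20 : 0 < eps / 2 by rewrite divr_gt0.
have [T [d [d0 HT]]] := dense_removal uH eps20.
have d20 : 0 < d / 2 by rewrite divr_gt0.
have [D1 [t1 [D10 t10 Hcount]]] := relative_counting uH r0 #|H| d20.
pose M : R := (num_cells T).+1%:R.
have M0 : 0 < M by rewrite ltr0n.
pose D := Num.min D1 (eps / 2 / M).
have D0 : 0 < D by rewrite lt_min D10 divr_gt0.
have [t2 t20 Hmodel] := dense_model J D0.
have t220 : 0 < t2 / 2 by rewrite divr_gt0.
have [t3 t30 Ht3] := exp_small (2 ^ r) (2 ^ r) t220.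
exists T, (d / 2), (Num.min (Num.min t1 t3) 1); split=> //.
  by rewrite !lt_min t10 t30 ltr01.
move=> V o nu g tau dnu dg lf; rewrite !le_min -andbA => /and3P[tau1 tau3 tau4] gP small.
have nu0 e x : e \in H -> 0 <= nu e x.
  by move=> eH; have /andP[h1 h2] := gP e x eH; apply: le_trans h2.
have /boolp.choice[gt gtP] : forall e, exists gt, e \in H ->
    [/\ dep e gt, unitv gt & cut_le e (fun x => g e x - gt x) D].
  move=> e; have [eH|_] := boolP (e \in H); last by exists (fun=> 0).
  have cutnu : cut_le e (fun x => nu e x - 1) t2.
    have -> : t2 = 2 * (t2 / 2) by rewrite mulrCA divff ?mulr1 // pnatr_eq0.
    exact: (cut_nu o uH r0 t220 lf tau4 (Ht3 _ tau3) eH).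
  by have [gt ?] := Hmodel V o e (nu e) (g e) (fun x => gP e x eH) cutnu; exists gt.
have cutD e : e \in H -> cut_le e (fun x => g e x - gt e x) D1 /\
    cut_le e (fun x => g e x - gt e x) (eps / 2 / M).
  move=> eH; have [_ _ cut] := gtP e eH.
  by split=> B dB; apply: le_trans (cut B dB) _; rewrite ge_min lexx ?orbT.
have dgt e : e \in H -> dep e (gt e) by move=> /gtP[].
have ugt e : e \in H -> unitv (gt e) by move=> /gtP[].
have close : `|\E_ x (\prod_(e in H) g e x) - \E_ x (\prod_(e in H) gt e x)| <= d / 2.
  apply: (Hcount V o nu tau H) => //.
  - by move=> e x eH; rewrite /capped eH; apply: gP.
  - by move=> e /cutD[].
  - by move=> e ->.
have small' : \E_ x (\prod_(e in H) gt e x) <= d.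
  by move: close; rewrite ler_norml => /andP[? _]; lra.
have [gam [E [dgam gT El Enone Ebound]]] := HT V o gt dgt ugt small'.
have lt_r e f : e \in H -> f \proper e -> (#|f| < r)%N.
  by move=> eH fe; rewrite -(uH e eH) proper_card.
exists gam, E; split=> //.
- by move=> e f eH fe; apply: dgam; apply: lt_r fe.
- by move=> e f x eH fe; apply: gT; apply: lt_r fe.
move=> e eH.
have -> : \E_ x (g e x * (~~ E e (gam^~ x))%:R) =
   \E_ x (gt e x * (~~ E e (gam^~ x))%:R) +
   \E_ x ((g e x - gt e x) * (~~ E e (gam^~ x))%:R).
  by rewrite -avgD; apply: eq_avg => x; ring.
rewrite [leRHS]splitr; apply: lerD; first exact: Ebound.
have du : dep e (fun x => g e x - gt e x).
  exact: dep_comp2 (fun a b => a - b) (dg e eH) (dgt e eH).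
apply: le_trans (cut_le_cells o (T := T) (gam := gam) _ du (cutD e eH).2 _ _) _.
- by rewrite -card_gt0 (uH e eH).
- by move=> f fe; apply: dgam; apply: lt_r fe.
- move=> x y /ffunP xy; congr (~~ _); apply: El => // f fe.
  have gTe (z : config V) (h : {set J}) : h \proper e -> (gam h z < T)%N
    by move=> he; apply: gT; apply: lt_r he.
  have := congr1 (@nat_of_ord _) (xy f).
  by rewrite !(face_coloursE _ fe) => // h; apply: gTe.
rewrite mulrCA ler_piMr ?(ltW eps20) // ler_pdivrMr // mul1r ler_nat.
exact: leqnSn.
Qed.

End RelativeRemoval.

(** * Transport to sets of partial configurations *)

Section Bridge.
Variables (R : realType) (J : finType) (V : J -> finType) (o : config V).
Local Notation Om := (config V).
Implicit Types (e f : {set J}) (x y : Om).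

Definition restrict e x : vprod V e := [ffun j : {j : J | j \in e} => x (val j)].

Definition extend e (z : vprod V e) : Om :=
  [ffun j => match @idP (j \in e) with
             | ReflectT je => z (exist _ j je)
             | ReflectF _ => o j
             end].

Lemma extendE e (z : vprod V e) j (je : j \in e) : extend z j = z (exist _ j je).
Proof.
rewrite ffunE; case: {-}_ / idP => [je'|/(_ je) //].
by rewrite (bool_irrelevance je' je).
Qed.

Lemma extendK e : cancel (@extend e) (restrict e).
Proof. by move=> z; apply/ffunP => -[j je]; rewrite ffunE extendE. Qed.

Lemma extend_restrict e x j : j \in e -> extend (restrict e x) j = x j.
Proof. by move=> je; rewrite (extendE _ je) ffunE. Qed.

Lemma restrict_dep T e (h : vprod V e -> T) : dep e (fun x => h (restrict e x)).
Proof.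
by move=> x y xy; congr h; apply/ffunP => -[j je]; rewrite !ffunE xy.
Qed.

(** Exchanging the coordinates in [e] between a partial and a full configuration
    is an involution. *)
Lemma avg_restrict e (h : vprod V e -> R) : avg h = \E_ x h (restrict e x).
Proof.
have -> : \E_ x h (restrict e x) = avg (fun _ : vprod V e => \E_ x h (restrict e x)).
  by rewrite (avg_cst (restrict e o)).
have -> : avg h = \E_ z avg (fun _ : Om => h z).
  by apply: eq_avg => z; rewrite (avg_cst o).
rewrite -[LHS]avg_pair -[RHS]avg_pair.
pose s (p : vprod V e * Om) := (restrict e p.2, mix e (extend p.1) p.2).
have sK : involutive s.
  case=> z x; rewrite /s /=; congr pair.
    by apply/ffunP => -[j je]; rewrite ffunE /= mixE je (extendE _ je).
  apply: pointP => j; rewrite !mixE; case: (boolP (j \in e)) => // je.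
  by rewrite extend_restrict.
by rewrite -(avg_bij (fun p => h p.1) (inv_bij sK)).
Qed.

Definition to_full x : vprod V [set: J] := restrict [set: J] x.

Lemma to_full_bij : bijective to_full.
Proof.
exists (@extend [set: J]); last exact: extendK.
by move=> x; apply: pointP => j; rewrite extend_restrict ?finset.in_setT.
Qed.

Lemma proj_full e x : proj e (to_full x) = restrict e x.
Proof. by apply/ffunP => -[j je]; rewrite !ffunE. Qed.

Lemma avg_full (F : vprod V [set: J] -> R) : avg F = \E_ x F (to_full x).
Proof. by rewrite (avg_bij F to_full_bij). Qed.

(** The set form of the exponent [w] of a twisted configuration. *)
Definition second e (w : {ffun {j : J | j \in e} -> bool}) : {set J} :=
  [set j | [exists k : {j : J | j \in e}, (val k == j) && w k]].

Lemma in_second e (w : {ffun {j : J | j \in e} -> bool}) (k : {j : J | j \in e}) :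
  (val k \in second w) = w k.
Proof.
rewrite inE; apply/existsP/idP => [[k' /andP[/eqP kk' wk']]|wk]; last first.
  by exists k; rewrite eqxx.
by rewrite -(val_inj kk').
Qed.

Lemma twisted_mix e w x y :
  twisted (to_full x) (to_full y) w = restrict e (mix (second w) y x).
Proof.
apply/ffunP => k; rewrite !ffunE in_second.
by case: (w k); rewrite ?ffunE ?mixE ?in_second.
Qed.

Lemma prod_second e (F : {set J} -> R) :
  \prod_(C : {set J} | C \subset e) F C =
  \prod_(w : {ffun {j : J | j \in e} -> bool}) F (second w).
Proof.
rewrite (reindex_onto (@second e) (fun C => [ffun k => val k \in C])) /=.
  apply: eq_bigl => w; apply/andP; split.
    apply/fintype.subsetP => j; rewrite inE => /existsP[k /andP[/eqP <- _]].
    exact: (valP k).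
  by apply/eqP/ffunP => k; rewrite ffunE in_second.
move=> C Ce; apply/finset.setP => j; rewrite inE.
apply/existsP/idP => [[k /andP[/eqP <-]]|jC]; first by rewrite ffunE.
by exists (exist _ j (fintype.subsetP Ce j jC)); rewrite ffunE eqxx.
Qed.

Definition pull (g : weights R V) e x : R := g e (restrict e x).

Lemma linear_forms_pull (H : {set {set J}}) (nu : weights R V) (tau : R) :
  (forall n : forall e : {set J}, {ffun {j : J | j \in e} -> bool} -> bool,
    `| avg (fun x : vprod V [set: J] * vprod V [set: J] =>
         \prod_(e in H) \prod_(w : {ffun {j : J | j \in e} -> bool})
            nu e (twisted x.1 x.2 w) ^+ n e w) - 1 | <= tau) ->
  linear_forms H (pull nu) tau.
Proof.
move=> lf n; have := lf (fun e w => n e (second w)).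
rewrite (avg_pair (fun p q => \prod_(e in H) \prod_(w : {ffun {j : J | j \in e} -> bool})
            nu e (twisted p q w) ^+ n e (second w))) avg_full.
suff -> : \E_ x (\E_ q (\prod_(e in H) \prod_(w : {ffun {j : J | j \in e} -> bool})
            nu e (twisted (to_full x) q w) ^+ n e (second w))) =
          \E_ x (\E_ y nu_form H (pull nu) n x y) by [].
apply: eq_avg => x; rewrite avg_full; apply: eq_avg => y; apply: eq_bigr => e _.
rewrite prod_second; apply: eq_bigr => w _.
by rewrite twisted_mix.
Qed.

Lemma natprod_bool (I : finType) (b : I -> bool) :
  (\prod_(i : I) b i)%N = [forall i, b i] :> nat.
Proof.
have [/forallP a|/forallPn[i ni]] := boolP [forall i, b i].
  by rewrite big1 // => i _; rewrite a.
by rewrite (bigD1 i) //= (negbTE ni).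
Qed.

(** The parts are the fibres of the colours of the proper faces. A fibre is a
    product over the facets because every proper face lies in a facet. *)
Lemma splits_cells T (gam : colouring V) e (D : {set vprod V e}) :
  (forall f, f \proper e -> dep f (gam f)) ->
  (forall f x, f \proper e -> (gam f x < T)%N) ->
  (forall y z : vprod V e, face_colours T gam e (extend y) = face_colours T gam e (extend z) ->
     (y \in D) = (z \in D)) ->
  exists2 s, splits_into D s & (s <= num_cells J T)%N.
Proof.
move=> dgam gT DE; pose c (z : vprod V e) := face_colours T gam e (extend z).
pose P := preim_partition c D.
exists #|P|; last first.
  have -> : P = (fun a => [set y in D | a == c y]) @: (c @: D).
    rewrite -imset_comp; apply: eq_imset => x; apply/finset.setP => y.
    by rewrite !inE.
  apply: leq_trans (leq_imset_card _ _) _; exact: max_card.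
exists P; split=> //; first exact: preim_partitionP.
move=> A /imsetP[y yD ->].
exists (fun f => [set u | [forall g : {set J}, (g \subset f) && (g \proper e) ==>
   (gam g (extend u) == gam g (extend y))]]) => z.
rewrite natprod_bool; congr (nat_of_bool _).
have ext (f : {set J}) (fe : f \subset e) (g : {set J}) : g \subset f -> g \proper e ->
    gam g (extend (vrestr fe z)) = gam g (extend z).
  move=> gf ge; apply: dgam => // j jg.
  have jf := fintype.subsetP gf j jg.
  by rewrite (extendE _ jf) ffunE /= -extendE.
apply/idP/forallP => [|H].
  rewrite !inE => /andP[zD /eqP cc] f; rewrite inE; apply/forallP => g.
  apply/implyP => /andP[gf ge]; rewrite ext //.
  have := congr1 (@nat_of_ord _) (congr1 (fun h : {ffun {set J} -> 'I_T.+1} => h g) cc).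
  by rewrite /c !face_coloursE // => [->|h hx|h hx]; rewrite ?eqxx // gT.
have cE : c y = c z.
  apply/ffunP => g; rewrite !ffunE; case: ifP => // ge.
  have /properP[gsub [j je jg]] := ge.
  have gj : g \subset e :\ j by rewrite finset.subsetD1 gsub jg.
  have := H (exist _ (e :\ j) (boundary_setD1 je)); rewrite inE => /forallP/(_ g).
  by rewrite /= gj ge /= ext // => /eqP ->.
by rewrite !inE (DE _ _ (esym cE)) yD cE eqxx.
Qed.

Lemma complexity_exists e (D : {set vprod V e}) s : splits_into D s ->
  exists t, complexity D t /\ (t <= s)%N.
Proof.
move=> Ds; have ex : exists n, boolp.asbool (splits_into D n).
  by exists s; apply/boolp.asboolP.
case: (ex_minnP ex) => t /boolp.asboolP Dt tmin; exists t; split; last first.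
  by apply: tmin; apply/boolp.asboolP.
by split=> // n Dn; apply: tmin; apply/boolp.asboolP.
Qed.

Lemma removal_vprod (H : {set {set J}}) T (eps : R) (g : weights R V) gam E :
  removal H T eps (pull g) gam E ->
  exists E' : forall e : {set J}, {set vprod V e},
    (forall e : {set J}, e \in H ->
       exists t : nat, complexity (~: E' e) t /\ (t <= num_cells J T)%N) /\
    (forall x : vprod V [set: J], \prod_(e in H) (proj e x \in E' e)%:R = 0 :> R) /\
    (forall e : {set J}, e \in H ->
       avg (fun x : vprod V e => g e x * (x \in ~: E' e)%:R) <= eps).
Proof.
case=> dgam gT El Enone Ebound.
exists (fun e => [set z | E e (gam^~ (extend z))]).
have Eres e x : e \in H -> E e (gam^~ (extend (restrict e x))) = E e (gam^~ x).
  move=> eH; apply: El => // f fe; apply: (dgam e f eH fe) => j jf.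
  by rewrite extend_restrict // (fintype.subsetP (proper_sub fe)).
split; last split.
- move=> e eH.
  have [|s Ds sT] := splits_cells
    (D := ~: [set z : vprod V e | E e (gam^~ (extend z))])
    (fun f fe => dgam e f eH fe) (fun f x fe => gT e f x eH fe).
    move=> y z /ffunP yz; rewrite !inE; congr (~~ _); apply: El => // f fe.
    have := congr1 (@nat_of_ord _) (yz f).
    by rewrite !face_coloursE // => h hx; apply: gT eH hx.
  have [t [Dt ts]] := complexity_exists Ds; exists t; split=> //.
  exact: leq_trans sT.
- move=> x; have [x' ->] : exists x', x = to_full x'.
    by have [h _ hK] := to_full_bij; exists (h x).
  have [e eH nE] : exists2 e, e \in H & ~~ E e (gam^~ x').
    apply/exists_inP; rewrite -[X in is_true X]negbK negb_exists_in.
    by apply/negP => /forall_inP allE; apply: (Enone x') => e /allE; rewrite negbK.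
  by rewrite (bigD1 e) //= inE proj_full Eres // (negbTE nE) mul0r.
- move=> e eH; rewrite avg_restrict; apply: le_trans (Ebound e eH).
  rewrite le_eqVlt; apply/orP; left; apply/eqP; apply: eq_avg => x.
  by rewrite !inE Eres.
Qed.

End Bridge.

(** * The removal theorem *)

Lemma common_lower_bound (R : realType) (I : finType) (d : I -> R) : (forall i, 0 < d i) ->
  exists2 d0, 0 < d0 & forall i, d0 <= d i.
Proof.
move=> d0; have s0 : 0 <= \sum_i (d i)^-1 by apply: sumr_ge0 => i _; rewrite invr_ge0 ltW.
exists (1 + \sum_i (d i)^-1)^-1; first by rewrite invr_gt0 ltr_wpDr.
move=> i; rewrite -[leRHS]invrK lef_pV2 ?posrE ?invr_gt0 ?ltr_wpDr //.
rewrite (bigD1 i) //= addrCA lerDl addr_ge0 // sumr_ge0 // => j _.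
by rewrite invr_ge0 ltW.
Qed.

Theorem theorem2p12 (R : realType) (eps : R) (J : finType) (eps_gt0 : 0 < eps) :
  exists (delta : R) (T : nat), 0 < delta /\ (0 < T)%N /\
  forall (tau : nat -> R), (tau N @[N --> \oo] --> (0 : R))%classic ->
  exists N0 : nat,
  forall (r : nat) (H : {set {set J}}) (V : nat -> J -> finType)
         (nu : forall N : nat, weights R (V N)),
    (0 < r)%N ->
    uniform_hypergraph r H ->
    (forall (N : nat) (j : J), (0 < #|V N j|)%N) ->
    (forall N : nat, weights_le H (weights0 R (V N)) (nu N)) ->
    linear_forms_condition H nu tau ->
  forall N : nat, (N0 <= N)%N ->
  forall g : weights R (V N),
    weights_le H (weights0 R (V N)) g ->
    weights_le H g (nu N) ->
    avg (fun x : vprod (V N) [set: J] => \prod_(e in H) g e (proj e x))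
      <= delta ->
  exists E' : forall e : {set J}, {set vprod (V N) e},
    (forall e : {set J}, e \in H ->
       exists t : nat, complexity (~: E' e) t /\ (t <= T)%N) /\
    (forall x : vprod (V N) [set: J],
       \prod_(e in H) (proj e x \in E' e)%:R = 0 :> R) /\
    (forall e : {set J}, e \in H ->
       avg (fun x : vprod (V N) e => g e x * (x \in ~: E' e)%:R) <= eps).
Proof.
(* Constants for each [H] separately; there are finitely many of them. *)
have /boolp.choice[c cP] : forall H : {set {set J}}, exists c : nat * R * R,
    0 < c.1.2 /\ 0 < c.2 /\ forall r, (0 < r)%N -> uniform_hypergraph r H ->
    forall (V : J -> finType) (o : config V) (nu g : {set J} -> config V -> R) tau,
    (forall e, e \in H -> dep e (nu e)) -> (forall e, e \in H -> dep e (g e)) ->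
    linear_forms H nu tau -> tau <= c.2 ->
    (forall e x, e \in H -> 0 <= g e x <= nu e x) ->
    \E_ x (\prod_(e in H) g e x) <= c.1.2 ->
    exists gam E, removal H c.1.1 eps g gam E.
  move=> H; have [[r [r0 uH]]|none] :=
    boolp.pselect (exists r, (0 < r)%N /\ uniform_hypergraph r H); last first.
    exists (0%N, 1, 1); do 2!split=> //.
    by move=> r r0 uH; case: none; exists r.
  have [T [d [t [d0 t0 P]]]] := relative_removal r0 uH eps_gt0.
  by exists (T, d, t); do 2!split=> //; move=> _ _ _; apply: P.
have [d d0 dle] := common_lower_bound (fun H => (cP H).1).
have [t t0 tle] := common_lower_bound (fun H => (cP H).2.1).
exists d, (\max_(H : {set {set J}}) num_cells J (c H).1.1).+1; split=> //; split=> //.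
move=> tau /cvgrPdist_le/(_ t t0) [N0 _ HN0]; exists N0.
move=> r H V nu r0 uH V0 nu0 lf N N0N g g0 gnu small.
have o : config (V N).
  apply: finfun => j; exact: (enum_val (Ordinal (V0 N j))).
have tauN : tau N <= (c H).2.
  apply: le_trans (tle H); apply: le_trans (HN0 N N0N).
  by rewrite sub0r normrN ler_norm.
have lfN : linear_forms H (pull (nu N)) (tau N).
  by apply: (linear_forms_pull o) => n; apply: (lf n N).
have [||||gam [E rem]] := (cP H).2.2 r r0 uH (V N) o (pull (nu N)) (pull g) (tau N) _ _ lfN tauN.
- by move=> e _; apply: restrict_dep.
- by move=> e _; apply: restrict_dep.
- by move=> e x eH; apply/andP; split; [apply: g0 | apply: gnu].
- apply: le_trans (dle H); apply: le_trans small; rewrite (avg_full o).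
  rewrite le_eqVlt; apply/orP; left; apply/eqP; apply: eq_avg => x.
  by apply: eq_bigr => e _; rewrite proj_full.
have [E' [comp rest]] := removal_vprod o rem; exists E'; split=> // e eH.
have [s [cs sT]] := comp e eH; exists s; split=> //.
by apply: leq_trans sT _; apply: leqW; apply: (leq_bigmax H).
Qed.
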